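(* Assume that $b$ satisfies (A3) and (A5). For $\varepsilon>0$ let $X^{\varepsilon}$ be the unique strong solution of $$dX_t^{\varepsilon}=b(X_t^{\varepsilon})\,dt+\varepsilon\,dW_t,\qquad X_0^{\varepsilon}=0 ,$$ and define $Y_t^{\varepsilon}=|X_t^{\varepsilon}|^2$. Then, for any $r_0>0$, the exit time $\tau^0$, defined as the first hitting time of the boundary point $r_0$ by the limiting process $Y^0(\cdot)=\lim_{\varepsilon\to0}Y^{\varepsilon}(\cdot)$, satisfies $$\int_0^{r_0}\frac{1}{g_{\max}(y)}\,dy\ \le\ \mathbb E\big[\tau^0\big]\ \le\ \int_0^{r_0}\frac{1}{g_{\min}(y)}\,dy<\infty .$$
   Context: $W$ is a $d$-dimensional standard Brownian motion on a filtered probability space $(\Omega,\mathcal F,\{\mathcal F_t\},\mathbb P)$ satisfying the usual conditions. The drift $b:\mathbb R^d\to\mathbb R^d$ is measurable and bounded, which guarantees a unique strong solution of the SDE. The limit defining $Y^0$ is the zero-noise limit (weak limit in law on $C([0,T])$, $T>0$), i.e. $Y^0=|X^0|^2$ with $X^0$ the weak limit of $X^{\varepsilon}$. For $y\ge0$ define $$g_{\min}(y)=\min_{\{x:\,|x|^2=y\}\cap\mathcal D(b)}2\langle b(x),x\rangle,\qquad g_{\max}(y)=\max_{\{x:\,|x|^2=y\}\cap\mathcal D(b)}2\langle b(x),x\rangle,$$ where $\mathcal D(b)$ is the domain of $b$. (A3) $b$ is measurable and locally bounded, $b(0)=0$, $0\notin\mathrm{Int}\{x\in\mathbb R^d:b(x)=0\}$,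 and $\langle b(x),x\rangle\ge0$ for all $x\in\mathbb R^d$. (A5) For any $r>0$, $0<\int_0^r\frac{1}{g_{\max}(y)}\,dy\le\int_0^r\frac{1}{g_{\min}(y)}\,dy<+\infty$, and $g_{\min}$, $g_{\max}$ are continuously differentiable on $(0,\infty)$. *)

(* Defs.v *)
From HB Require Import structures.
From mathcomp Require Import all_boot all_order all_algebra.
From mathcomp Require Import all_classical all_reals all_analysis.

Set Implicit Arguments.
Unset Strict Implicit.
Unset Printing Implicit Defensive.

Import Order.TTheory GRing.Theory Num.Theory.
Import numFieldNormedType.Exports.

Local Open Scope classical_set_scope.
Local Open Scope ring_scope.

(* The library norm `|x| on 'rV[R]_n is the sup norm, hence the Euclidean
   structure is introduced here. *)
Definition dotv (R : realType) (n : nat) (x y : 'rV[R]_n) : R :=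
  \sum_i x ord0 i * y ord0 i.

Definition sqnorm (R : realType) (n : nat) (x : 'rV[R]_n) : R := dotv x x.

Definition borel_set (T : topologicalType) : set (set T) := <<s @open T >>.

Definition borel_fun (S T : topologicalType) (f : S -> T) : Prop :=
  forall B, borel_set B -> borel_set (f @^-1` B).

(* The drift is only measurable, so an extremum over a sphere need not be
   attained; inf and sup are the min and max whenever these exist. *)
Definition g_min (R : realType) (n : nat) (b : 'rV[R]_n -> 'rV[R]_n) (y : R)
  : R := inf [set 2 * dotv (b x) x | x in [set x | sqnorm x = y]].

Definition g_max (R : realType) (n : nat) (b : 'rV[R]_n -> 'rV[R]_n) (y : R)
  : R := sup [set 2 * dotv (b x) x | x in [set x | sqnorm x = y]].

(* int_0^r dy / g(y). The inverse is taken in \bar R, where 0^-1 = +oo, and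
   not in R, where 0^-1 = 0. *)
Definition int_inv (R : realType) (g : R -> R) (r : R) : \bar R :=
  (\int[@lebesgue_measure R]_(y in `]0%R, r[) ((g y)%:E)^-1)%E.

Definition C1_pos (R : realType) (g : R -> R) : Prop :=
  {in `]0, +oo[, forall y, derivable g y 1} /\
  {in `]0, +oo[, continuous (derive1 g)}.

Record condA3 (R : realType) (n : nat) (b : 'rV[R]_n -> 'rV[R]_n) : Prop :=
  CondA3 {
    A3_measurable : borel_fun b;
    A3_locally_bounded : forall x : 'rV[R]_n, bounded_near b (nbhs x);
    A3_zero : b 0 = 0;
    A3_zero_notin_interior : ~ ([set x | b x = 0]°) 0;
    A3_outward : forall x, 0 <= dotv (b x) x }.

Record condA5 (R : realType) (n : nat) (b : 'rV[R]_n -> 'rV[R]_n) : Prop :=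
  CondA5 {
    A5_integrals : forall r : R, 0 < r ->
      [/\ (0 < int_inv (g_max b) r)%E,
          (int_inv (g_max b) r <= int_inv (g_min b) r)%E &
          (int_inv (g_min b) r < +oo)%E];
    A5_g_min_C1 : C1_pos (g_min b);
    A5_g_max_C1 : C1_pos (g_max b) }.

(* Processes and filtrations are indexed by R; only times t >= 0 matter. *)

Record usual_conditions (R : realType) (d : measure_display)
    (T : measurableType d) (P : probability T R) (F : R -> set (set T))
    : Prop := UsualConditions {
  filtration_sigma_algebra : forall t : R, 0 <= t -> sigma_algebra setT (F t);
  filtration_measurable : forall t : R, 0 <= t -> F t `<=` measurable;
  filtration_le : forall s t : R, 0 <= s -> s <= t -> F s `<=` F t;
  probability_complete : measure_is_complete P;
  filtration_negligible : forall A, P.-negligible A -> F 0 A;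
  filtration_right_continuous : forall t : R, 0 <= t ->
    \bigcap_(s in [set s | t < s]) F s = F t }.

Definition adapted (R : realType) (T : Type) (V : topologicalType)
    (F : R -> set (set T)) (X : R -> T -> V) : Prop :=
  forall t : R, 0 <= t -> forall B, borel_set B -> F t (X t @^-1` B).

Definition continuous_path (R : realType) (V : topologicalType) (f : R -> V)
  : Prop := {within `[0, +oo[, continuous f}.

(* The increment W_t - W_s is independent of F_s, with law N(0, (t - s) I_n),
   i.e. its coordinates are independent N(0, t - s); the second parameter of
   normal_prob is the standard deviation. *)
Record brownian_motion (R : realType) (n : nat) (d : measure_display)
    (T : measurableType d) (P : probability T R) (F : R -> set (set T))
    (W : R -> T -> 'rV[R]_n) : Prop := BrownianMotion {
  brownian_adapted : adapted F W;
  brownian_start : {ae P, forall w, W 0 w = 0};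
  brownian_continuous : {ae P, forall w, continuous_path (W ^~ w)};
  brownian_independent : forall s t : R, 0 <= s -> s < t ->
    forall (A : set T) (B : set 'rV[R]_n), F s A -> borel_set B ->
    P (A `&` [set w | B (W t w - W s w)]) =
    (P A * P [set w | B (W t w - W s w)%R])%E;
  brownian_gaussian : forall s t : R, 0 <= s -> s < t ->
    forall B : 'I_n -> set R, (forall i, measurable (B i)) ->
    P [set w | forall i, B i ((W t w - W s w) ord0 i)] =
    (\prod_(i < n) normal_prob 0 (Num.sqrt (t - s)) (B i))%E }.

(* dX = b(X) dt + eps dW, X_0 = 0, on the given filtered space and for the
   given W. The noise is additive, so no stochastic integral is involved. *)
Record strong_solution (R : realType) (n : nat) (d : measure_display)
    (T : measurableType d) (P : probability T R) (F : R -> set (set T))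
    (W : R -> T -> 'rV[R]_n) (b : 'rV[R]_n -> 'rV[R]_n) (eps : R)
    (X : R -> T -> 'rV[R]_n) : Prop := StrongSolution {
  solution_adapted : adapted F X;
  solution_continuous : {ae P, forall w, continuous_path (X ^~ w)};
  solution_eq : {ae P, forall w, forall t : R, 0 <= t -> forall i,
    X t w ord0 i =
    (\int[@lebesgue_measure R]_(s in `[0%R, t]) (b (X s w) ord0 i))%R
    + eps * W t w ord0 i} }.

Record continuous_process (R : realType) (n : nat) (d : measure_display)
    (T : measurableType d) (X : R -> T -> 'rV[R]_n) : Prop :=
  ContinuousProcess {
    process_measurable : forall t : R, 0 <= t -> forall B, borel_set B ->
      measurable (X t @^-1` B);
    process_continuous : forall w, continuous_path (X ^~ w) }.

(* C([0, T]; R^n), as a subset of the functions R -> R^n endowed with the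
   topology of uniform convergence on [0, T]. That topology identifies functions
   that agree on [0, T]. *)
Definition C_upto (R : realType) (n : nat) (T : R)
  : set {uniform` `[0, T] -> 'rV[R]_n} :=
  [set f | {within `[0, T], continuous (f : R -> 'rV[R]_n)}].
Arguments C_upto {R} n T.

(* Weak convergence of the laws of X^eps, as eps -> 0+, to the law of X0 on
   C([0, T]; R^n), for every T > 0. *)
Definition zero_noise_limit (R : realType) (n : nat)
    (d : measure_display) (S : measurableType d) (P : probability S R)
    (X : R -> R -> S -> 'rV[R]_n)
    (d0 : measure_display) (S0 : measurableType d0) (P0 : probability S0 R)
    (X0 : R -> S0 -> 'rV[R]_n) : Prop :=
  forall T : R, 0 < T ->
  forall H : {uniform` `[0, T] -> 'rV[R]_n} -> R,
    [bounded H f | f in C_upto n T] ->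
    {within C_upto n T, continuous H} ->
    ('E_P[fun w => H (X eps ^~ w)] @[eps --> 0^'+] -->
     'E_P0[fun w => H (X0 ^~ w)])%E.

Definition hitting_time (R : realType) (y : R -> R) (r : R) : \bar R :=
  ereal_inf [set t%:E | t in [set t | 0 <= t /\ y t = r]].

(* Main.v *)
Require Import Defs.
From HB Require Import structures.
From mathcomp Require Import all_boot all_order all_algebra.
From mathcomp Require Import all_classical all_reals all_analysis.
From mathcomp Require Import ring lra measurable_realfun.

(** The squared norm Y = |X|^2 of the solution has the radial drift 2 <b(x), x>,
    which on the sphere |x|^2 = y lies between g_min y and g_max y, plus noise
    terms that are small with eps^2. Without noise, a path with radial drift g
    takes the time int_0^r dy / g(y) to reach r. The two bounds express this by
    test functions: if the generator g U' + s (n U' + 2 y U''), with s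
    proportional to eps^2, is at most c0 below the level r and U >= 0 above it,
    then Dynkin's formula compares the mean exit time with U 0.

    For the upper bound, U is the mean exit time for the slowest radial drift
    g_min, obtained by solving an ordinary differential equation
    ([upper_test_function]); U 0 is at most int_inv (g_min b) r plus a small
    error, for every value of eps. For the lower bound, U is independent of eps
    with U' close to 1 / g_max ([lower_test_function]). Positivity of g_min and
    g_max away from 0 is forced by the integrability of 1 / g_min
    ([pos_of_int_inv]): a C1 function with a zero has a reciprocal that is not
    integrable.

    Dynkin's formula is proved on a grid of times, as an inequality
    ([dynkin_grid]). Each step uses the equation for X, a second-order expansion,
    the independence of the increment of W from the past, and the moments of the
    normal law. The drift b being only measurable, its contribution is
    bounded along the path by the inequality for p * 2 <x, b(x)>, not by the
    value of b at the grid time ([drift_modulus]).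

    The mean exit time must then pass to the weak limit. The hitting time is not
    a continuous functional of the path, so it is replaced by soft hitting times
    ([soft_hit]), infima over t of t plus a penalty for not having reached the
    level. They are bounded and continuous in the uniform norm, they are at most
    the hitting time, and they are sandwiched between grid occupation times for
    slightly different levels. The bounds for positive noise
    ([noisy_soft_hit_upper], [noisy_soft_hit_lower]) therefore hold in the limit;
    monotonicity and Fatou's lemma turn them into bounds for the hitting time
    ([hitting_time_mean_ge], [hitting_time_mean_le]), and the levels are let
    tend to r0 by continuity of int_inv in its end point. *)

Set Implicit Arguments.
Unset Strict Implicit.
Unset Printing Implicit Defensive.

Import Order.TTheory GRing.Theory Num.Theory.
Import numFieldNormedType.Exports.

Local Open Scope classical_set_scope.
Local Open Scope ring_scope.

(** * Calculus on the line *)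

Section analysis.
Context {R : realType}.
Local Notation mu := (@lebesgue_measure R).

Lemma uniformly_continuous_segment (V : normedModType R) (f : R -> V) (A B : R) :
  continuous f -> forall e, 0 < e -> exists2 d, 0 < d &
    forall x y, A <= x <= B -> A <= y <= B -> `|x - y| < d -> `|f x - f y| < e.
Proof.
move=> cf e e0.
have e20 : 0 < e / 2 by rewrite divr_gt0.
have := @segment_compact R A B.
move=> /compact_near_coveringP.
move=> /(_ R (0^'+) (fun d z => forall y, `|z - y| < d -> `|f z - f y| < e)).
case.
- move=> x _.
  have /cvgrPdist_lt /(_ _ e20) := cf x.
  move=> [r /= r0 xr].
  exists (ball x (r / 2), [set d | 0 < d < r / 2]).
    split => /=; first by apply: nbhsx_ballx; rewrite divr_gt0.
    exists (r / 2) => /=; first by rewrite divr_gt0.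
    move=> d /=; rewrite sub0r normrN => dr d0.
    by rewrite d0 /= (le_lt_trans _ dr) // ler_norm.
  move=> [z d] [/= xz /andP[d0 dr]] y zy.
  have fz := xr z; have fy := xr y.
  rewrite /ball/= in fz fy xz.
  rewrite -(subrKA (f x)) addrC.
  apply: le_lt_trans (ler_normD _ _) _.
  rewrite [X in _ < X](splitr e) ltrD //.
    apply: fy; rewrite (_ : x - y = (x - z) + (z - y)); last by lra.
    apply: le_lt_trans (ler_normD _ _) _.
    by rewrite [X in _ < X](splitr r) ltrD// (lt_trans zy).
  by rewrite distrC; apply: fz; rewrite (lt_trans xz) // ltr_pdivrMr // ltr_pMr // ltr1n.
- move=> d /= d0 dP.
  exists (d / 2); first by rewrite divr_gt0.
  move=> x y xAB _ xy.
  apply: (dP (d / 2)) => //=.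
  + by rewrite sub0r normrN gtr0_norm ?divr_gt0// ltr_pdivrMr // ltr_pMr // ltr1n.
  + by rewrite divr_gt0.
Qed.

Lemma bounded_segment (f : R -> R) (A B : R) : continuous f ->
  exists2 M, 0 < M & forall x, A <= x <= B -> `|f x| <= M.
Proof.
move=> cf; have [BA|AB] := ltP B A.
  by exists 1 => // x /andP[Ax /(le_trans Ax)]; rewrite leNgt BA.
have /(EVT_max AB) : {within `[A, B], continuous (fun x => `|f x|)}.
  by apply: continuous_subspaceT => x; apply: continuous_comp; [exact: cf|exact: norm_continuous].
move=> [c _ cP]; exists (`|f c| + 1); first by rewrite ltr_wpDl.
by move=> x xAB; rewrite (le_trans (cP x _)) ?lerDl// in_itv.
Qed.

(** The fundamental theorem of calculus only differentiates inside an interval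
    on which the integral starts. Being constant on the negative axis, f minus
    its value at 0 has a primitive that starts at -1 and vanishes up to 0. *)
Lemma primitive_exists (f : R -> R) : continuous f ->
  (forall y, y <= 0 -> f y = f 0) ->
  exists F : R -> R, forall x : R, is_derive x 1 F (f x).
Proof.
move=> cf f0.
pose g x := f x - f 0.
have cg : continuous g by move=> x; apply: cvgB; [exact: cf|exact: cvg_cst].
pose G x := \int[mu]_(t in `[-1, x]) g t.
have dG (x : R) : is_derive x 1 G (g x).
  have [x0|x0] := ltP x 0.
    have -> : g x = 0 by rewrite /g f0 ?subrr// ltW.
    apply: (@near_eq_is_derive _ _ _ (cst 0)) => //.
    near=> y; rewrite /G /= (@eq_Rintegral _ _ _ _ _ (cst 0)); last first.
      move=> t; rewrite inE /= in_itv /= => /andP[_ ty].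
      have yx : y <= 0 by near: y; exact: (lt_le_nbhsl x0).
      by rewrite /g f0 ?subrr // (le_trans ty).
    by rewrite Rintegral_cst // mul0r.
  have x1 : x < x + 1 by rewrite ltrDl.
  have xm : (-1 : R) < x by rewrite (lt_le_trans _ x0)// ltrN10.
  have ig : mu.-integrable `[-1, (x + 1)] (EFin \o g).
    apply: continuous_compact_integrable; first exact: segment_compact.
    exact: continuous_subspaceT.
  have [d1 d2] := continuous_FTC1_closed x1 ig xm (cg x).
  by rewrite -d2 derive1E; exact/derivableP.
exists (fun x => G x + f 0 * x) => x.
have := dG x => dGx.
apply: is_derive_eq; rewrite /g /=.
by rewrite scaler1 ; lra.
Unshelve. all: by end_near. Qed.

End analysis.

Section analysis2.
Context {R : realType}.

(** In these forms of the derivation rules the derivatives of the operands are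
    premises and the derivative of the result is syntactic, so that a
    derivative is computed by composing proof terms and adjusted once, by
    [derive_eq]. *)
Section derivation_rules.
Implicit Types (f g : R -> R) (x a b c : R).

Lemma derive_eq f x a b : is_derive x 1 f a -> a = b -> is_derive x 1 f b.
Proof. by move=> ? <-. Qed.

Lemma derive_const c x : is_derive x 1 (fun=> c) 0.
Proof. exact: is_derive_cst. Qed.

Lemma derive_ident x : is_derive x 1 (fun y => y) 1.
Proof. exact: is_derive_id. Qed.

Lemma derive_add f g x a b : is_derive x 1 f a -> is_derive x 1 g b ->
  is_derive x 1 (fun y => f y + g y) (a + b).
Proof. by move=> fa gb; exact: is_deriveD. Qed.

Lemma derive_sub f g x a b : is_derive x 1 f a -> is_derive x 1 g b ->
  is_derive x 1 (fun y => f y - g y) (a - b).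
Proof. by move=> fa gb; exact: is_deriveB. Qed.

Lemma derive_opp f x a : is_derive x 1 f a -> is_derive x 1 (fun y => - f y) (- a).
Proof. by move=> fa; exact: is_deriveN. Qed.

Lemma derive_mul f g x a b : is_derive x 1 f a -> is_derive x 1 g b ->
  is_derive x 1 (fun y => f y * g y) (f x * b + g x * a).
Proof. by move=> fa gb; exact: is_deriveM. Qed.

Lemma derive_mulr c f x a : is_derive x 1 f a ->
  is_derive x 1 (fun y => c * f y) (c * a).
Proof.
move=> fa; apply: derive_eq (derive_mul (derive_const c x) fa) _.
by rewrite mulr0 addr0.
Qed.

Lemma derive_inv f x a : f x != 0 -> is_derive x 1 f a ->
  is_derive x 1 (fun y => (f y)^-1) (- a / f x ^+ 2).
Proof.
move=> fx0 fa; apply: derive_eq (is_deriveV fx0 fa) _.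
by rewrite /GRing.scale /= mulNr mulNr mulrC.
Qed.

Lemma derive_comp f g x a b : is_derive (g x) 1 f a -> is_derive x 1 g b ->
  is_derive x 1 (fun y => f (g y)) (a * b).
Proof. exact: is_derive1_comp. Qed.

Lemma derive_exp f x a : is_derive x 1 f a ->
  is_derive x 1 (fun y => expR (f y)) (expR (f x) * a).
Proof. by move=> fa; exact: (derive_comp (is_derive_expR (f x)) fa). Qed.

End derivation_rules.

Lemma is_derive_continuous (f f' : R -> R) :
  (forall x : R, is_derive x 1 f (f' x)) -> continuous f.
Proof.
move=> df x; apply/differentiable_continuous/derivable1_diffP.
exact: (@ex_derive _ _ _ _ _ _ _ (df x)).
Qed.

Lemma mean_value_bounds (f f' : R -> R) (a b m M : R) :
  (forall x : R, is_derive x 1 f (f' x)) -> a <= b ->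
  (forall x, a <= x <= b -> m <= f' x <= M) ->
  m * (b - a) <= f b - f a <= M * (b - a).
Proof.
move=> df ab mM.
have [c cab ->] := MVT_segment ab (fun x _ => df x)
  (continuous_subspaceT (is_derive_continuous df)).
move: cab; rewrite in_itv /= => /mM/andP[mc cM].
by rewrite !ler_wpM2r ?subr_ge0.
Qed.

Lemma le_of_derive_ge0 (f f' : R -> R) (a b : R) :
  (forall x : R, is_derive x 1 f (f' x)) -> a <= b ->
  (forall x, a <= x <= b -> 0 <= f' x) -> f a <= f b.
Proof.
move=> df ab f'0.
have [c cab E] := MVT_segment ab (fun x _ => df x)
  (continuous_subspaceT (is_derive_continuous df)).
by rewrite -subr_ge0 E mulr_ge0 ?subr_ge0// f'0// -in_itv.
Qed.

(** The positive part is only Lipschitz at 0; its square is C1, which is all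
    the smoothness that a cutoff needs here. *)
Definition sqpos (t : R) : R := Num.max 0 t ^+ 2.

Lemma is_derive_sqpos (t : R) : is_derive t 1 sqpos (2 * Num.max 0 t).
Proof.
have [t0|t0|t0] := ltgtP 0 t.
- apply: (@near_eq_is_derive _ _ _ (fun u : R => u * u)).
    by near=> u; rewrite /sqpos (max_idPr _)// ltW//; near: u; exact: lt_nbhsr.
  apply: derive_eq (derive_mul (derive_ident t) (derive_ident t)) _.
  by lra.
- rewrite mulr0.
  apply: (@near_eq_is_derive _ _ _ (cst 0)).
    by near=> u; rewrite /sqpos (max_idPl _) ?expr0n//; near: u; exact: lt_le_nbhsl.
- rewrite -t0 mulr0.
  have H : h^-1 *: ((sqpos \o shift (0:R)) (h *: 1) - sqpos (0:R)) @[h --> (0:R)^'] --> (0:R).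
    apply/cvgrPdist_le => e e0; near=> h.
    rewrite sub0r normrN /sqpos /= maxxx expr0n subr0 addr0 scaler1 normrM.
    have h0 : h != 0 by near: h; exact: nbhs_dnbhs_neq.
    have he : `|h| < e by near: h; apply: dnbhs0_lt.
    rewrite normfV ler_pdivrMl ?normr_gt0// normrX.
    have : `|Num.max 0 h| <= `|h| by rewrite /Num.max; case: ifP; rewrite ?normr0.
    have := normr_ge0 (Num.max 0 h).
    by nra.
  by split; [apply/cvg_ex; exists 0|apply/cvg_lim].
Unshelve. all: by end_near. Qed.

Lemma continuous_sqpos' : continuous (fun t : R => 2 * Num.max 0 t).
Proof.
move=> t; apply: cvgM; first exact: cvg_cst.
by apply: continuous_max; [exact: cvg_cst|exact: cvg_id].
Qed.

(** Two nested squares of positive parts: the inner one makes the cutoff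
    constant to the left of a, the outer one kills it to the right of b. *)
Lemma smooth_cutoff (a b : R) : a < b -> exists theta theta' : R -> R,
  [/\ forall x : R, is_derive x 1 theta (theta' x), continuous theta',
      forall x, x <= a -> theta x = 1 /\ theta' x = 0,
      forall x, b <= x -> theta x = 0 /\ theta' x = 0 &
      forall x, 0 <= theta x <= 1].
Proof.
move=> ab.
have ba0 : 0 < b - a by rewrite subr_gt0.
pose k := (b - a)^-1.
have k0 : 0 < k by rewrite invr_gt0.
pose u x := 1 - sqpos ((x - a) * k).
pose u' x := - (2 * Num.max 0 ((x - a) * k) * k).
have du (x : R) : is_derive x 1 u (u' x).
  have d0 : is_derive x 1 (fun x => (x - a) * k) k.
    apply: derive_eq (derive_mul (derive_sub (derive_ident x) (derive_const a x)) (derive_const k x)) _.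
    by rewrite mulr0 add0r subr0 mulr1.
  have d1 := @derive_comp sqpos (fun x => (x - a) * k) _ _ _ (is_derive_sqpos ((x - a) * k)) d0.
  by apply: derive_eq (derive_sub (derive_const 1 x) d1) _; rewrite sub0r.
exists (fun x => sqpos (u x)), (fun x => 2 * Num.max 0 (u x) * u' x).
have cu : continuous u by exact: is_derive_continuous du.
split.
- move=> x; exact: (@derive_comp sqpos u _ _ _ (is_derive_sqpos (u x)) (du x)).
- move=> x; apply: cvgM; first exact: (@continuous_comp _ _ _ u (fun t => 2 * Num.max 0 t) x (cu x) (@continuous_sqpos' _)).
  apply: cvgN; apply: cvgM; last exact: cvg_cst.
  apply: (@continuous_comp _ _ _ (fun x => (x - a) * k) (fun t => 2 * Num.max 0 t)).
    by apply: cvgM; [apply: cvgB; [exact: cvg_id|exact: cvg_cst]|exact: cvg_cst].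
  exact: continuous_sqpos'.
- move=> x xa; have xa0 : (x - a) * k <= 0 by rewrite pmulr_lle0// subr_le0.
  rewrite /u' /u /sqpos (max_idPl xa0) expr0n subr0 (max_idPr _)// expr1n.
  by rewrite mulr0 mul0r oppr0 mulr0.
- move=> x bx.
  have x1 : 1 <= (x - a) * k by rewrite ler_pdivlMr// mul1r lerB.
  have u0 : u x <= 0.
    by rewrite subr_le0 /sqpos (max_idPr _) ?(le_trans ler01)// expr_ge1// (le_trans ler01).
  by rewrite /sqpos (max_idPl u0) expr0n mulr0 mul0r.
- move=> x; rewrite /sqpos sqr_ge0 /= expr_le1// ?le_max ?lexx// ge_max ler01 /=.
  by rewrite /u lerBlDr lerDl /sqpos sqr_ge0.
Unshelve. all: by end_near. Qed.

(** The remainder of p, then that of U, is controlled by the mean value theorem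
    from the oscillation of dp, which is uniform for y in a segment. The
    uniformity is the point: y will be a random position. *)
Lemma taylor2 (U p dp : R -> R) (A B : R) :
  (forall x : R, is_derive x 1 U (p x)) -> (forall x : R, is_derive x 1 p (dp x)) ->
  continuous dp -> forall e, 0 < e -> exists2 d, 0 < d &
  forall y D, A <= y <= B -> `|D| < d ->
    `|U (y + D) - U y - p y * D - 2^-1 * dp y * D ^+ 2| <= e * D ^+ 2.
Proof.
move=> dU dP cdp e e0.
have [d d0 dd] := uniformly_continuous_segment (A - 1) (B + 1) cdp e0.
exists (Num.min d 1); first by rewrite lt_min d0 ltr01.
move=> y D /andP[Ay yB]; rewrite lt_min => /andP[Dd D1].
have near_dp z : `|z - y| <= `|D| -> - e <= dp z - dp y <= e.
  move=> zy; rewrite -ler_norml ltW// dd//.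
  - move: (le_lt_trans zy D1); rewrite ltr_norml => /andP[]; lra.
  - lra.
  - exact: le_lt_trans Dd.
pose f1 (z : R) := p z - p y - dp y * (z - y).
have df1 (z : R) : is_derive z 1 f1 (dp z - dp y).
  apply: derive_eq (derive_sub (derive_sub (dP z) (derive_const (p y) z))
    (derive_mulr (dp y) (derive_sub (derive_ident z) (derive_const y z)))) _.
  by rewrite !subr0 mulr1.
have f1b z : `|z - y| <= `|D| -> `|f1 z| <= e * `|D|.
  move=> zy.
  have f1y : f1 y = 0 by rewrite /f1 !subrr mulr0 subr0.
  have [yz|zy'] := leP y z.
    have := @mean_value_bounds f1 _ y z (- e) e df1 yz.
    case/(_ _)/andP.
      move=> x /andP[yx xz]; apply: near_dp; apply: le_trans zy.
      by rewrite !ger0_norm ?subr_ge0// lerD2r.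
    rewrite f1y subr0 => h1 h2; rewrite ler_norml.
    move: zy; rewrite (ger0_norm (_ : 0 <= z - y)) ?subr_ge0//.
    by move=> zy; apply/andP; split; nra.
  have := @mean_value_bounds f1 _ z y (- e) e df1 (ltW zy').
  case/(_ _)/andP.
    move=> x /andP[yx xz]; apply: near_dp; apply: le_trans zy.
    by rewrite !ler0_norm ?subr_le0 ?(ltW zy')// lerN2 lerD2r.
  rewrite f1y => h1 h2; rewrite ler_norml.
  move: zy; rewrite (ler0_norm (_ : z - y <= 0)) ?subr_le0 ?(ltW zy')//.
  by move=> zy; apply/andP; split; nra.
pose f0 (z : R) := U z - U y - p y * (z - y) - 2^-1 * dp y * ((z - y) * (z - y)).
have df0 (z : R) : is_derive z 1 f0 (f1 z).
  have dz := derive_sub (derive_ident z) (derive_const y z).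
  apply: derive_eq (derive_sub (derive_sub (derive_sub (dU z) (derive_const (U y) z))
    (derive_mulr (p y) dz)) (derive_mulr (2^-1 * dp y) (derive_mul dz dz))) _.
  by rewrite /f1; lra.
have f0y : f0 y = 0 by rewrite /f0 !subrr !mulr0 !subr0.
have -> : U (y + D) - U y - p y * D - 2^-1 * dp y * D ^+ 2 = f0 (y + D).
  by rewrite /f0 (_ : y + D - y = D) -?expr2 //; lra.
have [D0|D0] := leP 0 D.
  have := @mean_value_bounds f0 _ y (y + D) (- (e * `|D|)) (e * `|D|) df0.
  rewrite lerDl D0 => /(_ isT); case/(_ _)/andP.
    move=> x /andP[yx xz]; rewrite -ler_norml; apply: f1b.
    rewrite !ger0_norm ?subr_ge0//; lra.
  rewrite f0y subr0 addrC addKr (ger0_norm D0) ler_norml => h1 h2.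
  by rewrite expr2; apply/andP; split; nra.
have := @mean_value_bounds f0 _ (y + D) y (- (e * `|D|)) (e * `|D|) df0.
rewrite gerDl (ltW D0) => /(_ isT); case/(_ _)/andP.
  move=> x /andP[yx xz]; rewrite -ler_norml; apply: f1b.
  rewrite !ler0_norm ?subr_le0 ?(ltW D0)//; lra.
rewrite f0y (ltr0_norm D0) ler_norml => h1 h2.
by rewrite expr2; apply/andP; split; nra.
Qed.

End analysis2.

(** * The integral of 1/g *)

(** The integral of a nonnegative function is a supremum over the simple
    functions below it, hence monotone on all functions. Hitting times and
    functionals of a path are compared by this lemma without a proof that they
    are measurable. *)
Lemma ge0_le_integral_nonmeasurable d (T : measurableType d) (R : realType)
    (mu : {measure set T -> \bar R}) (D : set T) (f g : T -> \bar R) :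
  (forall x, D x -> (0 <= f x)%E) -> (forall x, D x -> (f x <= g x)%E) ->
  (\int[mu]_(x in D) f x <= \int[mu]_(x in D) g x)%E.
Proof.
move=> f0 fg; rewrite !ge0_integralE//; last first.
  by move=> x Dx; rewrite (le_trans (f0 x Dx))// fg.
apply: le_ereal_sup => _ [h hf <-]; exists h => // x.
apply: le_trans (hf x) _; rewrite /patch; case: ifPn => //.
by rewrite inE => /fg.
Qed.

(** In this section g may vanish at 0 and 1/g may blow up there; everything is
    computed on ]A, r[ with A > 0, where 1/g is replaced to the left of A by a
    constant. *)
Section inverse_integral.
Context {R : realType}.
Local Notation mu := (@lebesgue_measure R).
Variable g : R -> R.
Hypothesis cg : forall y : R, 0 < y -> {for y, continuous g}.
Hypothesis g0 : forall y : R, 0 < y -> 0 < g y.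

Lemma continuous_comp_max (A : R) : 0 < A -> continuous (fun y : R => g (Num.max y A)).
Proof.
move=> A0 y; apply: (@continuous_comp _ _ _ (fun y : R => Num.max y A) g).
  by apply: continuous_max; [exact: cvg_id|exact: cvg_cst].
by apply: cg; rewrite lt_max A0 orbT.
Qed.

Lemma measurable_inv_pos (D : set R) : D `<=` `]0, +oo[%classic ->
  measurable_fun D (fun y : R => ((g y)%:E)^-1%E : \bar R).
Proof.
move=> D0; apply: (measurable_funS (measurable_itv `]0, +oo[%R) D0).
apply: (eq_measurable_fun (fun y => ((g y)^-1)%:E)).
  by move=> y; rewrite inE /= in_itv /= andbT => y0; rewrite inver gt_eqF ?g0.
apply/measurable_EFinP.
apply: open_continuous_measurable_fun; first exact: interval_open.
move=> y; rewrite inE /= in_itv /= andbT => y0.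
by apply: cvgV; [rewrite gt_eqF ?g0|exact: cg].
Qed.

Lemma inverse_primitive (A r : R) : 0 < A -> A < r -> exists Phi : R -> R,
  (forall x : R, is_derive x 1 Phi (g (Num.max x A))^-1) /\
  (\int[mu]_(y in `]A, r[) ((g y)%:E)^-1 = (Phi r - Phi A)%:E)%E.
Proof.
move=> A0 Ar; pose f (y : R) := (g (Num.max y A))^-1.
have gm0 y : 0 < g (Num.max y A) by rewrite g0// lt_max A0 orbT.
have cf : continuous f.
  by move=> y; apply: cvgV; [rewrite gt_eqF|exact: continuous_comp_max].
have f0 y : y <= 0 -> f y = f 0.
  move=> y0; rewrite /f (max_idPr (ltW A0)) (max_idPr _)//.
  exact: (le_trans y0 (ltW A0)).
have [Phi dPhi] := primitive_exists cf f0.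
exists Phi; split => //.
transitivity (\int[mu]_(y in `[A, r]) (f y)%:E)%E.
  have mf D : measurable_fun D (fun y => (f y)%:E).
    by apply/measurable_EFinP/measurable_funTS; exact: continuous_measurable_fun.
  rewrite -integral_itv_bndo_bndc// -integral_itv_obnd_cbnd//.
  apply: eq_integral => y; rewrite inE /= in_itv /= => /andP[Ay yr].
  by rewrite inver gt_eqF ?g0 ?(lt_trans A0)// /f (max_idPl (ltW Ay)).
rewrite (@continuous_FTC2 _ f Phi)// ?EFinB//.
- exact: continuous_subspaceT.
- have cP := is_derive_continuous dPhi.
  split.
  + by move=> x _; exact: (@ex_derive _ _ _ _ _ _ _ (dPhi x)).
  + exact: cvg_at_right_filter (cP A).
  + exact: cvg_at_left_filter (cP r).
- by move=> x _; rewrite derive1E; exact: (@derive_val _ _ _ _ _ _ _ (dPhi x)).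
Qed.

Lemma int_inv_ge (A r : R) : 0 < A ->
  (\int[mu]_(y in `]A, r[) ((g y)%:E)^-1 <= int_inv g r)%E.
Proof.
move=> A0; apply: ge0_subset_integral => //.
- by apply: measurable_inv_pos => y /=; rewrite !in_itv /= => /andP[->].
- by move=> y /=; rewrite in_itv /= => /andP[y0 _]; rewrite inver gt_eqF ?g0// lee_fin invr_ge0 ltW// g0.
- by apply: subset_itvr; rewrite bnd_simp ltW.
Qed.

(** Monotone convergence along A = 1/(k+1). *)
Lemma int_inv_approx (r e : R) : 0 < r -> 0 < e -> (int_inv g r < +oo)%E ->
  exists A : R, [/\ 0 < A, A < r & (int_inv g r <= \int[mu]_(y in `]A, r[) ((g y)%:E)^-1 + e%:E)%E].
Proof.
move=> r0 e0 ifin.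
pose F (k : nat) : set R := `]k.+1%:R^-1, r[%classic.
have F0 k : F k `<=` `]0, +oo[%classic.
  by move=> y; rewrite /F /= !in_itv /= andbT => /andP[+ _]; apply: lt_trans.
have fF0 k x : F k x -> (0 <= ((g x)%:E)^-1)%E.
  by move=> /F0 /=; rewrite in_itv /= andbT => x0; rewrite inver gt_eqF ?g0// lee_fin invr_ge0 ltW// g0.
have ndF : nondecreasing_seq F.
  move=> m k mk; apply/subsetPset; apply: subset_itvr; rewrite bnd_simp.
  by rewrite lef_pV2 ?posrE// ler_nat.
have := @ge0_nondecreasing_set_cvg_integral _ (measurableTypeR R) R F (fun y => ((g y)%:E)^-1)%E mu ndF
  (fun i => measurable_itv _) (fun i => measurable_inv_pos (F0 i)) fF0.
have -> : \bigcup_i F i = `]0, r[%classic.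
  apply/seteqP; split => [y [k _]|y].
    by rewrite /F /= !in_itv /= => /andP[+ ->]; rewrite andbT; apply: lt_trans.
  rewrite /= in_itv /= => /andP[y0 yr].
  have [k] := ltr_add_invr y0; rewrite add0r => ky.
  by exists k => //; rewrite /F /= in_itv /= ky yr.
rewrite -/(int_inv g r) => cvgF.
have ige0 : (0 <= int_inv g r)%E.
  apply: integral_ge0 => y /=; rewrite in_itv /= => /andP[y0 _].
  by rewrite inver gt_eqF ?g0// lee_fin invr_ge0 ltW// g0.
have ifn : int_inv g r \is a fin_num by rewrite ge0_fin_numE.
apply: contrapT => nex.
have le_r k : (\int[mu]_(y in F k) ((g y)%:E)^-1 <= int_inv g r - e%:E)%E.
  rewrite leNgt; apply/negP => rk; apply: nex.
  have [kr|rk'] := ltP k.+1%:R^-1 r.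
    exists k.+1%:R^-1; split => //.
    by rewrite -leeBlDr// ltW.
  exists (r / 2); split; [by rewrite divr_gt0| |].
    by rewrite ltr_pdivrMr// ltr_pMr// ltr1n.
  have Fk0 : F k = set0 by rewrite /F set_itv_ge// bnd_simp -leNgt.
  move: rk; rewrite Fk0 integral_set0 => rk.
  rewrite -leeBlDr//; apply: (le_trans (ltW rk)).
  apply: integral_ge0 => y /=; rewrite in_itv /= => /andP[y0 _].
  by rewrite inver gt_eqF ?g0 ?(lt_trans _ y0) ?divr_gt0// lee_fin invr_ge0 ltW// g0// (lt_trans _ y0)// divr_gt0.
have : (int_inv g r <= int_inv g r - e%:E)%E.
  apply: (cvge_to_le cvgF).
  by near=> k; exact: le_r.
rewrite leeBrDr// -[leRHS]adde0 leeD2lE// lee_fin leNgt e0 //.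
Unshelve. all: by end_near. Qed.

End inverse_integral.

(** Near r0 > 0 the integrand is bounded, so the integral is Lipschitz in its
    end point. *)
Lemma int_inv_continuity {R : realType} (g : R -> R) (r0 e : R) :
  (forall y : R, 0 < y -> {for y, continuous g}) -> (forall y : R, 0 < y -> 0 < g y) ->
  0 < r0 -> 0 < e ->
  exists del, [/\ 0 < del, del < r0 & forall r r', r0 - del <= r -> r <= r' -> r' <= r0 + del ->
    (int_inv g r' <= int_inv g r + e%:E)%E].
Proof.
move=> cg g0 r00 e0.
pose A := r0 / 2; have A0 : 0 < A by rewrite divr_gt0.
pose f (y : R) := (g (Num.max y A))^-1.
have gm0 y : 0 < g (Num.max y A) by rewrite g0// lt_max A0 orbT.
have cf : continuous f.
  by move=> y; apply: cvgV; [rewrite gt_eqF|exact: continuous_comp_max].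
have [M M0 fM] := bounded_segment A (2 * r0) cf.
pose del := Num.min A (e / (2 * M)).
have del0 : 0 < del by rewrite lt_min A0 divr_gt0// mulr_gt0.
have delA : del <= A by rewrite ge_min lexx.
have delM : M * (2 * del) <= e.
  by rewrite mulrCA mulrA [2 * M * _]mulrC -ler_pdivlMr ?mulr_gt0// ge_min lexx orbT.
have r0A : r0 = A + A by rewrite /A -splitr.
exists del; split => //; first by lra.
move=> r r' h1 h2 h3.
have Ar : A <= r by lra.
have r0' : 0 < r by lra.
have mg (D : set (measurableTypeR R)) : D `<=` `]0, +oo[%classic -> measurable_fun D (fun y : R => ((g y)%:E)^-1%E : \bar R).
  by move=> D0; exact: measurable_inv_pos.
have U : `]0, r'[%classic = `]0, r[%classic `|` `[r, r'[%classic :> set R.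
  by rewrite -itv_bndbnd_setU// bnd_simp.
have pos y : `]0, r'[%classic y -> (0 <= ((g y)%:E)^-1)%E.
  by rewrite /= in_itv /= => /andP[y0 _]; rewrite inver gt_eqF ?g0// lee_fin invr_ge0 ltW// g0.
have split_int : (int_inv g r' = int_inv g r + \int[@lebesgue_measure R]_(y in `[r, r'[) ((g y)%:E)^-1)%E.
  rewrite /int_inv U; apply: ge0_integral_setU.
  - exact: measurable_itv.
  - exact: measurable_itv.
  - by apply: mg => y; rewrite -U /= !in_itv /= => /andP[-> _].
  - by move=> y; rewrite -U; exact: pos.
  - apply/disj_setPS => y [] /=; rewrite !in_itv /= => /andP[_ yr] /andP[ry _].
    by move: yr; rewrite ltNge ry.
rewrite split_int leeD2l//.
apply: (@le_trans _ _ (\int[@lebesgue_measure R]_(y in `[r, r'[) (cst M%:E y))%E).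
  apply: ge0_le_integral_nonmeasurable => y.
    by move=> yI; apply: pos; rewrite U; right.
  rewrite /= in_itv /= => /andP[ry yr']; rewrite inver gt_eqF ?g0 ?(lt_le_trans r0')// lee_fin.
  have := fM y; rewrite /f (max_idPl (le_trans Ar ry)) ger0_norm ?invr_ge0; last first.
    by rewrite ltW// g0// (lt_le_trans r0').
  by apply; rewrite (le_trans Ar ry)/=; lra.
rewrite integral_cst//= lebesgue_measure_itv /= lte_fin.
case: ifP => _; last by rewrite mule0 lee_fin ltW.
rewrite -EFinB -EFinM lee_fin; apply: le_trans delM.
by rewrite ler_wpM2l ?(ltW M0)//; lra.
Qed.

Lemma integrable_of_bound d (T : measurableType d) (R : realType)
    (mu : {measure set T -> \bar R}) (A : set T) (f : T -> R) (M : R) :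
  measurable A -> (mu A < +oo)%E -> measurable_fun A f ->
  (forall x, A x -> `|f x| <= M) -> mu.-integrable A (EFin \o f).
Proof.
move=> mA Afin mf fM; apply: measurable_bounded_integrable => //.
exists M; split; first exact: num_real.
by move=> x Mx y Ay; apply: le_trans (fM y Ay) (ltW Mx).
Qed.

Lemma bounded_integrable d (T : measurableType d) (R : realType) (P : probability T R)
    (f : T -> R) (M : R) :
  measurable_fun setT f -> (forall w, `|f w| <= M) -> P.-integrable setT (EFin \o f).
Proof.
move=> mf fM; apply: (integrable_of_bound measurableT _ mf (fun w _ => fM w)).
by rewrite (le_lt_trans (probability_le1 _ _))// ltry.
Qed.

Section positivity.
Context {R : realType}.
Local Notation mu := (@lebesgue_measure R).

Lemma derivable_linear_bound (g : R -> R) (y0 : R) : derivable g y0 1 ->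
  exists C d : R, [/\ 0 < C, 0 < d & forall t, 0 < t < d -> `|g (y0 + t) - g y0| <= C * t].
Proof.
move=> dg; have [l /cvgrPdist_le /(_ 1 ltr01) [d /= d0 hd]] : exists l : R^o, (h^-1 *: ((g \o shift y0) (h *: (1:R)) - g y0) : R^o) @[h --> (0:R)^'] --> l.
  by apply/cvg_ex; exact: dg.
exists (`|l| + 1), d; split => //.
move=> t /andP[t0 td].
have := hd t; rewrite /= sub0r normrN gtr0_norm// => /(_ td); rewrite gt_eqF// => /(_ isT).
rewrite (_ : t%:A = t) ?[LHS]mulr1// (addrC t) => H.
have : `|t^-1 *: (g (y0 + t) - g y0)| <= `|l| + 1.
  rewrite -[X in `|X|](subKr l); apply: le_trans (ler_normB _ _) _.
  by rewrite lerD2l.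
by rewrite normrM normfV (gtr0_norm t0) ler_pdivrMl// mulrC.
Qed.

(** If g vanished at y0, differentiability would give g <= C (y - y0) to the
    right of y0, so 1/g would dominate 1 / (C (y - y0)). The integral of the
    latter over ]y0 + s, y0 + 2 s[ is at least 1 / (2 C) for every s, although
    the length of this interval tends to 0: this contradicts the absolute
    continuity of the integral. *)
Lemma pos_of_int_inv (g : R -> R) (y0 r : R) :
  (forall y, 0 < y -> 0 <= g y) -> 0 < y0 -> y0 < r ->
  derivable g y0 1 -> (int_inv g r < +oo)%E -> 0 < g y0.
Proof.
move=> g0 y00 y0r dg ifin; rewrite lt_neqAle g0// andbT; apply/eqP => gy0.
have [C [d [C0 d0 Cd]]] := derivable_linear_bound dg.
pose b := Num.min d (r - y0).
have b0 : 0 < b by rewrite lt_min d0 subr_gt0.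
pose h (y : R) := (C * (y - y0))^-1.
pose D : set R := `]y0, y0 + b[%classic.
have hpos y : D y -> 0 < h y.
  by rewrite /D /= in_itv /= => /andP[yy _]; rewrite invr_gt0 mulr_gt0// subr_gt0.
have mh : measurable_fun D h.
  apply: open_continuous_measurable_fun; first exact: interval_open.
  move=> y; rewrite inE /D /= in_itv /= => /andP[yy _].
  apply: cvgV; first by rewrite mulf_neq0// gt_eqF// subr_gt0.
  by apply: cvgM; [exact: cvg_cst|apply: cvgB; [exact: cvg_id|exact: cvg_cst]].
have hI : (\int[mu]_(y in D) (h y)%:E <= int_inv g r)%E.
  have Dsub : D `<=` `]0, r[%classic.
    move=> y; rewrite /D /= !in_itv /= => /andP[yy yb]; rewrite (lt_trans y00)//=.
    by apply: (lt_le_trans yb); rewrite -lerBrDl /b ge_min lexx orbT.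
  rewrite /int_inv integral_mkcond [leRHS]integral_mkcond.
  apply: ge0_le_integral_nonmeasurable => y _; rewrite /patch.
    by case: ifPn => //; rewrite inE => /hpos/ltW; rewrite lee_fin.
  case: ifPn => [|_].
    rewrite inE => Dy; rewrite mem_set; last exact: Dsub.
    rewrite inver; case: ifPn => [_|gy]; first exact: leey.
    have gyp : 0 < g y.
      rewrite lt_neqAle eq_sym gy/= g0//.
      by have := Dsub _ Dy; rewrite /= in_itv /= => /andP[].
    have := Dy; rewrite /D /= in_itv /= => /andP[yy yb].
    rewrite lee_fin lef_pV2 ?posrE// ?mulr_gt0 ?subr_gt0//.
    have := Cd (y - y0); rewrite subr_gt0 yy -gy0 subr0 (addrC y0) subrK => H.
    rewrite (le_trans (ler_norm _))// H//= ltrBlDl (lt_le_trans yb)// lerD2l.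
    by rewrite /b ge_min lexx.
  case: ifPn => //; rewrite inE /= in_itv /= => /andP[yp _].
  rewrite inver -[point]/(0%E : \bar R); case: ifPn => [_|_]; first exact: leey.
  by rewrite lee_fin invr_ge0 g0.
have ih : mu.-integrable setT (EFin \o (h \_ D)).
  apply/integrableP; split.
    by apply/measurable_EFinP; apply/(measurable_restrictT _ _).1; [exact: measurable_itv|exact: mh].
  apply: (le_lt_trans _ ifin); apply: (le_trans _ hI); rewrite [leRHS]integral_mkcond.
  rewrite le_eqVlt; apply/orP; left; apply/eqP; apply: eq_integral => y _.
  rewrite /= /patch; case: ifPn => [|_]; last by rewrite normr0.
  by rewrite inE => /hpos hy; rewrite gtr0_norm.
have e0 : 0 < (2 * C)^-1 by rewrite invr_gt0 mulr_gt0.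
have [del [del0 hdel]] := integral_normr_continuous ih e0.
pose s := Num.min (b / 2) (del / 2).
have s0 : 0 < s by rewrite lt_min !divr_gt0.
pose J : set R := `]y0 + s, y0 + s + s[%classic.
have sb : s + s <= b.
  by rewrite [leRHS](splitr b) lerD// /s ge_min lexx.
have JD : J `<=` D.
  move=> y; rewrite /J /D /= !in_itv /= => /andP[h1 h2].
  rewrite (lt_trans _ h1) ?ltrDl//= (lt_le_trans h2)// -addrA lerD2l//.
have muJ : mu J = s%:E.
  rewrite lebesgue_measure_itv /= lte_fin ltrDl s0 -EFinD; congr EFin.
  by rewrite [X in X - _]addrC addrK.
have sdel : s < del.
  by rewrite (le_lt_trans (_ : s <= del / 2))// ?ge_min ?lexx ?orbT// ltr_pdivrMr// ltr_pMr// ltr1n.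
have := hdel J (measurable_itv _).
have muJd : (mu J < del%:E)%E by rewrite muJ lte_fin.
move=> /(_ muJd); apply/negP; rewrite -leNgt.
have -> : (2 * C)^-1 = \int[mu]_(y in J) (C * (s + s))^-1.
  rewrite Rintegral_cst; last exact: measurable_itv.
  rewrite (_ : fine _ = s); last exact: (congr1 fine muJ).
  by field; rewrite !gt_eqF//= addr_gt0.
have mJ : measurable J by exact: measurable_itv.
apply: le_Rintegral => //.
- by apply: (@integrable_of_bound _ _ _ _ _ _ `|(C * (s + s))^-1|) => //; by rewrite (_ : _ J = s%:E) ?ltry//; exact: muJ.
- apply: (integrableS measurableT) => //; exact: (integrable_abse ih).
move=> y Jy; have Dy := JD _ Jy; have := hpos _ Dy.
rewrite /patch (mem_set Dy) => hy; rewrite gtr0_norm//; move: hy.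
rewrite /h invr_gt0 => hp.
move: Jy; rewrite /J /= in_itv /= => /andP[_ ys].
have hs : 0 < C * (s + s) by rewrite mulr_gt0// addr_gt0.
rewrite lef_pV2 ?posrE// ler_pM2l//; lra.
Qed.

End positivity.

(** * Test functions for the squared norm *)

(** Test functions are evaluated at squared norms, whence a bound on the half-line
    only. *)
Record C2_bounded (R : realType) (U p dp : R -> R) : Prop := C2Bounded {
  C2_derive1 : forall x : R, is_derive x 1 U (p x);
  C2_derive2 : forall x : R, is_derive x 1 p (dp x);
  C2_continuous : continuous dp;
  C2_bound : exists B, forall y, 0 <= y -> `|U y| <= B }.

Section test_functions.
Context {R : realType}.
Variable g : R -> R.
Hypothesis cg : forall y : R, 0 < y -> {for y, continuous g}.
Hypothesis g0 : forall y : R, 0 < y -> 0 < g y.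

Let gm (a : R) : 0 < a -> forall y, 0 < g (Num.max y a).
Proof. by move=> a0 y; rewrite g0// lt_max a0 orbT. Qed.

(** If X solves the equation with drift b and noise of intensity s, and
    g = 2 <b(x), x>, then |X|^2 has the generator
    U |-> g U' + s (n U' + 2 y U''), and the mean time to reach a level solves
    the equation generator = -1. This is the first-order equation for v = - U'.
    Its coefficient 2 s y degenerates at 0; the drift gt vanishes on [0, a] so
    that the regular solution is the constant 1 / (n s) there, and it is
    continued by an integrating factor expR K. *)
Lemma hitting_ode (n : nat) (s a : R) (gt : R -> R) : (0 < n)%N -> 0 < s -> 0 < a ->
  continuous gt -> (forall y, 0 <= gt y) -> (forall y, y <= a -> gt y = 0) ->
  exists v dv : R -> R, [/\ forall y : R, is_derive y 1 v (dv y), continuous dv,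
    forall y, y <= a -> v y = (n%:R * s)^-1 /\ dv y = 0,
    forall y, a <= y -> 2 * s * y * dv y + (gt y + n%:R * s) * v y = 1 &
    forall y, 0 <= y -> 0 < v y <= (n%:R * s)^-1].
Proof.
move=> n0 s0 a0 cgt gt0 gta.
pose m := n%:R * s; have m0 : 0 < m by rewrite mulr_gt0// ltr0n.
pose c (y : R) := (2 * s * Num.max y a)^-1.
have max0 y : 0 < Num.max y a by rewrite lt_max a0 orbT.
have c0 y : 0 < c y by rewrite invr_gt0 !mulr_gt0.
have cc : continuous c.
  move=> y; apply: cvgV; first by rewrite !mulf_neq0// gt_eqF.
  apply: cvgM; first exact: cvg_cst.
  by apply: continuous_max; [exact: cvg_id|exact: cvg_cst].
pose k y := (gt y + m) * c y.
have ck : continuous k.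
  move=> y; apply: cvgM; last exact: cc.
  by apply: cvgD; [exact: cgt|exact: cvg_cst].
have cE y : y <= a -> c y = (2 * s * a)^-1 by move=> ya; rewrite /c (max_idPr ya).
have k0 y : y <= 0 -> k y = k 0.
  by move=> y0; rewrite /k !gta ?cE// ?(le_trans y0) ?ltW.
have [K dK] := primitive_exists ck k0.
pose l y := expR (K y) * (gt y * c y / m).
have cl : continuous l.
  have cK := is_derive_continuous dK.
  move=> y; apply: cvgM.
    by apply: (continuous_comp (cK y)); exact: continuous_expR.
  apply: cvgM; last exact: cvg_cst.
  by apply: cvgM; [exact: cgt|exact: cc].
have l0 y : y <= a -> l y = 0 by move=> ya; rewrite /l gta// !mul0r mulr0.
have l0' y : y <= 0 -> l y = l 0.
  by move=> y0; rewrite !l0 ?(le_trans y0) ?ltW.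
have [L dL] := primitive_exists cl l0'.
pose Z y := expR (- K y) * (L y - L a).
pose v y := m^-1 - Z y.
pose dv y := c y - k y * v y.
have dv_ (y : R) : is_derive y 1 v (dv y).
  apply: derive_eq (derive_sub (derive_const m^-1 y)
    (derive_mul (derive_exp (derive_opp (dK y))) (derive_sub (dL y) (derive_const (L a) y)))) _.
  rewrite /dv /v /Z /k /l sub0r subr0 expRN.
  by field; rewrite !gt_eqF//= expR_gt0.
have cv := is_derive_continuous dv_.
have LA y : y <= a -> L y = L a.
  move=> ya; have := @mean_value_bounds _ L l y a 0 0 dL ya.
  case/(_ _)/andP; first by move=> x /andP[_ xa]; rewrite l0// lexx.
  by rewrite !mul0r subr_ge0 subr_le0 => h1 h2; apply/eqP; rewrite eq_le h1 h2.
have va y : y <= a -> v y = m^-1 by move=> ya; rewrite /v /Z LA// subrr mulr0 subr0.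
have dva y : y <= a -> dv y = 0.
  move=> ya; rewrite /dv va// /k gta// add0r mulrAC mulfV ?gt_eqF// mul1r subrr.
  by [].
exists v, dv; split => //.
- by move=> y; apply: cvgB; [exact: cc|apply: cvgM; [exact: ck|exact: cv]].
- by move=> y ya; split; [exact: va|exact: dva].
- move=> y ay; have y0 : 0 < y by exact: lt_le_trans ay.
  rewrite /dv /k /c (max_idPl ay) -/m.
  by field; rewrite !gt_eqF.
- move=> y y0; apply/andP; split; last first.
    rewrite -/m /v gerBl mulr_ge0 ?expR_ge0// subr_ge0.
    have [ya|ay] := leP y a; first by rewrite LA.
    apply: le_of_derive_ge0 dL (ltW ay) _ => x _.
    by rewrite /l mulr_ge0 ?expR_ge0// divr_ge0 ?(ltW m0)// mulr_ge0// ltW.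
  have dev (x : R) : is_derive x 1 (fun x => expR (K x) * v x) (expR (K x) * c x).
    apply: derive_eq (derive_mul (derive_exp (dK x)) (dv_ x)) _.
    by rewrite /dv; ring.
  have : expR (K 0) * v 0 <= expR (K y) * v y.
    apply: (le_of_derive_ge0 dev y0) => x _.
    by rewrite mulr_ge0 ?expR_ge0// ltW.
  rewrite (va _ (ltW a0)) => H; rewrite -(pmulr_rgt0 _ (expR_gt0 (K y))).
  by apply: lt_le_trans H; rewrite mulr_gt0 ?expR_gt0 ?invr_gt0.
Qed.

(** U is the mean hitting time for a drift gt <= g, with a cutoff between r and
    r'. As p <= 0, every drift z >= g is at least as favourable: p z <= p gt.
    The estimate of U 0 does not depend on s, because v + (s y v^2)' <= 1/g
    wherever gt = g: substituting the equation for v, the difference of the two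
    sides is g v^2 - 2 v + 1/g = (g v - 1)^2 / g plus a nonnegative term. *)
Lemma upper_test_function (n : nat) (s r r' e : R) : (0 < n)%N -> 0 < s ->
  0 < r -> r < r' -> 0 < e -> (int_inv g r' < +oo)%E -> 0 <= g 0 ->
  exists U p dp q : R -> R, [/\ C2_bounded U p dp, continuous q,
    forall y, 0 <= y -> forall z, g y <= z -> p y * z <= q y,
    forall y, 0 <= y <= r -> q y + s * (n%:R * p y + 2 * y * dp y) <= -1 &
    (forall y, 0 <= y -> 0 <= U y) /\ ((U 0)%:E <= int_inv g r' + e%:E)%E].
Proof.
move=> n0 s0 r0 rr' e0 ifin g00.
have n0' : 0 < n%:R :> R by rewrite ltr0n.
pose m := n%:R * s; have m0 : 0 < m by rewrite mulr_gt0.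
have r'0 : 0 < r' := lt_trans r0 rr'.
(* In ae, the first term bounds U 0 - U (2 a), and the second one is the boundary
   term s y v^2 at y = 2 a. *)
pose a := Num.min (r / 4) (e / (2 / m + 2 * s / m ^+ 2)).
have den0 : 0 < 2 / m + 2 * s / m ^+ 2 by rewrite addr_gt0// divr_gt0// ?mulr_gt0// exprn_gt0.
have a0 : 0 < a by rewrite lt_min !divr_gt0.
have ar : 4 * a <= r by rewrite mulrC -ler_pdivlMr// /a ge_min lexx.
have ae : 2 * a / m + s * (2 * a) / m ^+ 2 <= e.
  have : a <= e / (2 / m + 2 * s / m ^+ 2) by rewrite /a ge_min lexx orbT.
  by rewrite ler_pdivlMr//; lra.
have aa : a < 2 * a by lra.
have [chi [dchi [dchiE cdchi chi1 chi0 chi01]]] := smooth_cutoff aa.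
have cchi := is_derive_continuous dchiE.
pose gt y := (1 - chi y) * g (Num.max y a).
have cgt : continuous gt.
  move=> y; apply: cvgM; last exact: continuous_comp_max.
  by apply: cvgB; [exact: cvg_cst|exact: cchi].
have chi_ge0 y : 0 <= 1 - chi y by rewrite subr_ge0; case/andP: (chi01 y).
have gt0 y : 0 <= gt y by rewrite mulr_ge0// ltW// gm.
have gta y : y <= a -> gt y = 0 by move=> /chi1[E _]; rewrite /gt E subrr mul0r.
have gtg y : 0 <= y -> gt y <= g y.
  move=> y0; have [ya|ay] := leP y a.
    rewrite gta//; move: y0; rewrite le_eqVlt => /predU1P[<-//|/g0/ltW//].
  rewrite /gt (max_idPl (ltW ay)) ler_piMl ?(ltW (g0 (lt_trans a0 ay)))//.
  by rewrite gerBl; case/andP: (chi01 y).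
have gtE y : 2 * a <= y -> gt y = g y.
  move=> ay; rewrite /gt (chi0 _ ay).1 subr0 mul1r (max_idPl _)//.
  by rewrite (le_trans _ ay)// ltW.
have [v [dv [dvE cdv va vode v0]]] := hitting_ode n0 s0 a0 cgt gt0 gta.
have [th [dth [dthE cdth th1 th0 th01]]] := smooth_cutoff rr'.
pose p y := - (v y * th y).
pose dp y := - (v y * dth y + th y * dv y).
have dpE (y : R) : is_derive y 1 p (dp y) by exact: derive_opp (derive_mul (dvE y) (dthE y)).
have cp := is_derive_continuous dpE.
have cv := is_derive_continuous dvE.
have cth := is_derive_continuous dthE.
have cdp : continuous dp.
  move=> y; apply: cvgN; apply: cvgD; apply: cvgM;
    [exact: cv|exact: cdth|exact: cth|exact: cdv].
have p0 y : y <= 0 -> p y = p 0.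
  move=> y0; have ya := le_trans y0 (ltW a0).
  by rewrite /p (va _ ya).1 (va _ (ltW a0)).1 (th1 _ (le_trans y0 (ltW r0))).1 (th1 _ (ltW r0)).1.
have [P dP] := primitive_exists cp p0.
pose U y := P y - P r'.
have dU (y : R) : is_derive y 1 U (p y).
  by apply: derive_eq (derive_sub (dP y) (derive_const (P r') y)) _; rewrite subr0.
have vth y : 0 <= y -> 0 <= v y * th y <= v y.
  move=> y0; have /andP[h1 _] := v0 _ y0; have /andP[h2 h3] := th01 y.
  by rewrite mulr_ge0 ?(ltW h1)//= ler_piMr// ltW.
have p_le0 y : 0 <= y -> p y <= 0 by move=> /vth/andP[+ _]; rewrite oppr_le0.
have U_r' y : r' <= y -> U y = 0.
  move=> ry; apply/eqP; rewrite subr_eq0.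
  have := @mean_value_bounds _ P p r' y 0 0 dP ry.
  case/(_ _)/andP; first by move=> x /andP[rx _]; rewrite /p (th0 _ rx).1 mulr0 oppr0 lexx.
  by rewrite !mul0r subr_ge0 subr_le0 => h1 h2; rewrite eq_le h1 h2.
have U_dec x y : 0 <= x -> x <= y -> U y <= U x.
  move=> x0 xy; rewrite -lerN2.
  apply: (le_of_derive_ge0 (fun y => derive_opp (dU y)) xy) => z /andP[xz _].
  by rewrite oppr_ge0 p_le0// (le_trans x0).
have U_ge0 y : 0 <= y -> 0 <= U y.
  move=> y0; have [ry|yr] := leP r' y; first by rewrite U_r'.
  by rewrite -(U_r' _ (lexx r')) U_dec// ltW.
exists U, p, dp, (fun y => p y * gt y); split.
- split => //; exists (U 0) => y y0; rewrite ger0_norm ?U_ge0//.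
  exact: U_dec.
- by move=> y; apply: cvgM; [exact: cp|exact: cgt].
- by move=> y y0 z gz; rewrite ler_wnM2l ?p_le0// (le_trans (gtg _ y0)).
- move=> y /andP[y0 yr]; rewrite /dp /p (th1 _ yr).1 (th1 _ yr).2 mulr0 !mulr1 add0r mul1r.
  have [ya|ay] := leP y a.
    rewrite gta// (va _ ya).1 (va _ ya).2 -/m oppr0 !mulr0 add0r addr0.
    have sm : s * n%:R / m = 1 by rewrite (mulrC s) -/m mulfV ?gt_eqF.
    lra.
  by have := vode y (ltW ay); nra.
split => //.
have [Phi [dPhi PhiE]] := inverse_primitive cg g0 (ltac:(lra) : 0 < 2 * a) (ltac:(lra) : 2 * a < r').
have : (( Phi r' - Phi (2 * a))%:E <= int_inv g r')%E.
  by rewrite -PhiE; apply: int_inv_ge => //; lra.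
move=> /(leeD2r e%:E); apply: le_trans; rewrite -EFinD lee_fin.
have step1 : U 0 - U (2 * a) <= 2 * a / m.
  have := @mean_value_bounds _ U p 0 (2 * a) (- m^-1) 0 dU (ltac:(lra) : 0 <= 2 * a).
  case/(_ _)/andP; last by lra.
  move=> x /andP[x0 _]; rewrite p_le0// andbT lerN2.
  have /andP[_ h1] := vth _ x0; have /andP[_ h2] := v0 _ x0.
  exact: le_trans h1 h2.
have step2 : U (2 * a) <= Phi r' - Phi (2 * a) + s * (2 * a) / m ^+ 2.
  pose Lam y := Phi y + (U y - s * (y * (v y * v y))).
  have dLam (y : R) : is_derive y 1 Lam ((g (Num.max y (2 * a)))^-1 +
      (p y - s * (y * (v y * dv y + v y * dv y) + v y * v y * 1))).
    exact: derive_add (dPhi y) (derive_sub (dU y) (derive_mulr s (derive_mul (derive_ident y)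
      (derive_mul (dvE y) (dvE y))))).
  have : Lam (2 * a) <= Lam r'.
    apply: (le_of_derive_ge0 dLam); first lra.
    move=> y /andP[ay _]; rewrite (max_idPl ay).
    have y0 : 0 < y by lra.
    have /andP[_ h1] := vth _ (ltW y0).
    have /andP[vy0 _] := v0 _ (ltW y0).
    have := vode y (ltac:(lra) : a <= y); rewrite (gtE _ ay) => E.
    have gy := g0 y0.
    have gi : 0 < (g y)^-1 by rewrite invr_gt0.
    have gv : g y * (g y)^-1 = 1 by rewrite mulfV// gt_eqF.
    have n1 : 1 <= n%:R :> R by rewrite ler1n.
    have H1 : 0 <= (g y * v y - 1) ^+ 2 * (g y)^-1 by rewrite mulr_ge0 ?sqr_ge0// ltW.
    have H2 : (g y * v y - 1) ^+ 2 * (g y)^-1 = g y * v y ^+ 2 - 2 * v y + (g y)^-1.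
      by field; rewrite gt_eqF.
    have H3 : 2 * s * y * dv y * v y = v y - (g y + n%:R * s) * v y ^+ 2.
      by rewrite (_ : 2 * s * y * dv y = 1 - (g y + n%:R * s) * v y); [ring|lra].
    have H4 : s * v y ^+ 2 <= n%:R * s * v y ^+ 2.
      by rewrite ler_wpM2r ?sqr_ge0// ler_peMl// ltW.
    rewrite /p; lra.
  rewrite /Lam (U_r' _ (lexx r')) => H.
  have /andP[h1 h2] := v0 (2 * a) (ltac:(lra) : 0 <= 2 * a).
  have h3 : v (2 * a) * v (2 * a) <= m^-1 * m^-1 by rewrite ler_pM// ltW.
  have h4 : 0 <= s * (r' * (v r' * v r')).
    by have /andP[/ltW h _] := v0 r' (ltW r'0); rewrite !mulr_ge0// ltW.
  have h5 : s * (2 * a * (v (2 * a) * v (2 * a))) <= s * (2 * a) / m ^+ 2.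
    by rewrite mulrA -exprVn expr2 ler_wpM2l// mulr_ge0 ?ltW//; lra.
  lra.
lra.
Qed.

End test_functions.

Section lower_test.
Context {R : realType}.
Variable g : R -> R.
Hypothesis dg : forall y : R, 0 < y -> derivable g y 1.
Hypothesis cdg : forall y : R, 0 < y -> {for y, continuous (derive1 g)}.
Hypothesis g0 : forall y : R, 0 < y -> 0 < g y.

Let cg (y : R) : 0 < y -> {for y, continuous g}.
Proof. by move=> y0; apply/differentiable_continuous/derivable1_diffP/dg. Qed.

Let dgE (y : R) : 0 < y -> is_derive y 1 g (derive1 g y).
Proof. by move=> y0; rewrite derive1E; exact/derivableP/dg. Qed.

(** Here U does not depend on s. Its derivative p is (1 - kap) / g away from 0,
    smoothed at 0 and cut off after r, so that the drift part of the generator,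
    p z <= p g, is at most 1 - kap. The margin kap absorbs the second-order part
    as soon as s is small. Since U increases and vanishes at r, - U 0 is the
    integral of p over [0, r]. *)
Lemma lower_test_function (n : nat) (r e : R) :
  0 < r -> 0 < e -> (int_inv g r < +oo)%E ->
  exists U p dp q : R -> R, exists s0 : R, [/\ C2_bounded U p dp, continuous q,
    forall y, 0 <= y -> forall z, z <= g y -> p y * z <= q y,
    0 < s0 /\ forall s, 0 < s <= s0 -> forall y, 0 <= y <= r ->
      q y + s * (n%:R * p y + 2 * y * dp y) <= 1 &
    [/\ forall y, r <= y -> 0 <= U y, forall y, 0 <= y -> U 0 <= U y &
     (int_inv g r <= (- U 0)%:E + e%:E)%E]].
Proof.
move=> r0 e0 ifin.
have e20 : 0 < e / 2 by rewrite divr_gt0.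
have [A0 [A00 A0r HA]] := int_inv_approx cg g0 r0 e20 ifin.
have [Phi [dPhi PhiE]] := inverse_primitive cg g0 A00 A0r.
rewrite PhiE in HA.
set I := Phi r - Phi A0 in HA.
have I0 : 0 <= I.
  rewrite subr_ge0; apply: (le_of_derive_ge0 dPhi (ltW A0r)) => x _.
  by rewrite invr_ge0 ltW// g0// lt_max A00 orbT.
pose kap := Num.min (1 / 2) (e / 2 / (I + 1)).
have kap0 : 0 < kap by rewrite lt_min !divr_gt0// ltr_wpDl.
have kap1 : kap <= 1 / 2 by rewrite /kap ge_min lexx.
have kapI : kap * I <= e / 2.
  have : kap <= e / 2 / (I + 1) by rewrite /kap ge_min lexx orbT.
  rewrite ler_pdivlMr ?ltr_wpDl// mulrDr mulr1; lra.
pose a := A0 / 2; have a0 : 0 < a by rewrite divr_gt0.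
have aA : a < A0 by rewrite /a; lra.
have [ch [dch [dchE cdch ch1 ch0 ch01]]] := smooth_cutoff aA.
have rr' : r < r + 1 by rewrite ltrDl.
have [th [dth [dthE cdth th1 th0 th01]]] := smooth_cutoff rr'.
have cch := is_derive_continuous dchE.
have cth := is_derive_continuous dthE.
pose h (y : R) := (1 - ch y) * (g y)^-1.
pose dh (y : R) := (1 - ch y) * (- derive1 g y / g y ^+ 2) + (g y)^-1 * (0 - dch y).
have hz y : y <= a -> h y = 0 by move=> /ch1[E _]; rewrite /h E subrr mul0r.
have dhz y : y <= a -> dh y = 0 by move=> /ch1[E1 E2]; rewrite /dh E1 E2 !subrr mul0r mulr0 addr0.
have dhE (y : R) : is_derive y 1 h (dh y).
  have [ya|ay] := ltP y a.
    rewrite dhz ?ltW//; apply: (@near_eq_is_derive _ _ _ (cst 0)) => //.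
    by near=> z; rewrite hz//; near: z; exact: lt_le_nbhsl.
  have y0 : 0 < y := lt_le_trans a0 ay.
  have gy0 : g y != 0 by rewrite gt_eqF ?g0.
  exact: (derive_mul (derive_sub (derive_const 1 y) (dchE y)) (derive_inv gy0 (dgE y0))).
have ch_h y : 0 <= 1 - ch y by rewrite subr_ge0; case/andP: (ch01 y).
have h0 y : 0 <= y -> 0 <= h y.
  rewrite le_eqVlt => /predU1P[<-|y0]; first by rewrite hz// ltW.
  by rewrite mulr_ge0// invr_ge0 ltW// g0.
have cdh : continuous dh.
  move=> y; have [ya|ay] := ltP y a.
    rewrite /continuous_at dhz ?ltW//.
    by apply: cvg_near_cst; near=> z; rewrite dhz//; near: z; exact: lt_le_nbhsl.
  have y0 : 0 < y := lt_le_trans a0 ay.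
  have gy0 : g y != 0 by rewrite gt_eqF ?g0.
  apply: cvgD; apply: cvgM.
  - by apply: cvgB; [exact: cvg_cst|exact: cch].
  - apply: cvgM; first by apply: cvgN; exact: cdg.
    apply: cvgV; first by rewrite expf_neq0.
    exact: (continuous_comp (cg y0) (@sqr_continuous R (g y))).
  - by apply: cvgV => //; exact: cg.
  - by apply: cvgB; [exact: cvg_cst|exact: cdch].
pose k1 := 1 - kap.
have k10 : 0 < k1 by rewrite /k1; lra.
pose p y := k1 * (h y * th y).
pose dp y := k1 * (h y * dth y + th y * dh y).
have dpE (y : R) : is_derive y 1 p (dp y) by exact: derive_mulr (derive_mul (dhE y) (dthE y)).
have cp := is_derive_continuous dpE.
have ch_ := is_derive_continuous dhE.
have cdp : continuous dp.
  move=> y; apply: cvgM; first exact: cvg_cst.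
  by apply: cvgD; apply: cvgM; [exact: ch_|exact: cdth|exact: cth|exact: cdh].
have p_ge0 y : 0 <= y -> 0 <= p y.
  by move=> y0; rewrite mulr_ge0 ?(ltW k10)// mulr_ge0 ?h0//; case/andP: (th01 y).
have p0 y : y <= 0 -> p y = p 0.
  by move=> y0; rewrite /p !hz ?(le_trans y0) ?(ltW a0)// !mul0r.
have [P dP] := primitive_exists cp p0.
pose U y := P y - P r.
have dU (y : R) : is_derive y 1 U (p y).
  by apply: derive_eq (derive_sub (dP y) (derive_const (P r) y)) _; rewrite subr0.
have U_inc x y : 0 <= x -> x <= y -> U x <= U y.
  move=> x0 xy; apply: (le_of_derive_ge0 dU xy) => z /andP[xz _].
  by rewrite p_ge0// (le_trans x0).
pose q y := k1 * ((1 - ch y) * th y).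
have [M M0 HM] := @bounded_segment R (fun y => n%:R * p y + 2 * y * dp y) 0 r ltac:(idtac;
  move=> y; apply: cvgD; apply: cvgM; [exact: cvg_cst|exact: cp| |exact: cdp];
  apply: cvgM; [exact: cvg_cst|exact: cvg_id]).
exists U, p, dp, q, (kap / M); split.
- split => //; exists (Num.max `|U 0| `|U (r + 1)|) => y y0.
  have [ry|yr] := leP (r + 1) y.
    have -> : U y = U (r + 1).
      have := @mean_value_bounds _ U p (r + 1) y 0 0 dU ry.
      case/(_ _)/andP; first by move=> x /andP[rx _]; rewrite /p (th0 _ rx).1 !mulr0 lexx.
      by rewrite !mul0r subr_ge0 subr_le0 => h1 h2; apply/eqP; rewrite eq_le h1 h2.
    by rewrite le_max lexx orbT.
  rewrite ler_norml; apply/andP; split.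
    apply: le_trans (U_inc _ _ (lexx 0) y0).
    by rewrite lerNl le_max -normrN ler_norm.
  apply: le_trans (U_inc _ _ y0 (ltW yr)) _.
  by rewrite le_max (ler_norm (U (r + 1))) orbT.
- move=> y; apply: cvgM; first exact: cvg_cst.
  by apply: cvgM; [apply: cvgB; [exact: cvg_cst|exact: cch]|exact: cth].
- move=> y + z zg; rewrite le_eqVlt => /predU1P[<-|y0].
    by rewrite /p /q (hz _ (ltW a0)) (ch1 _ (ltW a0)).1 subrr !mul0r !mulr0 mul0r.
  apply: le_trans (_ : p y * g y <= _); first by rewrite ler_wpM2l// p_ge0// ltW.
  rewrite le_eqVlt; apply/orP; left; apply/eqP; rewrite /p /q /h.
  by field; rewrite gt_eqF ?g0.
- split; first by rewrite divr_gt0.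
  move=> s /andP[s0 sM] y yr.
  have q1 : q y <= k1.
    rewrite /q ler_piMr ?(ltW k10)//.
    have /andP[? ?] := ch01 y; have /andP[? ?] := th01 y.
    by rewrite mulr_ile1//; lra.
  have : s * (n%:R * p y + 2 * y * dp y) <= kap.
    apply: le_trans (_ : s * M <= _); last by rewrite -ler_pdivlMr.
    by rewrite ler_wpM2l ?(ltW s0)// (le_trans (ler_norm _))// HM.
  by move: q1; rewrite /k1; lra.
split.
- by move=> y ry; rewrite (_ : 0 = U r) ?U_inc ?(ltW r0)// /U subrr.
- by move=> y y0; exact: U_inc.
apply: (le_trans HA); rewrite -!EFinD lee_fin.
have H1 : k1 * I <= U r - U A0.
  have dLam (y : R) := derive_sub (dU y) (derive_mulr k1 (dPhi y)).
  have := le_of_derive_ge0 dLam (ltW A0r).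
  rewrite /I => H; suff : U A0 - k1 * Phi A0 <= U r - k1 * Phi r by lra.
  apply: H => y /andP[Ay yr].
  rewrite (max_idPl Ay) /p /h (ch0 _ Ay).1 (th1 _ yr).1 subr0 mul1r mulr1 subrr.
  by [].
have Ur : U r = 0 by rewrite /U subrr.
have := U_inc 0 A0 (lexx 0) (ltW A00).
by move: H1; rewrite Ur /k1; lra.
Unshelve. all: by end_near. Qed.

End lower_test.

(** * The increment of a test function over one time step *)

Section euclid.
Context {R : realType} {n : nat}.
Implicit Types x y z : 'rV[R]_n.

Lemma dotvC x y : dotv x y = dotv y x.
Proof. by apply: eq_bigr => i _; rewrite mulrC. Qed.

Lemma dotvDr x y z : dotv x (y + z) = dotv x y + dotv x z.
Proof. by rewrite -big_split; apply: eq_bigr => i _; rewrite mxE mulrDr. Qed.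

Lemma dotvDl x y z : dotv (x + y) z = dotv x z + dotv y z.
Proof. by rewrite dotvC dotvDr !(dotvC z). Qed.

Lemma dotvZr a x y : dotv x (a *: y) = a * dotv x y.
Proof. by rewrite /dotv mulr_sumr; apply: eq_bigr => i _; rewrite mxE mulrCA. Qed.

Lemma sqnormD x y : sqnorm (x + y) = sqnorm x + 2 * dotv x y + sqnorm y.
Proof. by rewrite /sqnorm dotvDr !dotvDl (dotvC y x); ring. Qed.

Lemma sqnormZ a x : sqnorm (a *: x) = a ^+ 2 * sqnorm x.
Proof. by rewrite /sqnorm dotvZr dotvC dotvZr expr2 mulrA. Qed.

Lemma sqnorm_ge0 x : 0 <= sqnorm x.
Proof. by apply: sumr_ge0 => i _; rewrite -expr2 sqr_ge0. Qed.

Lemma sqnorm0 : sqnorm (0 : 'rV[R]_n) = 0.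
Proof. by rewrite /sqnorm /dotv big1// => i _; rewrite mxE mul0r. Qed.

Lemma sqr_coord_le x i : x ord0 i ^+ 2 <= sqnorm x.
Proof.
rewrite /sqnorm /dotv (bigD1 i)//= -expr2 lerDl.
by apply: sumr_ge0 => j _; rewrite -expr2 sqr_ge0.
Qed.

Lemma cauchy_schwarz x y : dotv x y ^+ 2 <= sqnorm x * sqnorm y.
Proof.
have := sqnorm_ge0 (sqnorm y *: x + (- dotv x y) *: y).
rewrite sqnormD !sqnormZ dotvZr [dotv (_ *: _) _]dotvC dotvZr (dotvC y x).
have [y0|y0] := eqVneq (sqnorm y) 0.
  move=> _; rewrite y0 mulr0 /dotv big1 ?expr0n// => i _.
  have := sqr_coord_le y i; rewrite y0 => h.
  have /eqP : y ord0 i ^+ 2 = 0 by apply/eqP; rewrite eq_le h sqr_ge0.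
  by rewrite sqrf_eq0 => /eqP ->; rewrite mulr0.
have yp : 0 < sqnorm y by rewrite lt_neqAle eq_sym y0 sqnorm_ge0.
move=> H; rewrite -subr_ge0 -(pmulr_rge0 _ yp); move: H.
by congr (_ <= _); ring.
Qed.

Lemma young2 (l a b : R) : 0 < l -> 2 * (a * b) <= l * a ^+ 2 + l^-1 * b ^+ 2.
Proof.
move=> l0; rewrite -subr_ge0.
have -> : l * a ^+ 2 + l^-1 * b ^+ 2 - 2 * (a * b) = l^-1 * (l * a - b) ^+ 2.
  by field; rewrite gt_eqF.
by rewrite mulr_ge0 ?sqr_ge0// invr_ge0 ltW.
Qed.

Lemma young_norm (l a b : R) : 0 < l -> 2 * `|a * b| <= l * a ^+ 2 + l^-1 * b ^+ 2.
Proof.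
by move=> l0; rewrite normrM (le_trans (young2 _ _ l0))// !real_normK ?num_real.
Qed.

Lemma dotv_young (l : R) x y : 0 < l -> 2 * `|dotv x y| <= l * sqnorm x + l^-1 * sqnorm y.
Proof.
move=> l0; rewrite /sqnorm /dotv !mulr_sumr -big_split /=.
apply: le_trans (_ : 2 * \sum_i `|x ord0 i * y ord0 i| <= _).
  by rewrite ler_pM2l// ler_norm_sum.
rewrite mulr_sumr ler_sum// => i _; rewrite -!expr2.
exact: young_norm.
Qed.

End euclid.

Lemma dotvZl (R : realType) (n : nat) (a : R) (x y : 'rV[R]_n) : dotv (a *: x) y = a * dotv x y.
Proof. by rewrite dotvC dotvZr dotvC. Qed.

Lemma sqr_sqnorm_le (R : realType) (n : nat) (x : 'rV[R]_n) :
  sqnorm x ^+ 2 <= n%:R * \sum_i x ord0 i ^+ 4.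
Proof.
pose y : 'rV[R]_n := \row_i (x ord0 i ^+ 2).
have -> : sqnorm x = dotv (const_mx 1) y.
  by apply: eq_bigr => i _; rewrite !mxE mul1r expr2.
apply: le_trans (cauchy_schwarz _ _) _.
rewrite le_eqVlt; apply/orP; left; apply/eqP; congr (_ * _).
  rewrite /sqnorm /dotv (eq_bigr (fun=> 1)) ?sumr_const ?card_ord//.
  by move=> i _; rewrite mxE mul1r.
by apply: eq_bigr => i _; rewrite !mxE -exprD.
Qed.

Section taylor.
Context {R : realType} {n : nat}.
Variables (U p dp : R -> R).
Hypothesis HU : C2_bounded U p dp.

(** Increments with small |k| are handled by Taylor's formula for U at sqnorm x,
    with Young's inequality for the mixed terms. For the other ones the bounds
    on U, p and dp are enough, since |k|^4 is then bounded below: this is why the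
    remainder has a quartic term, whose mean is of order h^2 for Gaussian k. *)
Lemma taylor_sqnorm (r e : R) : 0 < r -> 0 < e -> exists2 K, 0 < K &
  forall x k : 'rV[R]_n, sqnorm x <= r ->
    U (sqnorm (x + k)) <= U (sqnorm x) + p (sqnorm x) * (2 * dotv x k + sqnorm k)
      + 2 * dp (sqnorm x) * dotv x k ^+ 2 + e * sqnorm k + K * sqnorm k ^+ 2.
Proof.
case: HU => dU dP cdp [B UB] r0 e0.
have [Pb Pb0 HP] := bounded_segment 0 r (is_derive_continuous dP).
have [Db Db0 HD] := bounded_segment 0 r cdp.
pose e1 := e / 2 / (8 * r + 2).
have e10 : 0 < e1 by rewrite !divr_gt0// ltr_wpDl// mulr_ge0// ltW.
have [d d0 Hd] := taylor2 0 r dU dP cdp e10.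
pose eta := Num.min 1 (d ^+ 2 / (8 * r + 2 + 1)).
have den0 : 0 < 8 * r + 2 + 1 by lra.
have eta0 : 0 < eta by rewrite lt_min ltr01 divr_gt0// exprn_gt0.
pose l := e / 2 / (Db * r).
have l0 : 0 < l by rewrite !divr_gt0// mulr_gt0.
pose K1 := Db * l^-1 + Db / 2.
have K10 : 0 < K1 by rewrite addr_gt0// mulr_gt0 ?invr_gt0.
have B0 : 0 <= B by rewrite (le_trans _ (UB 0 (lexx 0))).
pose K2 := (2 * B + Pb * (1 + r + 1)  + 2 * Db * r) / eta ^+ 2.
have K20 : 0 < K2.
  rewrite divr_gt0 ?exprn_gt0//.
  have : 0 < Pb * (1 + r + 1) by rewrite mulr_gt0//; lra.
  have : 0 < 2 * Db * r by rewrite !mulr_gt0.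
  by lra.
exists (K1 + K2); first exact: addr_gt0.
move=> x k xr.
set y := sqnorm x; set m := sqnorm k; set u := dotv x k.
have y0 : 0 <= y := sqnorm_ge0 x.
have m0 : 0 <= m := sqnorm_ge0 k.
have u2 : u ^+ 2 <= r * m.
  by apply: le_trans (cauchy_schwarz x k) _; rewrite ler_wpM2r.
have yr : 0 <= y <= r by rewrite y0.
have := HP _ yr; rewrite ler_norml => /andP[P1 P2].
have := HD _ yr; rewrite ler_norml => /andP[D1 D2].
rewrite sqnormD -/y -/m -/u -addrA; set D := 2 * u + m.
have [me|me] := ltP m eta; last first.
  (* A large increment: w is the factor, at least 1, that absorbs the constants. *)
  have yD : 0 <= y + D.
    by have := sqnorm_ge0 (x + k); rewrite sqnormD -addrA.
  have := UB _ yD; rewrite ler_norml => /andP[_ U1].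
  have := UB _ y0; rewrite ler_norml => /andP[U2 _].
  pose w := m ^+ 2 / eta ^+ 2.
  have w1 : 1 <= w by rewrite ler_pdivlMr ?exprn_gt0// mul1r ler_sqr ?nnegrE// ltW.
  have wm : m <= w.
    rewrite ler_pdivlMr ?exprn_gt0// [leRHS]expr2 ler_wpM2l//.
    have eta1 : eta <= 1 by rewrite /eta ge_min lexx.
    by apply: le_trans me; rewrite expr2 ler_piMl// ltW.
  have -> : (K1 + K2) * m ^+ 2 = K1 * m ^+ 2
      + (2 * B + Pb * (1 + r + 1)  + 2 * Db * r) * w.
    by rewrite /K2 /w; field; rewrite gt_eqF.
  have h1 : 0 <= K1 * m ^+ 2 by rewrite mulr_ge0 ?sqr_ge0// ltW.
  have h2 : 0 <= e * m by rewrite mulr_ge0// ltW.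
  have h3 : - (Pb * (1 + (r + 1) * m)) <= p y * D.
    have : `|p y * D| <= Pb * (1 + (r + 1) * m).
      rewrite normrM ler_pM// ?HP// /D (le_trans (ler_normD _ _))// (ger0_norm m0).
      have : 2 * `|1 * u| <= 1 * 1 ^+ 2 + 1^-1 * u ^+ 2 by exact: young_norm.
      by rewrite mul1r invr1 !mul1r expr1n normrM (ger0_norm (ler0n _ 2)); lra.
    by rewrite ler_norml => /andP[].
  have h4 : - (2 * Db * r * m) <= 2 * dp y * u ^+ 2.
    have : - dp y * u ^+ 2 <= Db * (r * m).
      apply: le_trans (_ : Db * u ^+ 2 <= _); last by rewrite ler_wpM2l// ltW.
      by rewrite ler_wpM2r ?sqr_ge0//; lra.
    by lra.
  have h5 : Pb * ((r + 1) * m) <= Pb * ((r + 1) * w).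
    by rewrite ler_wpM2l ?(ltW Pb0)// ler_wpM2l//; lra.
  have h6 : Db * r * m <= Db * r * w by rewrite ler_wpM2l// mulr_ge0 ?ltW.
  have h7 : B <= B * w by rewrite ler_peMr.
  have h8 : Pb <= Pb * w by rewrite ler_peMr// ltW.
  by lra.
have D2m : D ^+ 2 <= (8 * r + 2) * m.
  have m1 : m ^+ 2 <= m.
    by rewrite expr2 ler_piMl// ltW// (lt_le_trans me)// /eta ge_min lexx.
  have : D ^+ 2 <= 8 * u ^+ 2 + 2 * m ^+ 2.
    by have := sqr_ge0 (2 * u - m); rewrite /D; nra.
  by lra.
have Dd : `|D| < d.
  rewrite -ltr_sqr ?nnegrE// ?(ltW d0)// real_normK ?num_real//.
  apply: le_lt_trans D2m _.
  have : m < d ^+ 2 / (8 * r + 2 + 1) by rewrite (lt_le_trans me)// /eta ge_min lexx orbT.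
  by rewrite ltr_pdivlMr// => h; apply: le_lt_trans h; rewrite mulrC ler_wpM2l//; lra.
have := Hd _ _ yr Dd; rewrite ler_norml => /andP[_ T1].
have T2 : e1 * D ^+ 2 <= e / 2 * m.
  have -> : e / 2 * m = e1 * ((8 * r + 2) * m).
    by rewrite /e1; field; rewrite gt_eqF//; lra.
  by rewrite ler_wpM2l// ltW.
have T3 : 2^-1 * dp y * D ^+ 2 <= 2 * dp y * u ^+ 2 + (e / 2 * m + K1 * m ^+ 2).
  have Y := young_norm u m l0.
  have Y' : `|dp y| * (2 * `|u * m|) <= Db * (l * (r * m) + l^-1 * m ^+ 2).
    rewrite ler_pM// ?HD//.
    by apply: (le_trans Y); rewrite lerD2r ler_wpM2l// ltW.
  have lE : Db * (l * (r * m)) = e / 2 * m.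
    by rewrite /l; field; rewrite !gt_eqF.
  have Z : dp y * (2 * (u * m)) <= `|dp y| * (2 * `|u * m|).
    by apply: le_trans (ler_norm _) _; rewrite !normrM (ger0_norm (ler0n _ 2)).
  have Z2 : dp y * m ^+ 2 <= Db * m ^+ 2 by rewrite ler_wpM2r ?sqr_ge0.
  by rewrite /D /K1; lra.
have K2m : 0 <= K2 * m ^+ 2 by rewrite mulr_ge0 ?sqr_ge0// ltW.
by lra.
Qed.

(** One time step of length h: b is the displacement due to the drift, of order h,
    and z the one due to the noise. All terms that contain b, except the linear
    one, are of order h^2 or are mixed terms dominated by h and |z|^2. *)
Lemma one_step_bound (r M e : R) : 0 < r -> 0 <= M -> 0 < e ->
  exists K h0 : R, [/\ 0 < K, 0 < h0 & forall (h : R) (x b z : 'rV[R]_n),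
    0 < h <= h0 -> sqnorm x <= r -> (forall i, `|b ord0 i| <= M * h) ->
    U (sqnorm (x + b + z)) <= U (sqnorm x) + p (sqnorm x) * (2 * dotv x b)
      + 2 * p (sqnorm x) * dotv x z + p (sqnorm x) * sqnorm z
      + 2 * dp (sqnorm x) * dotv x z ^+ 2
      + e * (h + sqnorm z) + K * sqnorm z ^+ 2].
Proof.
case: (HU) => dU dP cdp _ r0 M0 e0.
have [Pb Pb0 HP] := bounded_segment 0 r (is_derive_continuous dP).
have [Db Db0 HD] := bounded_segment 0 r cdp.
have e40 : 0 < e / 4 by rewrite divr_gt0.
have [K1 K10 HT] := taylor_sqnorm r0 e40.
have den0 : 0 < Pb + 2 * Db * r by rewrite addr_gt0// !mulr_gt0.
pose l := e / 2 / (Pb + 2 * Db * r).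
have l0 : 0 < l by rewrite !divr_gt0.
have li0 : 0 < l^-1 by rewrite invr_gt0.
pose C := n%:R * M ^+ 2.
have C0 : 0 <= C by rewrite mulr_ge0// sqr_ge0.
(* C bounds |b|^2 / h^2; L collects the coefficients of |b|^2 in the estimate. *)
pose L := (Pb + 2 * Db * r) * (1 + l^-1) + e / 2 + 8 * K1 * C.
have L0 : 0 < L.
  rewrite ltr_wpDr ?mulr_ge0// ?(ltW K10)// addr_gt0// ?divr_gt0//.
  by rewrite mulr_gt0// addr_gt0.
exists (8 * K1), (Num.min 1 (e / (L * (C + 1)))); split.
- by rewrite mulr_gt0.
- by rewrite lt_min ltr01 divr_gt0// mulr_gt0// ltr_wpDl.
move=> h x b z /andP[h0 hh] xr bM.
have h1 : h <= 1 by rewrite (le_trans hh)// ge_min lexx.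
have hL : h * (L * (C + 1)) <= e.
  rewrite -ler_pdivlMr; first by rewrite (le_trans hh)// ge_min lexx orbT.
  by rewrite mulr_gt0// ltr_wpDl.
set w := sqnorm b; set m := sqnorm z.
have w0 : 0 <= w := sqnorm_ge0 b.
have m0 : 0 <= m := sqnorm_ge0 z.
have wC : w <= C * h ^+ 2.
  rewrite /w /sqnorm /dotv.
  apply: le_trans (_ : \sum_(i < n) (M * h) ^+ 2 <= _).
    rewrite ler_sum// => i _; rewrite -expr2 -real_normK ?num_real// ler_sqr ?nnegrE//.
    by rewrite mulr_ge0// ltW.
  by rewrite sumr_const card_ord /C exprMn -mulrA mulr_natl.
have h2 : h ^+ 2 <= h by rewrite expr2 ler_piMl// ltW.
have wC1 : w <= C by apply: (le_trans wC); rewrite ler_piMr// expr_le1// ltW.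
have wLh : w * L <= e * h.
  apply: le_trans (_ : C * h ^+ 2 * L <= _); first by rewrite ler_wpM2r// ltW.
  have : h * (L * C) <= e.
    by apply: le_trans hL; rewrite ler_wpM2l ?(ltW h0)// ler_wpM2l ?(ltW L0)// lerDl.
  by move=> /(ler_wpM2r (ltW h0)); apply: le_trans; rewrite le_eqVlt; apply/orP; left; apply/eqP; ring.
have yr : 0 <= sqnorm x <= r by rewrite sqnorm_ge0.
set y := sqnorm x in yr xr *.
have := HT x (b + z) xr; rewrite addrA -/y => T.
apply: (le_trans T).
rewrite dotvDr sqnormD -/w -/m.
set u := dotv x b; set t := dotv x z; set c := dotv b z.
have u2 : u ^+ 2 <= r * w.
  by apply: le_trans (cauchy_schwarz x b) _; rewrite ler_wpM2r.
have t2 : t ^+ 2 <= r * m.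
  by apply: le_trans (cauchy_schwarz x z) _; rewrite ler_wpM2r.
have c2 : 2 * `|c| <= l * m + l^-1 * w.
  by rewrite /c dotvC; exact: dotv_young.
have ut : 2 * `|u * t| <= l * (r * m) + l^-1 * (r * w).
  rewrite mulrC; apply: le_trans (_ : l * t ^+ 2 + l^-1 * u ^+ 2 <= _).
    by rewrite mulrC (mulrC u); exact: young_norm.
  by rewrite lerD// ler_wpM2l// ltW.
have mm : w + 2 * c + m <= 2 * w + 2 * m.
  have := @dotv_young R n 1 b z ltr01; rewrite invr1 !mul1r -/c -/w -/m.
  by have := ler_norm c; lra.
have mm0 : 0 <= w + 2 * c + m by have := sqnorm_ge0 (b + z); rewrite sqnormD.
have mm2 : (w + 2 * c + m) ^+ 2 <= 8 * w ^+ 2 + 8 * m ^+ 2.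
  apply: le_trans (_ : (2 * w + 2 * m) ^+ 2 <= _).
    by rewrite ler_sqr ?nnegrE// (le_trans mm0).
  by have := sqr_ge0 (w - m); nra.
have E1 : p y * (w + 2 * c) <= Pb * (w + (l * m + l^-1 * w)).
  apply: le_trans (ler_norm _) _; rewrite normrM ler_pM// ?HP//.
  rewrite (le_trans (ler_normD _ _))// (ger0_norm w0) lerD2l normrM.
  by rewrite (ger0_norm (ler0n _ 2)).
have E2 : dp y * (u ^+ 2 + 2 * (u * t)) <= Db * (r * w + (l * (r * m) + l^-1 * (r * w))).
  apply: le_trans (ler_norm _) _; rewrite normrM ler_pM// ?HD//.
  rewrite (le_trans (ler_normD _ _))// (ger0_norm (sqr_ge0 u)) lerD// normrM.
  by rewrite (ger0_norm (ler0n _ 2)).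
have E3 : (e / 4) * (w + 2 * c + m) <= (e / 4) * (2 * w + 2 * m).
  by rewrite ler_wpM2l// ltW.
have E4 : K1 * (w + 2 * c + m) ^+ 2 <= K1 * (8 * w ^+ 2 + 8 * m ^+ 2).
  by rewrite ler_wpM2l// ltW.
have E5 : K1 * w ^+ 2 <= K1 * (C * w).
  by rewrite ler_wpM2l ?(ltW K10)// expr2 ler_wpM2r.
have lE : l * (Pb + 2 * Db * r) = e / 2 by rewrite /l divfK// gt_eqF.
have lE' : l * (Pb + 2 * Db * r) * m = e / 2 * m by rewrite lE.
move: wLh; rewrite /L => wLh.
by lra.
Qed.

End taylor.

(** * Moments of the normal law *)

Section normal_moments.
Context {R : realType}.
Local Notation mu := (@lebesgue_measure R).
Local Notation normal s := (@normal_prob R 0 s).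

(** The change of variables for the Radon-Nikodym derivative, which is almost
    everywhere the explicit density. *)
Lemma ge0_integral_normal_prob (s : R) (f : R -> R) :
  (forall x, 0 <= f x) -> measurable_fun setT f ->
  (\int[normal s]_x (f x)%:E = \int[mu]_x (f x * normal_pdf 0 s x)%:E)%E.
Proof.
move=> f0 mf.
have dom := @normal_prob_dominates R 0 s.
have mpdf : measurable_fun [set: measurableTypeR R] (fun x => (normal_pdf 0 s x)%:E).
  by apply/measurable_EFinP; exact: measurable_normal_pdf.
have fint := Radon_Nikodym_SigmaFinite.f_integrable dom.
rewrite -(Radon_Nikodym_SigmaFinite.change_of_variables dom)//; last first.
  exact/measurable_EFinP.
apply: ae_eq_integral => //.
- apply: emeasurable_funM; first exact/measurable_EFinP.
  exact: measurable_int fint.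
- by apply/measurable_EFinP; apply: measurable_funM => //; exact: measurable_normal_pdf.
- rewrite (_ : (fun x => (f x * normal_pdf 0 s x)%:E) = (fun x => ((f x)%:E * (normal_pdf 0 s x)%:E)%E)); last first.
    by apply/funext => x; rewrite EFinM.
  apply: ae_eqe_mul2l.
  apply: integral_ae_eq => // E _ mE.
  by rewrite -Radon_Nikodym_SigmaFinite.f_integral.
Qed.

Lemma normal_pdf_scale (s x : R) : 0 < s ->
  normal_pdf 0 s (s * x) * s = normal_pdf 0 1 x.
Proof.
move=> s0; rewrite !normal_pdfE ?gt_eqF// /normal_fun !subr0.
have -> : - (s * x) ^+ 2 / (s ^+ 2 *+ 2) = - x ^+ 2 / (1 ^+ 2 *+ 2).
  have -> : s ^+ 2 *+ 2 = s ^+ 2 * 2 :> R by rewrite mulr_natr.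
  have -> : 1 ^+ 2 *+ 2 = 2 :> R by rewrite expr1n.
  by field; rewrite gt_eqF.
rewrite /normal_peak expr1n mul1r mulrAC; congr (_ * _).
rewrite -mulrnAr sqrtrM ?sqr_ge0// sqrtr_sqr gtr0_norm//.
by rewrite invfM mulrAC mulVf ?mul1r// gt_eqF.
Qed.

Lemma normal_moment_scale (s : R) (k : nat) : 0 < s -> ~~ odd k ->
  (\int[mu]_x (x ^+ k * normal_pdf 0 s x)%:E =
   (s ^+ k)%:E * \int[mu]_x (x ^+ k * normal_pdf 0 1 x)%:E)%E.
Proof.
move=> s0 ek.
have Fd (x : R) : is_derive x 1 (fun x : R => s * x) s.
  by apply: is_derive_eq; rewrite /GRing.scale/= mulr1.
have F' : derive1 (fun x : R => s * x) = cst s.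
  by apply/funext => x; rewrite derive1E; exact: derive_val.
have pk (x : R) : 0 <= x ^+ k by rewrite exprn_even_ge0.
rewrite (@increasing_ge0_integration_by_substitutionT _ (fun x => s * x)).
- rewrite F' -ge0_integralZl_EFin//.
  + apply: eq_integral => x _ /=.
    rewrite -EFinM; congr EFin; rewrite !fctE -(@normal_pdf_scale s x)//.
    by rewrite exprMn !mulrA.
  + by move=> x _; rewrite lee_fin mulr_ge0// normal_pdf_ge0.
  + apply/measurable_EFinP; apply: measurable_funM; last exact: measurable_normal_pdf.
    exact: measurable_funX.
- by move=> x y xy; rewrite ltr_pM2l.
- by rewrite F'; exact: cst_continuous.
- by rewrite F'; exact: is_cvg_cst.
- by rewrite F'; exact: is_cvg_cst.
- by move=> x; exact: (@ex_derive _ _ _ _ _ _ _ (Fd x)).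
- by apply: gt0_cvgMrNy.
- by apply: gt0_cvgMry.
- move=> x; apply: cvgM; first exact: exprn_continuous.
  by apply: continuous_normal_pdf; rewrite gt_eqF.
- by move=> x; rewrite mulr_ge0// normal_pdf_ge0.
Qed.

(** The density of variance 1 times x^4 is dominated by a multiple of the density
    of variance 4: their quotient is the square of expR (3/16 x^2), and
    expR u >= u. *)
Lemma normal_moment4_lty : (\int[mu]_x (x ^+ 4 * normal_pdf 0 1 x)%:E < +oo)%E.
Proof.
pose C : R := normal_peak 1 * (normal_peak 2)^-1 * (16 / 3) ^+ 2.
have p2 : 0 < normal_peak (2 : R) by rewrite normal_peak_gt0.
have p1 : 0 < normal_peak (1 : R) by rewrite normal_peak_gt0.
apply: (@le_lt_trans _ _ (\int[mu]_x (C%:E * (normal_pdf 0 2 x)%:E))%E).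
  apply: ge0_le_integral => //.
  - by move=> x _; rewrite lee_fin mulr_ge0 ?normal_pdf_ge0// exprn_even_ge0.
  - apply/measurable_EFinP; apply: measurable_funM; last exact: measurable_normal_pdf.
    exact: measurable_funX.
  - under eq_fun do rewrite -EFinM.
    by apply/measurable_EFinP; apply: measurable_funM => //; exact: measurable_normal_pdf.
  - move=> x _; rewrite -EFinM lee_fin !normal_pdfE// /normal_fun !subr0.
    have e1 : expR (- x ^+ 2 / (2 ^+ 2 *+ 2)) = expR (- x ^+ 2 / (1 ^+ 2 *+ 2)) * expR (3 / 16 * x ^+ 2) ^+ 2.
      rewrite [expR _ ^+ 2]expr2 -!expRD; congr expR.
      have -> : 1 ^+ 2 *+ 2 = 2 :> R by rewrite expr1n.
      have -> : 2 ^+ 2 *+ 2 = 8 :> R by rewrite -mulr_natr; ring.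
      by field.
    rewrite e1 /C.
    set E := expR (- _ / (1 ^+ 2 *+ 2)); set G := expR (3 / 16 * _).
    have G1 : 3 / 16 * x ^+ 2 <= G by rewrite (le_trans _ (expR_ge1Dx _))// lerDr.
    have x0 : 0 <= 3 / 16 * x ^+ 2 by rewrite mulr_ge0 ?sqr_ge0.
    have G2 : (3 / 16 * x ^+ 2) ^+ 2 <= G ^+ 2.
      by rewrite ler_sqr ?nnegrE// (le_trans x0).
    have -> : normal_peak 1 / normal_peak 2 * (16 / 3) ^+ 2 * (normal_peak 2 * (E * G ^+ 2)) =
      (16 / 3) ^+ 2 * (normal_peak 1 * E) * G ^+ 2 by field; rewrite gt_eqF.
    have -> : x ^+ 4 * (normal_peak 1 * E) = (16 / 3) ^+ 2 * (normal_peak 1 * E) * (3 / 16 * x ^+ 2) ^+ 2 by field.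
    by rewrite ler_wpM2l// mulr_ge0 ?sqr_ge0// mulr_ge0 ?expR_ge0// ltW.
rewrite ge0_integralZl_EFin//.
- by rewrite integral_normal_pdf mule1 ltry.
- by move=> x _; rewrite lee_fin normal_pdf_ge0.
- by apply/measurable_EFinP; exact: measurable_normal_pdf.
- by rewrite mulr_ge0 ?sqr_ge0// divr_ge0// ltW.
Qed.

Lemma normal_moment2_gt0 : (0 < \int[mu]_x (x ^+ 2 * normal_pdf 0 1 x)%:E)%E.
Proof.
pose c : R := normal_peak 1 * expR (- 2).
have c0 : 0 < c by rewrite mulr_gt0 ?expR_gt0// normal_peak_gt0.
have mf : measurable_fun [set: measurableTypeR R] (fun x => (x ^+ 2 * normal_pdf 0 1 x)%:E).
  apply/measurable_EFinP; apply: measurable_funM; last exact: measurable_normal_pdf.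
  exact: measurable_funX.
have f0 (x : R) : 0 <= x ^+ 2 * normal_pdf 0 1 x.
  by rewrite mulr_ge0 ?sqr_ge0// normal_pdf_ge0.
apply: (@lt_le_trans _ _ (\int[mu]_(x in `[1%R, 2%R]) (cst c%:E x))%E).
  rewrite integral_cst//= lebesgue_measure_itv /= lte_fin ltr1n -EFinB -EFinM lte_fin.
  by rewrite mulr_gt0// subr_gt0 ltr1n.
apply: (@le_trans _ _ (\int[mu]_(x in `[1%R, 2%R]) (x ^+ 2 * normal_pdf 0 1 x)%:E)%E).
  apply: ge0_le_integral => //.
  - by move=> x _; rewrite lee_fin ltW.
  - exact: measurable_funTS.
  - move=> x /=; rewrite in_itv /= => /andP[x1 x2]; rewrite lee_fin.
    rewrite normal_pdfE// /normal_fun subr0 /c.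
    rewrite -[leLHS]mul1r ler_pM//.
    + by rewrite mulr_ge0 ?expR_ge0// normal_peak_ge0.
    + by rewrite expr_ge1// (le_trans ler01).
    + rewrite ler_wpM2l ?normal_peak_ge0// ler_expR expr1n.
      rewrite mulNr lerN2 ler_pdivrMr//; nra.
apply: ge0_subset_integral => //.
by move=> x _; rewrite lee_fin.
Qed.

(** The mean of the normal law vanishes, in a form that does not presuppose that
    the identity is integrable. *)
Lemma normal_mean_parts (s : R) : 0 < s ->
  (\int[normal s]_x (Num.max x 0)%:E = \int[normal s]_x (Num.max (- x) 0)%:E)%E.
Proof.
move=> s0.
have m1 : measurable_fun [set: measurableTypeR R] (fun x : R => Num.max x 0).
  by apply: measurable_maxr => //; exact: measurable_id.
have m2 : measurable_fun [set: measurableTypeR R] (fun x : R => Num.max (- x) 0).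
  by apply: measurable_maxr => //; exact: measurableT_comp.
have pdfN (x : R) : normal_pdf 0 s (- x) = normal_pdf 0 s x.
  by rewrite !normal_pdfE ?gt_eqF// /normal_fun !subr0 sqrrN.
rewrite !ge0_integral_normal_prob//; last 2 first.
- by move=> x; rewrite le_max lexx orbT.
- by move=> x; rewrite le_max lexx orbT.
transitivity (\int[mu]_(x in `[0%R, +oo[) (Num.max x 0 * normal_pdf 0 s x)%:E)%E.
  rewrite [RHS]integral_mkcond; apply: eq_integral => x _; rewrite /patch.
  case: ifPn => //; rewrite notin_setE /= in_itv /= andbT => /negP; rewrite -ltNge => x0.
  by rewrite (max_idPr (ltW x0)) mul0r.
transitivity (\int[mu]_(x in `]-oo, 0%R]) (Num.max (- x) 0 * normal_pdf 0 s x)%:E)%E; last first.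
  rewrite integral_mkcond; apply: eq_integral => x _; rewrite /patch.
  case: ifPn => //; rewrite notin_setE /= in_itv /= => /negP; rewrite -ltNge => x0.
  by rewrite (max_idPr _) ?mul0r// oppr_le0 ltW.
have := @ge0_integration_by_substitutionNy R (fun x => Num.max (- x) 0 * normal_pdf 0 s x) 0.
rewrite oppr0 => ->.
- by apply: eq_integral => x _ /=; rewrite opprK pdfN.
- apply: continuous_subspaceT => x; apply: cvgM.
    by apply: continuous_max; [exact: continuousN|exact: cvg_cst].
  by apply: continuous_normal_pdf; rewrite gt_eqF.
- by move=> x _; rewrite mulr_ge0 ?normal_pdf_ge0// le_max lexx orbT.
Qed.

(** What the argument uses of the normal law: the scaling of its second and fourth
    moments, and its symmetry. The constants c and c4 are the moments of the
    standard law. *)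
Lemma normal_moments : exists c c4 : R, [/\ 0 < c, 0 <= c4 & forall s, 0 < s ->
  [/\ (\int[normal s]_x (x ^+ 2)%:E = (c * s ^+ 2)%:E)%E,
      (\int[normal s]_x (x ^+ 4)%:E = (c4 * s ^+ 4)%:E)%E &
      (\int[normal s]_x (Num.max x 0)%:E = \int[normal s]_x (Num.max (- x) 0)%:E)%E]].
Proof.
have mX k : measurable_fun [set: measurableTypeR R] (fun x : R => x ^+ k).
  exact: measurable_funX.
have mf k : measurable_fun [set: measurableTypeR R] (fun x : R => (x ^+ k * normal_pdf 0 1 x)%:E).
  apply/measurable_EFinP; apply: measurable_funM; last exact: measurable_normal_pdf.
  exact: measurable_funX.
have M4 : (\int[mu]_x (x ^+ 4 * normal_pdf 0 1 x)%:E)%E \is a fin_num.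
  rewrite ge0_fin_numE ?normal_moment4_lty//.
  by apply: integral_ge0 => x _; rewrite lee_fin mulr_ge0 ?normal_pdf_ge0// exprn_even_ge0.
have M2 : (\int[mu]_x (x ^+ 2 * normal_pdf 0 1 x)%:E)%E \is a fin_num.
  rewrite ge0_fin_numE; last first.
    by apply: integral_ge0 => x _; rewrite lee_fin mulr_ge0 ?normal_pdf_ge0// sqr_ge0.
  apply: (@le_lt_trans _ _ (\int[mu]_x ((normal_pdf 0 1 x)%:E + (x ^+ 4 * normal_pdf 0 1 x)%:E))%E).
    apply: ge0_le_integral => //.
    - by move=> x _; rewrite lee_fin mulr_ge0 ?normal_pdf_ge0// sqr_ge0.
    - by apply: emeasurable_funD => //; apply/measurable_EFinP; exact: measurable_normal_pdf.
    - move=> x _; rewrite -EFinD lee_fin -[X in _ <= X + _]mul1r -mulrDl.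
      rewrite ler_wpM2r ?normal_pdf_ge0//.
      by have := sqr_ge0 (x ^+ 2 - 1); nra.
  rewrite ge0_integralD//.
  - by rewrite integral_normal_pdf lte_add_pinfty ?ltry// normal_moment4_lty.
  - by move=> x _; rewrite lee_fin normal_pdf_ge0.
  - by apply/measurable_EFinP; exact: measurable_normal_pdf.
  - by move=> x _; rewrite lee_fin mulr_ge0 ?normal_pdf_ge0// exprn_even_ge0.
exists (fine (\int[mu]_x (x ^+ 2 * normal_pdf 0 1 x)%:E)%E),
  (fine (\int[mu]_x (x ^+ 4 * normal_pdf 0 1 x)%:E)%E); split.
- by rewrite fine_gt0// normal_moment2_gt0 -ge0_fin_numE// ltW// normal_moment2_gt0.
- apply: fine_ge0; apply: integral_ge0 => x _.
  by rewrite lee_fin mulr_ge0 ?normal_pdf_ge0// exprn_even_ge0.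
move=> s s0; split; last exact: normal_mean_parts.
- rewrite ge0_integral_normal_prob//; last by move=> x; rewrite sqr_ge0.
  by rewrite normal_moment_scale// -[in LHS](fineK M2) -EFinM mulrC.
- rewrite ge0_integral_normal_prob//; last by move=> x; rewrite exprn_even_ge0.
  by rewrite normal_moment_scale// -[in LHS](fineK M4) -EFinM mulrC.
Qed.

End normal_moments.

(** * Independence and Brownian increments *)

Section real_integrable.
Context {R : realType} {d : measure_display} {S : measurableType d}.
Variable mu : {measure set S -> \bar R}.
Variable D : set S.
Hypothesis mD : measurable D.
Implicit Types f g : S -> R.

Lemma real_integrableD f g : mu.-integrable D (EFin \o f) ->
  mu.-integrable D (EFin \o g) -> mu.-integrable D (EFin \o (fun w => f w + g w)).
Proof.
move=> iF iG; apply: (eq_integrable mD _ _ _ (integrableD mD iF iG)).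
by move=> w _ /=; rewrite EFinD.
Qed.

Lemma real_integrableB f g : mu.-integrable D (EFin \o f) ->
  mu.-integrable D (EFin \o g) -> mu.-integrable D (EFin \o (fun w => f w - g w)).
Proof.
move=> iF iG; apply: (eq_integrable mD _ _ _ (integrableB mD iF iG)).
by move=> w _ /=; rewrite EFinB.
Qed.

Lemma real_integrableZ c f : mu.-integrable D (EFin \o f) ->
  mu.-integrable D (EFin \o (fun w => c * f w)).
Proof.
move=> iF; apply: (eq_integrable mD _ _ _ (integrableZl mD c iF)).
by move=> w _ /=; rewrite EFinM.
Qed.

Lemma real_integrable0 : mu.-integrable D (EFin \o (fun=> 0 : R)).
Proof. exact: integrable0. Qed.

Lemma real_integrable_sum (I : Type) (s : seq I) (f : I -> S -> R) :
  (forall i, mu.-integrable D (EFin \o f i)) ->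
  mu.-integrable D (EFin \o (fun w => \sum_(i <- s) f i w)).
Proof.
move=> iF; elim: s => [|i s IH].
  by apply: (eq_integrable mD _ _ _ real_integrable0) => w _ /=; rewrite big_nil.
apply: (eq_integrable mD _ _ _ (real_integrableD (iF i) IH)).
by move=> w _ /=; rewrite big_cons.
Qed.

Lemma Rintegral_sum (I : Type) (s : seq I) (f : I -> S -> R) :
  (forall i, mu.-integrable D (EFin \o f i)) ->
  \int[mu]_(w in D) (\sum_(i <- s) f i w) = \sum_(i <- s) \int[mu]_(w in D) f i w.
Proof.
move=> iF; elim: s => [|i s IH].
  rewrite big_nil (@eq_Rintegral _ _ _ _ _ (cst 0)).
    by rewrite Rintegral_cst// mul0r.
  by move=> w _; rewrite big_nil.
rewrite big_cons -IH -RintegralD//; last exact: real_integrable_sum.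
by apply: eq_Rintegral => w _; rewrite big_cons.
Qed.

End real_integrable.

(** The joint law of (Z, V) agrees with the product of the laws on rectangles,
    hence everywhere; Tonelli's theorem then factors the mean of a product of
    nonnegative functions, and the general case follows by splitting both
    factors into positive and negative parts. *)
Section independence.
Context {R : realType} {d : measure_display} {S : measurableType d} (P : probability S R).
Variables (Z V : S -> R).
Hypotheses (mZ : measurable_fun setT Z) (mV : measurable_fun setT V).
Hypothesis indepZV : forall A B : set R, measurable A -> measurable B ->
  P ((Z @^-1` A) `&` (V @^-1` B)) = (P (Z @^-1` A) * P (V @^-1` B))%E.

Let Zm : {mfun S >-> R} := HB.pack Z (isMeasurableFun.Build _ _ _ _ _ mZ).
Let Vm : {mfun S >-> R} := HB.pack V (isMeasurableFun.Build _ _ _ _ _ mV).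
Let ZV w := (Z w, V w).
Let mZV : measurable_fun setT ZV.
Proof. exact: measurable_fun_pair. Qed.
Let ZVm : {mfun S >-> (R * R)%type} := HB.pack ZV (isMeasurableFun.Build _ _ _ _ _ mZV).

Let m1 := distribution P Zm.
Let m2 := distribution P Vm.
Let m := distribution P ZVm.

Let joint_prod X : measurable X -> (m1 \x m2)%E X = m X.
Proof.
apply: product_measure_unique => A B mA mB.
by rewrite /m /distribution /pushforward /= -indepZV.
Qed.

Let ge0_prod (f g : R -> R) : measurable_fun setT f -> measurable_fun setT g ->
  (forall x, 0 <= f x) -> (forall x, 0 <= g x) ->
  (\int[P]_w (f (Z w) * g (V w))%:E = \int[P]_w (f (Z w))%:E * \int[P]_w (g (V w))%:E)%E.
Proof.
move=> mf mg f0 g0.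
pose h (z : R * R) := (f z.1 * g z.2)%:E.
have mh : measurable_fun setT h.
  apply/measurable_EFinP; apply: measurable_funM.
    by apply: (measurableT_comp mf); exact: measurable_fst.
  by apply: (measurableT_comp mg); exact: measurable_snd.
have h0 z : (0 <= h z)%E by rewrite lee_fin mulr_ge0.
transitivity (\int[m]_z h z)%E.
  by rewrite (ge0_integral_distribution ZVm).
transitivity (\int[(m1 \x m2)%E]_z h z)%E.
  by apply: eq_measure_integral => A mA _; first [exact: (joint_prod mA)|exact: (esym (joint_prod mA))].
rewrite fubini_tonelli1//.
have mg' : measurable_fun setT (fun y => (g y)%:E) by exact/measurable_EFinP.
have mf' : measurable_fun setT (fun y => (f y)%:E) by exact/measurable_EFinP.
transitivity (\int[m1]_x ((f x)%:E * \int[m2]_y (g y)%:E))%E.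
  apply: eq_integral => x _; rewrite /fubini_F /h /=.
  under eq_integral do rewrite EFinM.
  by rewrite ge0_integralZl_EFin// => y _; rewrite lee_fin.
have I0 : (0 <= \int[m2]_y (g y)%:E)%E by apply: integral_ge0 => y _; rewrite lee_fin.
rewrite ge0_integralZr//; last by move=> x _; rewrite lee_fin.
by rewrite (ge0_integral_distribution Zm)// (ge0_integral_distribution Vm).
Qed.

Lemma indep_integrableM : P.-integrable setT (EFin \o Z) ->
  P.-integrable setT (EFin \o V) -> P.-integrable setT (EFin \o (Z \* V)).
Proof.
move=> iZ iV; apply/integrableP; split.
  by apply/measurable_EFinP; exact: measurable_funM.
rewrite (eq_integral (fun w => (`|Z w| * `|V w|)%:E)); last first.
  by move=> w _; rewrite /= normrM.
rewrite (@ge0_prod (fun x => `|x|) (fun x => `|x|))// lte_mul_pinfty//.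
- exact: integral_ge0.
- by rewrite ge0_fin_numE; [case/integrableP: iZ|exact: integral_ge0].
- by case/integrableP: iV.
Qed.

Lemma indep_expectationM : P.-integrable setT (EFin \o Z) ->
  P.-integrable setT (EFin \o V) ->
  \int[P]_w (Z w * V w) = \int[P]_w Z w * \int[P]_w V w.
Proof.
move=> iZ iV.
have mp : measurable_fun setT (fun x : R => Num.max x 0).
  by apply: measurable_maxr => //; exact: measurable_id.
have mn : measurable_fun setT (fun x : R => Num.max (- x) 0).
  by apply: measurable_maxr => //; exact: measurableT_comp.
have p0 (x : R) : 0 <= Num.max x 0 by rewrite le_max lexx orbT.
have n0 (x : R) : 0 <= Num.max (- x) 0 by rewrite le_max lexx orbT.
have dec (x : R) : x = Num.max x 0 - Num.max (- x) 0.
  have [x0|x0] := leP 0 x.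
    by rewrite (max_idPr _) ?subr0 ?oppr_le0.
  by rewrite (max_idPl _) ?oppr_ge0 ?ltW// sub0r opprK.
have ip (f : R -> R) (X : S -> R) : measurable_fun setT f -> measurable_fun setT X -> (forall x, 0 <= f x <= `|x|) ->
    P.-integrable setT (EFin \o X) -> P.-integrable setT (EFin \o (f \o X)).
  move=> mf mX fx iX; apply: (le_integrable measurableT _ _ iX).
    by apply/measurable_EFinP; exact: measurableT_comp.
  by move=> w _ /=; rewrite lee_fin ger0_norm; case/andP: (fx (X w)).
have bp (x : R) : 0 <= Num.max x 0 <= `|x| by rewrite p0 /= ge_max ler_norm /=.
have bn (x : R) : 0 <= Num.max (- x) 0 <= `|x| by rewrite n0 /= ge_max -normrN ler_norm /=.
pose Zp w := Num.max (Z w) 0. pose Zn w := Num.max (- Z w) 0.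
pose Vp w := Num.max (V w) 0. pose Vn w := Num.max (- V w) 0.
have iZp : P.-integrable setT (EFin \o Zp) by exact: (ip _ Z mp).
have iZn : P.-integrable setT (EFin \o Zn) by exact: (ip _ Z mn).
have iVp : P.-integrable setT (EFin \o Vp) by exact: (ip _ V mp).
have iVn : P.-integrable setT (EFin \o Vn) by exact: (ip _ V mn).
have prodE (f g : R -> R) : measurable_fun setT f -> measurable_fun setT g ->
    (forall x, 0 <= f x) -> (forall x, 0 <= g x) ->
    P.-integrable setT (EFin \o (f \o Z)) -> P.-integrable setT (EFin \o (g \o V)) ->
    P.-integrable setT (EFin \o (fun w => f (Z w) * g (V w))) /\
    \int[P]_w (f (Z w) * g (V w)) = \int[P]_w (f (Z w)) * \int[P]_w (g (V w)).
  move=> mf mg f0 g0 iF iG; have E := ge0_prod mf mg f0 g0.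
  have F1 := integrable_fin_num measurableT iF.
  have F2 := integrable_fin_num measurableT iG.
  split; last by rewrite /Rintegral E fineM.
  apply/integrableP; split.
    by apply/measurable_EFinP; apply: measurable_funM; exact: measurableT_comp.
  under eq_integral do rewrite /= ger0_norm ?mulr_ge0//.
  rewrite E -ge0_fin_numE; first exact: fin_numM.
  by apply: mule_ge0; apply: integral_ge0 => w _; rewrite lee_fin.
have [i1 e1] := prodE _ _ mp mp p0 p0 iZp iVp.
have [i2 e2] := prodE _ _ mp mn p0 n0 iZp iVn.
have [i3 e3] := prodE _ _ mn mp n0 p0 iZn iVp.
have [i4 e4] := prodE _ _ mn mn n0 n0 iZn iVn.
have -> : \int[P]_w (Z w * V w) = \int[P]_w ((Zp w * Vp w - Zp w * Vn w) - (Zn w * Vp w - Zn w * Vn w)).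
  by apply: eq_Rintegral => w _; rewrite {1}(dec (Z w)) {1}(dec (V w)) mulrBl !mulrBr.
have -> : \int[P]_w Z w = \int[P]_w (Zp w - Zn w) by apply: eq_Rintegral => w _; exact: dec.
have -> : \int[P]_w V w = \int[P]_w (Vp w - Vn w) by apply: eq_Rintegral => w _; exact: dec.
rewrite RintegralB//; [|exact: real_integrableB|exact: real_integrableB].
rewrite !RintegralB// e1 e2 e3 e4.
by rewrite mulrBl !mulrBr.
Qed.

End independence.

Lemma continuous_borel_measurable (R : realType) (V : ptopologicalType) (f : V -> R) :
  continuous f -> measurable_fun [set: g_sigma_algebraType (@open V)] f.
Proof.
move=> /continuousP cf; apply: (measurability _ (RGenOpens.measurableE R)) => //.
move=> _ [_ [a [b ->] <-]]; rewrite setTI.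
by apply: sub_sigma_algebra; apply: cf; exact: interval_open.
Qed.

Lemma continuous_borel_preimage (R : realType) (V : ptopologicalType) (f : V -> R) (B : set R) :
  continuous f -> measurable B -> borel_set (f @^-1` B).
Proof.
move=> cf mB; have := continuous_borel_measurable cf measurableT mB.
by rewrite setTI.
Qed.

(** A filtration consists of families of sets; the type below carries such a
    family as its measurable sets, which makes the closure properties of
    measurable functions available. *)
Definition measurable_wrt (R : realType) (S : pointedType) (G : set (set S)) (Z : S -> R) :=
  measurable_fun [set: g_sigma_algebraType G] (Z : g_sigma_algebraType G -> R).

Lemma measurable_wrt_preimage (R : realType) (S : pointedType) (G : set (set S)) (Z : S -> R) B :
  sigma_algebra setT G -> measurable_wrt G Z -> measurable B -> G (Z @^-1` B).
Proof.
by move=> sG mZ mB; have := mZ measurableT B mB; rewrite setTI /measurable /= sigma_algebra_id.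
Qed.

Lemma measurable_wrtI (R : realType) (S : pointedType) (G : set (set S)) (Z : S -> R) :
  (forall B, measurable B -> G (Z @^-1` B)) -> measurable_wrt G Z.
Proof. by move=> GZ _ B mB; rewrite setTI; apply: sub_sigma_algebra; exact: GZ. Qed.

Section brownian.
Context {R : realType} {n : nat} {d : measure_display} {S : measurableType d}
  (P : probability S R) (F : R -> set (set S)) (W : R -> S -> 'rV[R]_n).
Hypothesis usualF : usual_conditions P F.
Hypothesis brownianW : brownian_motion P F W.

Lemma measurable_wrt_measurable (t : R) (Z : S -> R) : 0 <= t ->
  measurable_wrt (F t) Z -> measurable_fun setT Z.
Proof.
move=> t0 mZ _ B mB; rewrite setTI.
apply: (filtration_measurable usualF t0).
by apply: measurable_wrt_preimage => //; exact: (filtration_sigma_algebra usualF t0).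
Qed.

Lemma adapted_measurable_wrt (X : R -> S -> 'rV[R]_n) (f : 'rV[R]_n -> R) (t : R) :
  adapted F X -> continuous f -> 0 <= t -> measurable_wrt (F t) (fun w => f (X t w)).
Proof.
move=> aX cf t0; apply: measurable_wrtI => B mB.
by apply: (aX t t0 (f @^-1` B)); exact: continuous_borel_preimage.
Qed.

Lemma brownian_coord_measurable (t : R) i : 0 <= t ->
  measurable_fun setT (fun w => W t w ord0 i).
Proof.
move=> t0; apply: (measurable_wrt_measurable t0).
apply: (@adapted_measurable_wrt W (fun x => x ord0 i)) => //.
- exact: (brownian_adapted brownianW).
- exact: coord_continuous.
Qed.

Variables (c c4 : R).
Hypothesis normal_c : forall s : R, 0 < s ->
  [/\ (\int[normal_prob 0 s]_x (x ^+ 2)%:E = (c * s ^+ 2)%:E)%E,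
      (\int[normal_prob 0 s]_x (x ^+ 4)%:E = (c4 * s ^+ 4)%:E)%E &
      (\int[normal_prob 0 s]_x (Num.max x 0)%:E = \int[normal_prob 0 s]_x (Num.max (- x) 0)%:E)%E].

Section increment.
Variables (s t : R).
Hypotheses (s0 : 0 <= s) (st : s < t).
Let t0 : 0 <= t := le_trans s0 (ltW st).
Let sd := Num.sqrt (t - s).
Let sd0 : 0 < sd. Proof. by rewrite sqrtr_gt0 subr_gt0. Qed.
Let sd2 : sd ^+ 2 = t - s. Proof. by rewrite sqr_sqrtr// subr_ge0 ltW. Qed.

Definition increment (i : 'I_n) (w : S) : R := (W t w - W s w) ord0 i.
Local Notation xi := increment.

Lemma incrementE i w : xi i w = W t w ord0 i - W s w ord0 i.
Proof. by rewrite /increment !mxE. Qed.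

Lemma measurable_increment i : measurable_fun setT (xi i).
Proof.
rewrite (_ : xi i = fun w => W t w ord0 i - W s w ord0 i); last by apply/funext => w; exact: incrementE.
by apply: measurable_funB; exact: brownian_coord_measurable.
Qed.

Let prod_rect (i j : 'I_n) (A B : set R) : i != j -> measurable A -> measurable B ->
  P ((xi i @^-1` A) `&` (xi j @^-1` B)) = (normal_prob 0 sd A * normal_prob 0 sd B)%E.
Proof.
move=> ij mA mB.
pose C k : set R := if k == i then A else if k == j then B else setT.
have mC k : measurable (C k) by rewrite /C; case: ifP => // _; case: ifP.
have := brownian_gaussian brownianW s0 st mC.
rewrite (bigD1 i)//= (bigD1 j)//= 1?eq_sym// big1 => [|k /andP[ki kj]]; last first.
  by rewrite /C (negbTE ki) (negbTE kj) probability_setT.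
rewrite mule1 {2 3}/C eqxx eq_sym (negbTE ij) eqxx => <-; congr (P _).
apply/seteqP; split => [w [wi wj] k|w H].
  by rewrite /C; case: eqP => [->//|_]; case: eqP => [->//|].
split; first by have := H i; rewrite /C eqxx.
by have := H j; rewrite /C eq_sym (negbTE ij) eqxx.
Qed.

Let rect (i : 'I_n) (A : set R) : measurable A -> P (xi i @^-1` A) = normal_prob 0 sd A.
Proof.
move=> mA.
pose C k : set R := if k == i then A else setT.
have mC k : measurable (C k) by rewrite /C; case: ifP.
have := brownian_gaussian brownianW s0 st mC.
rewrite (bigD1 i)//= big1 => [|k ki]; last first.
  by rewrite /C (negbTE ki) probability_setT.
rewrite mule1 {2}/C eqxx => <-; congr (P _).
apply/seteqP; split => [w wi k|w H].
  by rewrite /C; case: eqP => [->//|_].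
by have := H i; rewrite /C eqxx.
Qed.

Let ge0_law (i : 'I_n) (f : R -> R) : (forall x, 0 <= f x) -> measurable_fun setT f ->
  (\int[P]_w (f (xi i w))%:E = \int[normal_prob 0 sd]_x (f x)%:E)%E.
Proof.
move=> f0 mf.
have mx : measurable_fun [set: S] (xi i : S -> measurableTypeR R).
  exact: measurable_increment.
pose xm : {mfun S >-> measurableTypeR R} := HB.pack (xi i : S -> measurableTypeR R)
  (isMeasurableFun.Build _ _ S (measurableTypeR R) (xi i : S -> measurableTypeR R) mx).
have mf' : measurable_fun setT (fun x => (f x)%:E) by exact/measurable_EFinP.
transitivity (\int[distribution P xm]_x (f x)%:E)%E.
  by rewrite (ge0_integral_distribution xm).
apply: eq_measure_integral => A mA _.
exact: rect.
Qed.

Lemma increment4_integrable i : P.-integrable setT (EFin \o (fun w => xi i w ^+ 4)).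
Proof.
apply/integrableP; split.
  by apply/measurable_EFinP; apply: measurable_funX; exact: measurable_increment.
under eq_integral do rewrite /= ger0_norm ?exprn_even_ge0//.
rewrite (@ge0_law i (fun x => x ^+ 4)); [|by move=> x; rewrite exprn_even_ge0|exact: measurable_funX].
by have [_ -> _] := normal_c sd0; rewrite ltry.
Qed.

Lemma increment2_integrable i : P.-integrable setT (EFin \o (fun w => xi i w ^+ 2)).
Proof.
apply/integrableP; split.
  by apply/measurable_EFinP; apply: measurable_funX; exact: measurable_increment.
under eq_integral do rewrite /= ger0_norm ?sqr_ge0//.
rewrite (@ge0_law i (fun x => x ^+ 2)); [|by move=> x; rewrite sqr_ge0|exact: measurable_funX].
by have [-> _ _] := normal_c sd0; rewrite ltry.
Qed.

Lemma increment_integrable i : P.-integrable setT (EFin \o xi i).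
Proof.
have i1 : P.-integrable setT (EFin \o (fun w => 1 + xi i w ^+ 2)).
  apply: real_integrableD => //; last exact: increment2_integrable.
  exact: finite_measure_integrable_cst.
apply: (le_integrable measurableT _ _ i1).
  by apply/measurable_EFinP; exact: measurable_increment.
move=> w _ /=; rewrite lee_fin [leRHS]ger0_norm ?addr_ge0 ?sqr_ge0//.
rewrite ler_norml; apply/andP; split.
  by have := sqr_ge0 (xi i w + 1); nra.
by have := sqr_ge0 (xi i w - 1); nra.
Qed.

Lemma increment4_expectation i : \int[P]_w (xi i w ^+ 4) = c4 * (t - s) ^+ 2.
Proof.
rewrite /Rintegral (@ge0_law i (fun x => x ^+ 4)); [|by move=> x; rewrite exprn_even_ge0|exact: measurable_funX].
have [_ -> _] := normal_c sd0.
by rewrite /= -sd2 -exprM.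
Qed.

Lemma increment2_expectation i : \int[P]_w (xi i w ^+ 2) = c * (t - s).
Proof.
rewrite /Rintegral (@ge0_law i (fun x => x ^+ 2)); [|by move=> x; rewrite sqr_ge0|exact: measurable_funX].
have [-> _ _] := normal_c sd0.
by rewrite /= -sd2.
Qed.

Lemma increment_expectation i : \int[P]_w (xi i w) = 0.
Proof.
have mp : measurable_fun setT (fun x : R => Num.max x 0).
  by apply: measurable_maxr => //; exact: measurable_id.
have mn : measurable_fun setT (fun x : R => Num.max (- x) 0).
  by apply: measurable_maxr => //; exact: measurableT_comp.
rewrite /Rintegral integralE.
rewrite (eq_integral (fun w => (Num.max (xi i w) 0)%:E)); last first.
  by move=> w _; rewrite funeposE EFin_max.
rewrite (eq_integral (fun w => (Num.max (- xi i w) 0)%:E) (EFin \o xi i)^\-%E); last first.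
  by move=> w _; rewrite funenegE EFin_max.
rewrite (@ge0_law i (fun x => Num.max x 0))//; last by move=> x; rewrite le_max lexx orbT.
rewrite (@ge0_law i (fun x => Num.max (- x) 0))//; last by move=> x; rewrite le_max lexx orbT.
have [_ _ ->] := normal_c sd0.
(* An infinite common value would do as well: +oo - +oo is -oo, of real part 0. *)
by case: (\int[_]_x _)%E => [y| |] //=; rewrite subrr.
Qed.

Lemma increment_pair (i j : 'I_n) : P.-integrable setT (EFin \o (fun w => xi i w * xi j w)) /\
  \int[P]_w (xi i w * xi j w) = (i == j)%:R * (c * (t - s)).
Proof.
have [->|ij] := eqVneq i j.
  split; first exact: increment2_integrable.
  by rewrite mul1r -(increment2_expectation j); apply: eq_Rintegral => w _; rewrite expr2.
have ind (A B : set R) : measurable A -> measurable B ->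
    P ((xi i @^-1` A) `&` (xi j @^-1` B)) = (P (xi i @^-1` A) * P (xi j @^-1` B))%E.
  by move=> mA mB; rewrite prod_rect// !rect.
split.
  by apply: (indep_integrableM (measurable_increment i) (measurable_increment j) ind);
    exact: increment_integrable.
rewrite (indep_expectationM (measurable_increment i) (measurable_increment j) ind);
  [|exact: increment_integrable|exact: increment_integrable].
by rewrite increment_expectation !mul0r.
Qed.

Lemma increment_indep (Z : S -> R) (phi : 'rV[R]_n -> R) :
  measurable_wrt (F s) Z -> continuous phi ->
  forall A B : set R, measurable A -> measurable B ->
  P ((Z @^-1` A) `&` ((fun w => phi (W t w - W s w)%R) @^-1` B)) =
  (P (Z @^-1` A) * P ((fun w => phi (W t w - W s w)%R) @^-1` B))%E.
Proof.
move=> mZ cphi A B mA mB.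
have FA : F s (Z @^-1` A).
  by apply: measurable_wrt_preimage => //; exact: (filtration_sigma_algebra usualF s0).
exact: (brownian_independent brownianW s0 st FA (continuous_borel_preimage cphi mB)).
Qed.

(** This takes the place of conditioning on the past: a factor known at time s
    can be integrated separately from a function of the increment. *)
Lemma increment_freeze (Z : S -> R) (phi : 'rV[R]_n -> R) (M : R) :
  measurable_wrt (F s) Z -> (forall w, `|Z w| <= M) -> continuous phi ->
  P.-integrable setT (EFin \o (fun w => phi (W t w - W s w)%R)) ->
  P.-integrable setT (EFin \o (fun w => Z w * phi (W t w - W s w))) /\
  \int[P]_w (Z w * phi (W t w - W s w)) = \int[P]_w Z w * \int[P]_w phi (W t w - W s w).
Proof.
move=> mZ ZM cphi iphi.
have mZ' := measurable_wrt_measurable s0 mZ.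
have iZ : P.-integrable setT (EFin \o Z).
  exact: bounded_integrable mZ' ZM.
have mphi : measurable_fun setT (fun w => phi (W t w - W s w)%R).
  by apply/measurable_EFinP; exact: measurable_int iphi.
have ind := increment_indep mZ cphi.
by split; [exact: (indep_integrableM mZ' mphi ind)|exact: (indep_expectationM mZ' mphi ind)].
Qed.

(** The mean of a second-order expansion with coefficients known at time s: the
    linear terms and the off-diagonal quadratic ones vanish, the diagonal ones
    give the second-order part of the generator. *)
Lemma quadratic_expectation (z : S -> R) (a : 'I_n -> S -> R) (b : 'I_n -> 'I_n -> S -> R) (K M : R) :
  measurable_wrt (F s) z -> (forall i, measurable_wrt (F s) (a i)) ->
  (forall i j, measurable_wrt (F s) (b i j)) ->
  (forall w, `|z w| <= M) -> (forall i w, `|a i w| <= M) -> (forall i j w, `|b i j w| <= M) ->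
  let f w := z w + \sum_i a i w * xi i w + \sum_i \sum_j b i j w * (xi i w * xi j w)
             + K * \sum_i xi i w ^+ 4 in
  P.-integrable setT (EFin \o f) /\
  \int[P]_w f w = \int[P]_w z w + c * (t - s) * \sum_i \int[P]_w b i i w
                  + K * (n%:R * (c4 * (t - s) ^+ 2)).
Proof.
move=> mz ma mb zM aM bM f.
have iz : P.-integrable setT (EFin \o z).
  exact: bounded_integrable (measurable_wrt_measurable s0 mz) zM.
have ha i : P.-integrable setT (EFin \o (fun w => a i w * xi i w)) /\ \int[P]_w (a i w * xi i w) = 0.
  have [h1 h2] := @increment_freeze (a i) (fun x => x ord0 i) M (ma i) (aM i) (@coord_continuous _ _ _ _ _) (increment_integrable i).
  by split=> //; rewrite h2 increment_expectation mulr0.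
have hb i j : P.-integrable setT (EFin \o (fun w => b i j w * (xi i w * xi j w))) /\
   \int[P]_w (b i j w * (xi i w * xi j w)) = \int[P]_w b i j w * ((i == j)%:R * (c * (t - s))).
  have [p1 p2] := increment_pair i j.
  have cc : continuous (fun x : 'rV[R]_n => x ord0 i * x ord0 j).
    by move=> x; exact: (cvgM (@coord_continuous R 1 n ord0 i x) (@coord_continuous R 1 n ord0 j x)).
  have [h1 h2] := @increment_freeze (b i j) (fun x => x ord0 i * x ord0 j) M (mb i j) (bM i j) cc p1.
  by split => //; rewrite h2 -p2.
have isa := real_integrable_sum measurableT (index_enum 'I_n) (fun i => (ha i).1).
have isb1 i := real_integrable_sum measurableT (index_enum 'I_n) (fun j => (hb i j).1).
have isb := real_integrable_sum measurableT (index_enum 'I_n) isb1.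
have i4 := real_integrableZ measurableT K (real_integrable_sum measurableT (index_enum 'I_n) increment4_integrable).
have i12 := real_integrableD measurableT iz isa.
have i123 := real_integrableD measurableT i12 isb.
split; first exact: real_integrableD.
rewrite (RintegralD measurableT i123 i4) (RintegralD measurableT i12 isb) (RintegralD measurableT iz isa).
rewrite (Rintegral_sum measurableT _ (fun i => (ha i).1)) big1 ?addr0; last by move=> i _; rewrite (ha i).2.
rewrite (Rintegral_sum measurableT _ isb1).
rewrite RintegralZl//; last exact: real_integrable_sum increment4_integrable.
rewrite (Rintegral_sum measurableT _ increment4_integrable).
congr (_ + _ + _ * _).
  rewrite mulr_sumr; apply: eq_bigr => i _.
  rewrite (Rintegral_sum measurableT _ (fun j => (hb i j).1)) (bigD1 i)//= big1 ?addr0.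
    by rewrite (hb i i).2 eqxx mul1r mulrC.
  by move=> j ji; rewrite (hb i j).2 eq_sym (negbTE ji) mul0r mulr0.
rewrite (eq_bigr (fun=> c4 * (t - s) ^+ 2)); last by move=> i _; rewrite increment4_expectation.
by rewrite sumr_const card_ord mulr_natl.
Qed.

End increment.
End brownian.

(** * Modulus of continuity and displacement due to the drift *)

(** Extending a path by its initial value turns continuity on the half-line into
    continuity on the line. *)
Lemma continuous_path_max0 (R : realType) (V : topologicalType) (f : R -> V) :
  continuous_path f -> continuous (fun t : R => f (Num.max 0 t)).
Proof.
move=> /subspace_continuousP cf t.
have ct : Num.max 0 t \in (`[0, +oo[%classic : set R).
  by rewrite inE /= in_itv /= andbT le_max lexx.
have := cf (Num.max 0 t); rewrite inE in ct => /(_ ct) cft.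
move=> B fB; have cA := cft _ fB.
have cmax : Num.max 0 u @[u --> t] --> Num.max 0 t.
  by apply: continuous_max; [exact: cvg_cst|exact: cvg_id].
have {}cA : nbhs (Num.max 0 t) [set y | `[0, +oo[%classic y -> B (f y)] := cA.
have nB : \forall u \near t, `[0, +oo[%classic (Num.max 0 u) -> B (f (Num.max 0 u)) := cmax _ cA.
change (\forall u \near t, B (f (Num.max 0 u))).
near=> u; apply: (near nB u) => //=; by rewrite in_itv /= andbT le_max lexx.
Unshelve. all: by end_near.
Qed.

Lemma coord_diff_le (R : realType) (n : nat) (x y : 'rV[R]_n) i :
  `|x ord0 i - y ord0 i| <= `|x - y|.
Proof.
have -> : x ord0 i - y ord0 i = (x - y) ord0 i by rewrite !mxE.
rewrite [leRHS]mx_normrE.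
exact: (le_bigmax _ (fun ij => `|(x - y) ij.1 ij.2|) (ord0, i)).
Qed.

Section modulus.
Context {R : realType} {n : nat} {d : measure_display} {S : measurableType d}
  (P : probability S R) (Z : R -> S -> 'rV[R]_n).
Hypothesis mZ : forall t i, 0 <= t -> measurable_fun setT (fun w => Z t w ord0 i).

(** Almost all paths are uniformly continuous on [0, T], with a modulus that
    depends on the path; outside an event of small probability it does not. The
    events E m on which the modulus at scale 1/(m+1) is good increase to a set of
    full measure. Testing rational times only makes them measurable, at the cost
    of constant factors in the bounds. *)
Lemma continuity_event (Q : S -> Prop) (T del eta : R) :
  {ae P, forall w, continuous_path (Z ^~ w) /\ Q w} ->
  0 < T -> 0 < del -> 0 < eta ->
  exists h0 (E : set S), [/\ 0 < h0, measurable E, (P (~` E) <= eta%:E)%E &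
    forall w, E w -> Q w /\ forall s t, 0 <= s <= T -> 0 <= t <= T -> `|s - t| <= h0 ->
      forall i, `|Z s w ord0 i - Z t w ord0 i| <= del].
Proof.
move=> [N [mN PN subN]] T0 del0 eta0.
have goodN w : ~ N w -> continuous_path (Z ^~ w) /\ Q w.
  by move=> Nw; apply: contrapT => H; apply: Nw; apply: subN.
pose del3 := del / 3.
have del30 : 0 < del3 by rewrite divr_gt0.
pose I := (rat * rat * 'I_n)%type.
pose ok (m : nat) (k : I) := [&& (0 <= (ratr k.1.1 : R) <= T), (0 <= (ratr k.1.2 : R) <= T) &
   (`|ratr k.1.1 - ratr k.1.2 : R| <= m.+1%:R^-1)].
pose bad (m : nat) (k : I) : set S := if ok m k then
  [set w | `|Z (ratr k.1.1) w ord0 k.2 - Z (ratr k.1.2) w ord0 k.2| > del3] else set0.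
have mbad m k : measurable (bad m k).
  rewrite /bad; case: ifPn => // /and3P[/andP[k1 _] /andP[k2 _] _].
  have mf : measurable_fun setT (fun w => `|Z (ratr k.1.1) w ord0 k.2 - Z (ratr k.1.2) w ord0 k.2|).
    by apply: measurableT_comp => //; apply: measurable_funB; exact: mZ.
  have := mf measurableT _ (measurable_itv `]del3, +oo[%R); rewrite setTI.
  by congr measurable; apply/seteqP; split => w /=; rewrite in_itv /= andbT.
pose E m : set S := ~` N `\` \bigcup_k bad m k.
have mE m : measurable (E m).
  apply: measurableD; first exact: measurableC.
  by apply: countable_bigcupT_measurable => //; exact: countableP.
have ndE : nondecreasing_seq E.
  move=> m k mk; apply/subsetPset => w [Nw bw]; split => // -[j _ bj]; apply: bw.
  exists j => //; move: bj; rewrite /bad; case: ifPn => // /and3P[j1 j2 j3].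
  rewrite /ok j1 j2 (le_trans j3)//= lef_pV2 ?posrE// ler_nat.
  by [].
have unif w : ~ N w -> forall e, 0 < e -> exists2 r, 0 < r &
    forall s t, 0 <= s <= T -> 0 <= t <= T -> `|s - t| < r -> forall i, `|Z s w ord0 i - Z t w ord0 i| < e.
  move=> /goodN[/continuous_path_max0 cw _] e e0.
  have [r r0 hr] := uniformly_continuous_segment 0 T cw e0.
  exists r => // s t s0 t0 st i.
  have := hr s t s0 t0 st; rewrite !(max_idPr _); [|by case/andP: t0|by case/andP: s0].
  by apply: le_lt_trans; exact: coord_diff_le.
have UE : \bigcup_m E m = ~` N.
  apply/seteqP; split => [w [m _ []]//|w Nw].
  have [r r0 hr] := unif w Nw del3 del30.
  have [m] := ltr_add_invr r0; rewrite add0r => mr.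
  exists m => //; split => // -[k _]; rewrite /bad; case: ifPn => // /and3P[k1 k2 k3].
  by rewrite /= ltNge ltW// hr// (le_lt_trans k3).
have PNC : P (~` N) = 1%E by rewrite probability_setC// PN sube0.
have cvgE : P (E m) @[m --> \oo] --> (1 : \bar R)%E.
  by rewrite -PNC -UE; apply: nondecreasing_cvg_mu => //; rewrite UE; exact: measurableC.
have [m Pm] : exists m, (P (~` E m) <= eta%:E)%E.
  apply: contrapT => H.
  have : (1 <= 1 - eta%:E :> \bar R)%E.
    apply: (cvge_to_le cvgE); near=> m.
    have : ~ (P (~` E m) <= eta%:E)%E by move=> h; apply: H; exists m.
    rewrite probability_setC// => /negP; rewrite -ltNge => h.
    rewrite leeBrDr// ltW//; move: h; rewrite lteBrDr ?fin_num_measure//.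
    by rewrite addeC.
  by rewrite leeBrDr// -EFinD lee_fin gerDl leNgt eta0.
exists (m.+1%:R^-1 / 2), (E m); split => //.
move=> w [Nw bw]; split; first by case: (goodN w Nw).
move=> s t sT tT st i.
have [r r0 hr] := unif w Nw del3 del30.
pose e := Num.min r (m.+1%:R^-1 / 4).
have e0 : 0 < e by rewrite lt_min r0 divr_gt0.
have ratnear u : 0 <= u <= T -> exists q : rat, 0 <= (ratr q : R) <= T /\ `|u - ratr q| < e.
  move=> /andP[u0 uT].
  have : Num.max 0 (u - e) < Num.min T (u + e).
    rewrite lt_min !gt_max T0 /= (ltr_wpDl u0 e0)/=.
    by apply/andP; split; lra.
  move=> /rat_in_itvoo[q]; rewrite in_itv /= gt_max lt_min => /andP[/andP[q1 q2] /andP[q3 q4]].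
  exists q; split; first by rewrite !ltW.
  move: q1 q2 q3 q4; move: (ratr q : R) => x q1 q2 q3 q4.
  by rewrite ltr_norml; apply/andP; split; lra.
have [p [pT sp]] := ratnear s sT.
have [q [qT tq]] := ratnear t tT.
have er : e <= r by rewrite /e ge_min lexx.
have em : e <= m.+1%:R^-1 / 4 by rewrite /e ge_min lexx orbT.
have pq : `|ratr p - ratr q : R| <= m.+1%:R^-1.
  move: sp tq st em; move: (e) (ratr p : R) (ratr q : R) (m.+1%:R^-1 : R) => e' x y k.
  rewrite ler_norml ler_norml !ltr_norml => /andP[? ?] /andP[? ?] /andP[? ?] ?.
  by apply/andP; split; lra.
have h1 : `|Z (ratr p) w ord0 i - Z (ratr q) w ord0 i| <= del3.
  rewrite leNgt; apply/negP => H; apply: bw; exists (p, q, i) => //.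
  by rewrite /bad /ok /= pT qT pq.
have h2 := hr s (ratr p) sT pT (lt_le_trans sp er) i.
have h3 := hr t (ratr q) tT qT (lt_le_trans tq er) i.
move: h1 h2 h3; rewrite ler_norml ler_norml !ltr_norml => /andP[? ?] /andP[? ?] /andP[? ?].
have d3 : del3 = del / 3 by [].
by apply/andP; split; lra.
Unshelve. all: by end_near. Qed.

End modulus.

Section drift.
Context {R : realType} {n : nat}.
Local Notation mu := (@lebesgue_measure R).

Lemma continuous_preimage_borel (V : ptopologicalType) (x : R -> V) (B : set V) :
  continuous x -> borel_set B -> measurable (x @^-1` B).
Proof.
move=> /continuousP cx.
have : measurable_fun [set: R] (x : R -> g_sigma_algebraType (@open V)).
  apply: (@measurability _ _ R (g_sigma_algebraType (@open V)) _ _ (@open V)) => //.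
  by move=> _ [U oU <-]; rewrite setTI; apply: open_measurable; exact: cx.
by move=> mx bB; have := mx measurableT B bB; rewrite setTI.
Qed.

Variables (b : 'rV[R]_n -> 'rV[R]_n) (M : R).
Hypothesis mb : borel_fun b.
Hypothesis bM : forall x i, `|b x ord0 i| <= M.

Lemma drift_integrable (x : R -> 'rV[R]_n) (s t : R) i : continuous_path x -> 0 <= s ->
  mu.-integrable `]s, t] (EFin \o (fun u => b (x u) ord0 i)) /\
  mu.-integrable `[s, t] (EFin \o (fun u => b (x u) ord0 i)).
Proof.
move=> /continuous_path_max0 cx s0.
have mf : measurable_fun [set: R] (fun u : R => b (x (Num.max 0 u)) ord0 i).
  move=> _ B mB; rewrite setTI.
  have : borel_set (b @^-1` ((fun y : 'rV[R]_n => y ord0 i) @^-1` B)).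
    by apply: mb; apply: continuous_borel_preimage => //; exact: coord_continuous.
  by move=> /(continuous_preimage_borel cx).
have eqx (D : set R) : D `<=` `[0, +oo[%classic -> measurable_fun D (fun u => b (x u) ord0 i).
  move=> D0; apply: (eq_measurable_fun (fun u : R => b (x (Num.max 0 u)) ord0 i)).
    move=> u; rewrite inE => /D0 /=; rewrite in_itv /= andbT => u0.
    by rewrite (max_idPr u0).
  exact: measurable_funTS.
have fin b1 b2 : (@lebesgue_measure R [set` Interval (BSide b1 s) (BSide b2 t)] < +oo)%E.
  by rewrite lebesgue_measure_itv /=; case: ifP => _; rewrite ?ltry// -EFinB ltry.
have [ts|st] := ltP t s.
  by rewrite !set_itv_ge ?bnd_simp -?ltNge -?leNgt// ?ltW//; split; exact: integrable_set0.
split; apply: (@integrable_of_bound _ _ _ mu _ _ M) => //.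
- exact: (fin false false).
- by apply: eqx => u /=; rewrite !in_itv /= andbT => /andP[su _]; rewrite ltW// (le_lt_trans s0).
- exact: (fin true false).
- by apply: eqx => u /=; rewrite !in_itv /= andbT => /andP[su _]; rewrite (le_trans s0).
Qed.

(** The displacement due to the drift is the integral of b along the path, so it
    inherits every bound on b and on <y, b> along the path. *)
Lemma drift_increment (x : R -> 'rV[R]_n) (W : R -> 'rV[R]_n) (eps s t : R) :
  continuous_path x ->
  (forall t, 0 <= t -> forall i, x t ord0 i =
    \int[mu]_(u in `[0%R, t]) b (x u) ord0 i + eps * W t ord0 i) ->
  0 <= s -> s < t ->
  let beta := x t - x s - eps *: (W t - W s) in
  (forall i, `|beta ord0 i| <= M * (t - s)) /\
  forall (y : 'rV[R]_n) (K : R), (forall u, s <= u <= t -> dotv y (b (x u)) <= K) ->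
    dotv y beta <= K * (t - s).
Proof.
move=> cx eqx s0 st beta.
have t0 : 0 <= t := le_trans s0 (ltW st).
have mst : mu (`]s, t]%classic : set R) = (t - s)%:E.
  by rewrite lebesgue_measure_itv /= lte_fin st EFinB.
have betaE i : beta ord0 i = \int[mu]_(u in `]s, t]) b (x u) ord0 i.
  rewrite /beta !mxE !eqx//.
  have [_ i2] := drift_integrable t i cx (lexx 0).
  have := Rintegral_itvB i2 (_ : (BLeft 0 <= BRight s)%O) (_ : (BRight s <= BRight t)%O).
  rewrite !bnd_simp s0 ltW// => /(_ isT isT) <-; ring.
have ifin K : mu.-integrable `]s, t] (EFin \o (fun=> K : R)).
  apply: (@integrable_of_bound _ _ _ mu _ _ `|K|) => //.
  by rewrite [X in (X < _)%E]mst ltry.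
have cstE K : \int[mu]_(u in `]s, t]) K = K * (t - s).
  by rewrite Rintegral_cst// (_ : fine _ = t - s)//; exact: (congr1 fine mst).
split=> [i|y K yK].
  have [i1 _] := drift_integrable t i cx s0.
  rewrite betaE; apply: le_trans (le_normr_Rintegral _ i1) _ => //.
  rewrite -cstE; apply: le_Rintegral => //.
  by apply: (eq_integrable _ _ _ _ (integrable_abse i1)) => // u _.
have -> : dotv y beta = \int[mu]_(u in `]s, t]) dotv y (b (x u)).
  rewrite /dotv Rintegral_sum//; last first.
    by move=> i; apply: real_integrableZ => //; exact: (drift_integrable t i cx s0).1.
  apply: eq_bigr => i _; rewrite betaE RintegralZl//.
  exact: (drift_integrable t i cx s0).1.
rewrite -cstE; apply: le_Rintegral => //.
  apply: real_integrable_sum => // i; apply: real_integrableZ => //.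
  exact: (drift_integrable t i cx s0).1.
by move=> u /=; rewrite in_itv /= => /andP[su ut]; apply: yK; rewrite ltW.
Qed.

End drift.

Lemma ae_le_Rintegral d (S : measurableType d) (R : realType) (P : {measure set S -> \bar R})
    (f g : S -> R) : P.-integrable setT (EFin \o f) -> P.-integrable setT (EFin \o g) ->
  {ae P, forall w, f w <= g w} -> \int[P]_w f w <= \int[P]_w g w.
Proof.
move=> iF iG fg.
have iD := real_integrableB measurableT iG iF.
rewrite -subr_ge0 -RintegralB//.
have mD : measurable_fun setT (fun w => g w - f w).
  by apply/measurable_EFinP; exact: measurable_int iD.
rewrite /Rintegral (_ : (\int[P]_w (g w - f w)%:E)%E = (\int[P]_w `|g w - f w|%:E)%E).
  by apply: fine_ge0; apply: integral_ge0 => w _; rewrite lee_fin.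
apply: ae_eq_integral => //.
- exact/measurable_EFinP.
- by apply/measurable_EFinP; exact: measurableT_comp.
by apply: filterS fg => w fgw _; rewrite ger0_norm// subr_ge0.
Qed.

Section measurable_wrt_closure.
Context {R : realType} {S : pointedType} (G : set (set S)).
Implicit Types Z V : S -> R.

Lemma measurable_wrt_cst (a : R) : measurable_wrt G (fun=> a).
Proof. exact: measurable_cst. Qed.

Lemma measurable_wrtD Z V : measurable_wrt G Z -> measurable_wrt G V ->
  measurable_wrt G (fun w => Z w + V w).
Proof. by move=> mZ mV; exact: measurable_funD. Qed.

Lemma measurable_wrtM Z V : measurable_wrt G Z -> measurable_wrt G V ->
  measurable_wrt G (fun w => Z w * V w).
Proof. by move=> mZ mV; exact: measurable_funM. Qed.

Lemma measurable_wrt_lt Z (r : R) : measurable_wrt G Z ->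
  measurable_wrt G (fun w => (Z w < r)%R%:R : R).
Proof.
move=> mZ.
have m1 : measurable_fun [set: R] (\1_[set` `]-oo, r[%R] : R -> R) by exact: measurable_indic.
have := measurableT_comp m1 mZ; apply: eq_measurable_fun => w _ /=.
by rewrite indicE /= mem_setE in_itv.
Qed.

End measurable_wrt_closure.

Lemma sqnorm_continuous (R : realType) (n : nat) : continuous (@sqnorm R n).
Proof.
rewrite (_ : @sqnorm R n = fun x => \sum_i x ord0 i * x ord0 i)//.
apply: continuous_big; first exact: add_continuous.
move=> i _ x; exact: (cvgM (@coord_continuous R 1 n ord0 i x) (@coord_continuous R 1 n ord0 i x)).
Qed.

(** Exit from the ball is tested at the times 0, h, 2 h, ... only: with
    finitely many tests no stopping time in continuous time is needed. *)
Fixpoint alive (R : realType) (n : nat) (x : R -> 'rV[R]_n) (h r : R) (k : nat) : bool :=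
  match k with
  | 0 => sqnorm (x 0) < r
  | k'.+1 => alive x h r k' && (sqnorm (x (k%:R * h)) < r)
  end.

Lemma alive_lt (R : realType) (n : nat) (x : R -> 'rV[R]_n) (h r : R) k :
  alive x h r k -> sqnorm (x (k%:R * h)) < r.
Proof. by case: k => [|k] /=; [rewrite mul0r|case/andP]. Qed.

Lemma sqnorm_lt_coord (R : realType) (n : nat) (x : 'rV[R]_n) (r : R) i :
  sqnorm x <= r -> `|x ord0 i| <= 1 + r.
Proof.
move=> xr; have := sqr_coord_le x i; move=> H.
have r0 : 0 <= r := le_trans (sqnorm_ge0 x) xr.
rewrite -ler_sqr ?nnegrE ?addr_ge0// real_normK ?num_real//.
by apply: (le_trans H); apply: (le_trans xr); nra.
Qed.

Lemma sqnorm_perturb (R : realType) (n : nat) (x x' : 'rV[R]_n) (r del : R) :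
  sqnorm x <= r -> 0 <= del <= 1 -> (forall i, `|x' ord0 i - x ord0 i| <= del) ->
  `|sqnorm x' - sqnorm x| <= del * (n%:R * (2 * (1 + r) + 1)).
Proof.
move=> xr /andP[del0 del1] xx'.
rewrite /sqnorm /dotv -sumrB; apply: le_trans (ler_norm_sum _ _ _) _.
apply: le_trans (_ : \sum_(i < n) del * (2 * (1 + r) + 1) <= _); last first.
  rewrite sumr_const card_ord -(mulr_natl _ n) le_eqVlt.
  by apply/orP; left; apply/eqP; ring.
apply: ler_sum => i _.
have -> : x' ord0 i * x' ord0 i - x ord0 i * x ord0 i =
  (x' ord0 i - x ord0 i) * ((x' ord0 i - x ord0 i) + 2 * x ord0 i) by ring.
rewrite normrM ler_pM//.
apply: le_trans (ler_normD _ _) _; rewrite normrM (ger0_norm (ler0n _ 2)).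
by have := xx' i; have := sqnorm_lt_coord i xr; lra.
Qed.

Section drift_modulus.
Context {R : realType} {n : nat}.
Variables (b : 'rV[R]_n -> 'rV[R]_n) (M : R) (p q : R -> R).
Hypothesis bM : forall x i, `|b x ord0 i| <= M.
Hypotheses (cp : continuous p) (cq : continuous q).
Hypothesis pq : forall x, p (sqnorm x) * (2 * dotv x (b x)) <= q (sqnorm x).

(** The drift b is merely measurable, so b x' cannot be compared with b x. But
    the inequality pq holds at x' as well, and replacing x' by x in every other
    place costs little, since p, q and the scalar product are continuous. *)
Lemma drift_modulus (r e : R) : 0 < r -> 0 < e -> exists2 del, 0 < del &
  forall x x' : 'rV[R]_n, sqnorm x <= r -> (forall i, `|x' ord0 i - x ord0 i| <= del) ->
    p (sqnorm x) * (2 * dotv x (b x')) <= q (sqnorm x) + e.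
Proof.
move=> r0 e0.
have nn0 : 0 <= n%:R :> R by [].
pose L := n%:R * (2 * (1 + r) + 1).
have L0 : 0 <= L by rewrite mulr_ge0//; lra.
have [Pb Pb0 HP] := bounded_segment 0 (r + L) cp.
pose A := 2 * n%:R * `|M| + 1.
have A0 : 0 < A by rewrite ltr_wpDl// !mulr_ge0.
pose e2 := e / 2.
have e20 : 0 < e2 by rewrite divr_gt0.
pose e1 := e2 / (A * (Pb + (1 + r))).
have den0 : 0 < Pb + (1 + r) by lra.
have e10 : 0 < e1 by rewrite divr_gt0// mulr_gt0.
have [dq dq0 Hq] := uniformly_continuous_segment 0 (r + L) cq e20.
have [d1 d10 H1] := uniformly_continuous_segment 0 (r + L) cp e10.
pose del := Num.min (Num.min 1 e1) (Num.min (dq / (2 * (L + 1))) (d1 / (2 * (L + 1)))).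
have L1 : 0 < 2 * (L + 1) by lra.
have del0 : 0 < del by rewrite !lt_min ltr01 e10 !divr_gt0.
exists del => // x x' xr xx'.
have del1 : del <= 1 by rewrite /del !ge_min lexx.
have dele : del <= e1 by rewrite /del !ge_min lexx orbT.
have delq : del * (L + 1) < dq.
  have : del <= dq / (2 * (L + 1)) by rewrite /del !ge_min lexx !orbT.
  by rewrite ler_pdivlMr//; lra.
have deld : del * (L + 1) < d1.
  have : del <= d1 / (2 * (L + 1)) by rewrite /del !ge_min lexx !orbT.
  by rewrite ler_pdivlMr//; lra.
set y := sqnorm x in xr *; set y' := sqnorm x'.
have y0 : 0 <= y := sqnorm_ge0 x.
have y'0 : 0 <= y' := sqnorm_ge0 x'.
have xb i : `|x ord0 i| <= 1 + r by exact: sqnorm_lt_coord.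
have yy' : `|y' - y| <= del * L.
  by apply: sqnorm_perturb => //; rewrite (ltW del0).
have yr : 0 <= y <= r + L by rewrite y0 (le_trans xr)// lerDl.
have y'r : 0 <= y' <= r + L.
  rewrite y'0 /=; move: yy'; rewrite ler_norml => /andP[_ h].
  have : del * L <= L by rewrite ler_piMl.
  by lra.
have py : `|p y - p y'| < e1.
  apply: H1 => //; rewrite distrC; apply: le_lt_trans yy' _.
  by apply: le_lt_trans deld; rewrite ler_wpM2l ?(ltW del0)// lerDl.
have qy : `|q y' - q y| < e2.
  apply: Hq => //; apply: le_lt_trans yy' _.
  by apply: le_lt_trans delq; rewrite ler_wpM2l ?(ltW del0)// lerDl.
have main : p y * (2 * dotv x (b x')) - p y' * (2 * dotv x' (b x')) <= e2.
  have -> : p y * (2 * dotv x (b x')) - p y' * (2 * dotv x' (b x')) =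
     \sum_i 2 * ((p y * x ord0 i - p y' * x' ord0 i) * b x' ord0 i).
    by rewrite /dotv !mulr_sumr -sumrB; apply: eq_bigr => i _; ring.
  apply: le_trans (_ : \sum_(i < n) 2 * (e1 * (Pb + (1 + r)) * `|M|) <= _).
    apply: ler_sum => i _; rewrite ler_pM2l//.
    apply: le_trans (ler_norm _) _; rewrite normrM ler_pM//; last first.
      by rewrite (le_trans (bM _ _))// ler_norm.
    have -> : p y * x ord0 i - p y' * x' ord0 i =
      (p y - p y') * x ord0 i + p y' * (x ord0 i - x' ord0 i) by ring.
    apply: le_trans (ler_normD _ _) _; rewrite !normrM mulrDr addrC.
    apply: lerD; last by rewrite ler_pM// ltW.
    by rewrite mulrC ler_pM// ?HP// distrC (le_trans (xx' i)).
  rewrite sumr_const card_ord -(mulr_natl _ n).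
  have -> : n%:R * (2 * (e1 * (Pb + (1 + r)) * `|M|)) = (2 * n%:R * `|M|) * (e1 * (Pb + (1 + r))) by ring.
  apply: le_trans (_ : A * (e1 * (Pb + (1 + r))) <= _).
    apply: ler_wpM2r; first exact: (mulr_ge0 (ltW e10) (ltW den0)).
    by rewrite /A lerDl.
  by rewrite /e1 le_eqVlt; apply/orP; left; apply/eqP; field; rewrite !gt_eqF.
have := pq x'; rewrite -/y' => hq.
move: qy; rewrite ltr_norml => /andP[_ hq2].
by rewrite /e2 in hq2 main; lra.
Qed.

End drift_modulus.

(** * Occupation times on a grid and soft hitting times *)

Section soft_hitting.
Context {R : realType} {n : nat}.
Implicit Types x : R -> 'rV[R]_n.

(** The cost of stopping at time t below the level r': the waiting time plus a
    penalty, which reaches T as soon as the squared norm is at most r. *)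
Definition soft_cost (T r r' : R) x (t : R) : R :=
  Num.min T (t + T / (r' - r) * Num.max 0 (r' - sqnorm (x t))).

(** The minimal cost is a substitute for the hitting time of r' that depends
    continuously on the path in the uniform norm, which the hitting time does
    not. It is at most the hitting time of r'. *)
Definition soft_hit (T r r' : R) x : R := inf [set soft_cost T r r' x t | t in `[0, T]].

Variables (T r r' : R).
Hypotheses (T0 : 0 < T) (rr' : r < r').

Let K := T / (r' - r).
Let K0 : 0 < K. Proof. by rewrite divr_gt0// subr_gt0. Qed.

Lemma soft_cost_ge0 x t : 0 <= t -> 0 <= soft_cost T r r' x t.
Proof.
move=> t0; rewrite /soft_cost le_min ltW//= addr_ge0// mulr_ge0 ?(ltW K0)//.
by rewrite le_max lexx.
Qed.

Let soft_set x := [set soft_cost T r r' x t | t in `[0, T]].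

Let soft_set_inf x : has_inf (soft_set x).
Proof.
split; first by exists (soft_cost T r r' x 0); exists 0 => //=; rewrite in_itv /= lexx ltW.
by exists 0 => v [t]; rewrite /= in_itv /= => /andP[t0 _] <-; exact: soft_cost_ge0.
Qed.

Lemma soft_hit_le x t : 0 <= t <= T -> soft_hit T r r' x <= soft_cost T r r' x t.
Proof.
move=> tT; apply: ge_inf; first by case: (soft_set_inf x).
by exists t => //=; rewrite in_itv.
Qed.

Lemma soft_hit_ge x v : (forall t, 0 <= t <= T -> v <= soft_cost T r r' x t) ->
  v <= soft_hit T r r' x.
Proof.
move=> H; apply: lb_le_inf; first by case: (soft_set_inf x).
by move=> u [t]; rewrite /= in_itv /= => tT <-; exact: H.
Qed.

Lemma soft_hit_ge0 x : 0 <= soft_hit T r r' x.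
Proof. by apply: soft_hit_ge => t /andP[t0 _]; exact: soft_cost_ge0. Qed.

Lemma soft_hit_leT x : soft_hit T r r' x <= T.
Proof.
apply: le_trans (@soft_hit_le x 0 _) _; first by rewrite lexx ltW.
by rewrite /soft_cost ge_min lexx.
Qed.

Lemma soft_hit_le_hitting x : ((soft_hit T r r' x)%:E <=
  hitting_time (fun t => sqnorm (x t)) r')%E.
Proof.
apply: le_ereal_inf_tmp => _ [t [t0 xt] <-]; rewrite lee_fin.
have [tT|Tt] := leP t T.
  apply: le_trans (@soft_hit_le x t _) _; first by rewrite t0.
  by rewrite /soft_cost xt subrr maxxx mulr0 addr0 ge_min lexx orbT.
by rewrite (le_trans (soft_hit_leT x))// ltW.
Qed.

End soft_hitting.

Section grid.
Context {R : realType} {n : nat}.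
Variables (x : R -> 'rV[R]_n) (T r h : R) (N : nat).
Hypotheses (h0 : 0 < h) (NhT : N%:R * h = T).

Lemma alive_antitone k m : (k <= m)%N -> alive x h r m -> alive x h r k.
Proof.
elim: m => [|m IH]; first by rewrite leqn0 => /eqP ->.
rewrite leq_eqVlt => /predU1P[-> //|]; rewrite ltnS => /IH H /= /andP[/H].
by [].
Qed.

(** The number of grid times before the exit is either all of them or the index of
    the first grid time outside the ball. *)
Lemma alive_dichotomy m :
  (\sum_(j < m) (alive x h r j)%:R = m%:R :> R) \/
  exists k, [/\ (k < m)%N, r <= sqnorm (x (k%:R * h)) &
     \sum_(j < m) (alive x h r j)%:R = k%:R :> R].
Proof.
suff : (\sum_(j < m) (alive x h r j)%:R = m%:R :> R /\ (forall j, (j < m)%N -> alive x h r j)) \/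
  exists k, [/\ (k < m)%N, r <= sqnorm (x (k%:R * h)), ~~ alive x h r k &
     \sum_(j < m) (alive x h r j)%:R = k%:R :> R].
  by case=> [[H _]|[k [k1 k2 _ k3]]]; [left|right; exists k].
elim: m => [|m [[IH1 IH2]|[k [km kr ka kS]]]].
- by left; rewrite big_ord0; split.
- case A : (alive x h r m).
    left; rewrite big_ord_recr /= IH1 A natr1; split => // j.
    by rewrite ltnS leq_eqVlt => /predU1P[->//|/IH2].
  right; exists m; split => //; last by rewrite big_ord_recr /= IH1 A addr0.
    rewrite leNgt; apply/negP => xr; move/negP: A; apply.
    case: m IH1 IH2 xr => [|m] _ IH2 /= xr; first by move: xr; rewrite mul0r.
    by rewrite IH2.
  by rewrite A.
- right; exists k; split => //; first exact: ltnW.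
  rewrite big_ord_recr /= kS (_ : alive x h r m = false) ?addr0//.
  by apply/negbTE; apply: contra ka; exact: alive_antitone (ltnW km).
Qed.

Lemma sum_alive_le m k : ~~ alive x h r k -> \sum_(j < m) (alive x h r j)%:R <= k%:R :> R.
Proof.
move=> ak; elim: m => [|m IH]; first by rewrite big_ord0.
rewrite big_ord_recr /=; have [km|mk] := leqP k m.
  rewrite (_ : alive x h r m = false) ?addr0//.
  by apply/negbTE; apply: contra ak; exact: alive_antitone.
apply: (@le_trans _ _ (m.+1%:R : R)); last by rewrite ler_nat.
rewrite -natr1 lerD//; last by case: alive; rewrite ?ler01 ?lexx.
rewrite -[in leRHS](card_ord m) -sumr_const.
by apply: ler_sum => i _; case: alive; rewrite ?ler01 ?lexx.
Qed.

Let occ : R := h * \sum_(k < N) (alive x h r k)%:R.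

Lemma occupation_leT : occ <= T.
Proof.
rewrite /occ -NhT mulrC ler_wpM2r ?(ltW h0)//.
rewrite -[in leRHS](card_ord N) -sumr_const.
by apply: ler_sum => i _; case: alive; rewrite ?ler01 ?lexx.
Qed.

(** Stopping at the first grid time outside the ball costs no penalty. *)
Lemma soft_hit_le_occupation rm : 0 < T -> rm < r -> soft_hit T rm r x <= occ.
Proof.
move=> T0 rr'; have [H|[k [kN kr kS]]] := alive_dichotomy N.
  by rewrite /occ H mulrC NhT soft_hit_leT.
rewrite /occ kS mulrC.
have kh : 0 <= k%:R * h <= T.
  by rewrite mulr_ge0 ?(ltW h0)//= -NhT ler_wpM2r ?(ltW h0)// ler_nat ltnW.
apply: le_trans (soft_hit_le T0 rr' x kh) _.
rewrite /soft_cost ge_min; apply/orP; right.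
by rewrite (max_idPl _) ?mulr0 ?addr0// subr_le0.
Qed.

(** At a time t where the squared norm is at most r1 the cost is T already.
    Otherwise, by the bound on the oscillation, the first grid time after t lies
    outside the ball, so the occupation time is at most t + h. *)
Lemma occupation_le_soft_hit r1 r2 : 0 < T -> r1 < r2 ->
  (forall s t, 0 <= s <= T -> 0 <= t <= T -> `|s - t| <= h ->
     sqnorm (x s) < r -> sqnorm (x t) <= r1) ->
  occ <= soft_hit T r1 r2 x + h.
Proof.
move=> T0 r12 osc; rewrite -lerBlDr; apply: soft_hit_ge => // t /andP[t0 tT].
rewrite lerBlDr.
have [yr|ry] := leP (sqnorm (x t)) r1.
  rewrite /soft_cost (min_idPl _).
    by rewrite (le_trans occupation_leT)// lerDl ltW.
  apply: le_trans (_ : T / (r2 - r1) * (r2 - r1) <= _).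
    by rewrite divfK// gt_eqF// subr_gt0.
  rewrite -[leLHS]add0r lerD// ler_wpM2l ?divr_ge0 ?(ltW T0) ?subr_ge0 ?(ltW r12)//.
  by rewrite le_max; apply/orP; right; rewrite lerB.
rewrite /soft_cost; have [_|_] := leP T _.
  by rewrite (le_trans occupation_leT)// lerDl ltW.
apply: le_trans (_ : t + h <= _); last first.
  have K_ge0 : 0 <= T / (r2 - r1).
    by apply: divr_ge0; [exact: ltW|rewrite subr_ge0; exact: ltW].
  by rewrite lerD2r lerDl; apply: mulr_ge0 => //; rewrite le_max lexx.
(* k + 1 is the index of the first grid time after t. *)
pose k := Num.truncn (t / h).
have := truncn_itv (divr_ge0 t0 (ltW h0)); rewrite -/k => /andP[k1 k2].
rewrite ler_pdivlMr// in k1; rewrite ltr_pdivrMr// in k2.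
have [kN|kN] := ltnP k N; last first.
  have tE : t = T.
    by apply/eqP; rewrite eq_le tT -NhT (le_trans _ k1)// ler_wpM2r ?(ltW h0)// ler_nat.
  by rewrite tE (le_trans occupation_leT)// lerDl ltW.
have k1T : 0 <= k.+1%:R * h <= T.
  by rewrite mulr_ge0 ?(ltW h0)//= -NhT ler_wpM2r ?(ltW h0)// ler_nat.
have dead : ~~ alive x h r k.+1.
  apply/negP => /alive_lt A; have := osc (k.+1%:R * h) t k1T.
  rewrite t0 tT => /(_ isT) H; have := ry; rewrite ltNge H//.
  rewrite ger0_norm; last by rewrite subr_ge0 ltW.
  by move: k1; rewrite -natr1 mulrDl mul1r; lra.
apply: le_trans (_ : h * k.+1%:R <= _); last first.
  by move: k1; rewrite -natr1 mulrDr mulr1 mulrC lerD2r.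
rewrite /occ ler_wpM2l ?(ltW h0)//.
exact: sum_alive_le.
Qed.

End grid.

Section occupation_time.
Context {R : realType} {n : nat} {S : Type}.
Variable Z : R -> S -> 'rV[R]_n.

Definition alive_ind (h r : R) (k : nat) (w : S) : R := (alive (Z ^~ w) h r k)%:R.

(** The time spent before the exit from the ball of squared radius r, as seen on
    the grid of step h. *)
Definition occupation (h r : R) (N : nat) (w : S) : R := h * \sum_(k < N) alive_ind h r k w.

Lemma alive_ind01 h r k w : 0 <= alive_ind h r k w <= 1.
Proof. by rewrite /alive_ind; case: alive; rewrite ?lexx ?ler01. Qed.

Lemma occupation_ge0 h r N w : 0 <= h -> 0 <= occupation h r N w.
Proof. by move=> h0; rewrite mulr_ge0// sumr_ge0. Qed.

Lemma occupation_ge h r N w : 0 <= h -> N%:R * h * alive_ind h r N w <= occupation h r N w.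
Proof.
move=> h0; rewrite /occupation mulrAC mulrC ler_wpM2l//.
rewrite mulr_natl -[in leLHS](card_ord N) -sumr_const; apply: ler_sum => i _.
rewrite card_ord /alive_ind; case A : (alive _ h r N); last by rewrite ler0n.
by rewrite (alive_antitone (ltnW (ltn_ord i)) A).
Qed.

End occupation_time.

Section measurable_occupation.
Context {R : realType} {n : nat} {d : measure_display} {S : measurableType d}
  (P : probability S R) (Z : R -> S -> 'rV[R]_n).
Hypothesis mZ : forall t i, 0 <= t -> measurable_fun setT (fun w => Z t w ord0 i).

Lemma alive_ind_measurable h r k : 0 <= h -> measurable_fun setT (alive_ind Z h r k).
Proof.
move=> h0.
have my j : measurable_fun setT (fun w => (sqnorm (Z (j%:R * h) w) < r)%R%:R : R).
  have ms : measurable_fun setT (fun w => sqnorm (Z (j%:R * h) w)).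
    apply: measurable_sum => i; apply: measurable_funM; apply: mZ; exact: mulr_ge0.
  have m1 : measurable_fun [set: R] (\1_[set` `]-oo, r[%R] : R -> R) by exact: measurable_indic.
  have := measurableT_comp m1 ms; apply: eq_measurable_fun => w _ /=.
  by rewrite indicE /= mem_setE in_itv.
elim: k => [|k IH].
  by have := my 0; rewrite mul0r.
have := measurable_funM IH (my k.+1); apply: eq_measurable_fun => w _.
by rewrite /alive_ind /= -natrM mulnb.
Qed.

Lemma occupation_measurable h r N : 0 <= h -> measurable_fun setT (occupation Z h r N).
Proof.
move=> h0; apply: measurable_funM; first exact: measurable_cst.
by apply: measurable_sum => i; exact: alive_ind_measurable.
Qed.

Lemma alive_ind_integrable h r k : 0 <= h -> P.-integrable setT (EFin \o alive_ind Z h r k).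
Proof.
move=> h0; apply: (@bounded_integrable _ _ _ P _ 1) => [|w]; first exact: alive_ind_measurable.
by have /andP[i0 i1] := alive_ind01 Z h r k w; rewrite ger0_norm.
Qed.

Lemma occupation_integrable h r N : 0 <= h -> P.-integrable setT (EFin \o occupation Z h r N).
Proof.
move=> h0; apply: real_integrableZ => //; apply: real_integrable_sum => // i.
exact: alive_ind_integrable.
Qed.

End measurable_occupation.

(** * A Dynkin inequality on a grid *)

Section dynkin.
Context {R : realType} {n : nat} {d : measure_display} {S : measurableType d}
  (P : probability S R) (F : R -> set (set S)) (W : R -> S -> 'rV[R]_n).
Hypothesis usualF : usual_conditions P F.
Hypothesis brownianW : brownian_motion P F W.
Variables (c c4 : R).
Hypothesis c4_ge0 : 0 <= c4.
Hypothesis c_ge0 : 0 <= c.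
Hypothesis normal_c : forall s : R, 0 < s ->
  [/\ (\int[normal_prob 0 s]_x (x ^+ 2)%:E = (c * s ^+ 2)%:E)%E,
      (\int[normal_prob 0 s]_x (x ^+ 4)%:E = (c4 * s ^+ 4)%:E)%E &
      (\int[normal_prob 0 s]_x (Num.max x 0)%:E = \int[normal_prob 0 s]_x (Num.max (- x) 0)%:E)%E].
Variables (b : 'rV[R]_n -> 'rV[R]_n) (M : R).
Hypothesis mb : borel_fun b.
Hypothesis bM : forall x i, `|b x ord0 i| <= M.
Variables (eps : R) (X : R -> S -> 'rV[R]_n).
Hypothesis eps0 : 0 < eps.
Hypothesis solX : strong_solution P F W b eps X.

Lemma alive_ind_adapted h r k : 0 <= h -> measurable_wrt (F (k%:R * h)) (alive_ind X h r k).
Proof.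
move=> h0; have aX := solution_adapted solX.
have my j : measurable_wrt (F (j%:R * h)) (fun w => (sqnorm (X (j%:R * h) w) < r)%R%:R : R).
  apply: measurable_wrt_lt; apply: (adapted_measurable_wrt aX (@sqnorm_continuous R n)).
  by rewrite mulr_ge0.
elim: k => [|k IH].
  have := my 0; rewrite mul0r; apply: eq_measurable_fun => w _.
  by rewrite /alive_ind /=.
have mk : measurable_wrt (F (k.+1%:R * h)) (alive_ind X h r k).
  apply: measurable_wrtI => B mB.
  apply: (filtration_le usualF (_ : 0 <= k%:R * h)).
  - by rewrite mulr_ge0.
  - by rewrite ler_wpM2r// ler_nat.
  apply: measurable_wrt_preimage mB => //.
  by apply: (filtration_sigma_algebra usualF); rewrite mulr_ge0.
have := measurable_wrtM mk (my k.+1); apply: eq_measurable_fun => w _.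
by rewrite /alive_ind /= -natrM mulnb.
Qed.

(** The form in which [continuity_event] records the properties of a path. *)
Lemma good_solution : {ae P, forall w, continuous_path (X ^~ w) /\
  (continuous_path (X ^~ w) /\ forall t, 0 <= t -> forall i, X t w ord0 i =
    \int[@lebesgue_measure R]_(u in `[0%R, t]) b (X u w) ord0 i + eps * W t w ord0 i)}.
Proof.
have h1 := solution_continuous solX; have h2 := solution_eq solX.
by apply: filterS2 h1 h2 => w cw ew; split => //; split.
Qed.

Lemma solution_start : {ae P, forall w, X 0 w = 0}.
Proof.
have h1 := solution_eq solX; have h2 := brownian_start brownianW.
apply: filterS2 h1 h2 => w ew W0; apply/rowP => i.
rewrite ew// W0 !mxE mulr0 addr0 set_itv1.
by rewrite Rintegral_set1.
Qed.

Lemma solution_coord_measurable t i : 0 <= t -> measurable_fun setT (fun w => X t w ord0 i).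
Proof.
move=> t0; apply: (measurable_wrt_measurable usualF t0).
apply: (@adapted_measurable_wrt _ _ _ _ F X (fun x => x ord0 i)) => //.
- exact: solution_adapted solX.
- exact: coord_continuous.
Qed.

Variables (U p dp q : R -> R) (r c0 T : R).
Hypothesis HU : C2_bounded U p dp.
Hypothesis cq : continuous q.
Hypothesis r0 : 0 < r.
Hypothesis T0 : 0 < T.
Hypothesis pq : forall x, p (sqnorm x) * (2 * dotv x (b x)) <= q (sqnorm x).
Hypothesis gen : forall y, 0 <= y <= r ->
  q y + c * eps ^+ 2 * (n%:R * p y + 2 * y * dp y) <= c0.

Let Y t w := sqnorm (X t w).

(** Over one time step, the mean of U (|X|^2) on the event of being still alive
    grows by c0 h times the probability of that event, up to a small multiple of
    h that does not depend on the step. On the event E where the path oscillates little,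
    [drift_modulus] gives the drift part of the generator; off E the crude bound
    C1 h is enough, since E has probability close to 1. The increment of W is
    then averaged by [quadratic_expectation], and the hypothesis on the generator
    bounds the sum of the drift and second-order parts. *)
Lemma one_step_expectation (eta : R) : 0 < eta -> exists2 h0, 0 < h0 &
  forall (h : R) (k : nat), 0 < h <= h0 -> k.+1%:R * h <= T ->
   P.-integrable setT (EFin \o (fun w => alive_ind X h r k w * U (Y (k.+1%:R * h) w))) ->
   P.-integrable setT (EFin \o (fun w => alive_ind X h r k w * U (Y (k%:R * h) w))) ->
    \int[P]_w (alive_ind X h r k w * U (Y (k.+1%:R * h) w)) <=
    \int[P]_w (alive_ind X h r k w * U (Y (k%:R * h) w))
    + c0 * h * \int[P]_w alive_ind X h r k w + h * eta.
Proof.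
move=> eta0; have eps_ge0 : 0 <= eps := ltW eps0.
case: (HU) => dU dP cdp [B HB].
have cp := is_derive_continuous dP.
have cU := is_derive_continuous dU.
have [Pb Pb0 HP] := bounded_segment 0 r cp.
have [Db Db0 HD] := bounded_segment 0 r cdp.
have [Qb Qb0 HQ] := bounded_segment 0 r cq.
pose e := eta / 8; have e0 : 0 < e by rewrite divr_gt0.
pose D1 := 1 + eps ^+ 2 * c * n%:R.
have D10 : 0 < D1 by rewrite ltr_wpDr// !mulr_ge0// ?sqr_ge0.
pose e1 := e / D1; have e10 : 0 < e1 by rewrite divr_gt0.
have M0' : 0 <= `|M| by [].
have [K [h1 [K0 h10 Hstep]]] := @one_step_bound R n U p dp HU r `|M| e1 r0 M0' e10.
have [del del0 Hdel] := drift_modulus bM cp cq pq r0 e0.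
pose C1 := Qb + Pb * (2 * (n%:R * ((1 + r) * `|M|))).
have C10 : 0 < C1.
  have r1 : 0 <= 1 + r by rewrite addr_ge0// ltW.
  by rewrite ltr_wpDr//; apply: mulr_ge0; [exact: ltW|rewrite !mulr_ge0].
pose eta1 := e / C1; have eta10 : 0 < eta1 by rewrite divr_gt0.
have [h2 [E [h20 mE PE HE]]] := continuity_event solution_coord_measurable good_solution T0 del0 eta10.
pose K4 := K * eps ^+ 4 * n%:R.
have K40 : 0 <= K4.
  by apply: mulr_ge0 => //; apply: mulr_ge0; [exact: ltW|exact: exprn_even_ge0].
pose D4 := K4 * (n%:R * c4) + 1.
have D40 : 0 < D4.
  by rewrite ltr_wpDl//; apply: mulr_ge0 => //; exact: mulr_ge0.
pose h3 := e / D4.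
exists (Num.min h1 (Num.min h2 h3)); first by rewrite !lt_min h10 h20 divr_gt0.
move=> h k /andP[h_gt0]; rewrite !le_min => /and3P[hh1 hh2 hh3] kT iL iR.
set s := k%:R * h; set t := k.+1%:R * h.
have s0 : 0 <= s by rewrite mulr_ge0// ltW.
have ts : t - s = h by rewrite /t /s -natr1 mulrDl mul1r addrAC subrr add0r.
have st : s < t by rewrite -subr_gt0 ts.
pose I := alive_ind X h r k.
have I01 w : 0 <= I w <= 1 := alive_ind01 X h r k w.
have Ir w : I w != 0 -> sqnorm (X s w) <= r.
  by rewrite /I /alive_ind; case A: alive; rewrite ?eqxx// => _; rewrite ltW// (alive_lt A).
have mI : measurable_wrt (F s) I by apply: alive_ind_adapted; exact: ltW.
have aX := solution_adapted solX.
have mphi (phi : R -> R) : continuous phi -> measurable_wrt (F s) (fun w => phi (Y s w)).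
  move=> cphi; apply: (adapted_measurable_wrt aX (_ : continuous (fun x => phi (sqnorm x)))) => //.
  by move=> x; apply: (continuous_comp (@sqnorm_continuous R n x)); exact: cphi.
have mx i : measurable_wrt (F s) (fun w => X s w ord0 i).
  apply: (adapted_measurable_wrt aX (_ : continuous (fun x : 'rV[R]_n => x ord0 i))) => //.
  exact: coord_continuous.
pose z w := I w * (U (Y s w) + h * (q (Y s w) + (e + e1))).
pose a (i : 'I_n) w := I w * (2 * eps * p (Y s w) * X s w ord0 i).
pose bb (i j : 'I_n) w := I w * (2 * eps ^+ 2 * dp (Y s w) * (X s w ord0 i * X s w ord0 j)
   + (i == j)%:R * eps ^+ 2 * (p (Y s w) + e1)).
have mz : measurable_wrt (F s) z.
  apply: measurable_wrtM => //; apply: measurable_wrtD; first exact: mphi.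
  apply: measurable_wrtM; first exact: measurable_wrt_cst.
  by apply: measurable_wrtD; [exact: mphi|exact: measurable_wrt_cst].
have ma i : measurable_wrt (F s) (a i).
  apply: measurable_wrtM => //; apply: measurable_wrtM => //.
  by apply: measurable_wrtM; [exact: measurable_wrt_cst|exact: mphi].
have mbb i j : measurable_wrt (F s) (bb i j).
  apply: measurable_wrtM => //; apply: measurable_wrtD.
    apply: measurable_wrtM; last exact: measurable_wrtM.
    by apply: measurable_wrtM; [exact: measurable_wrt_cst|exact: mphi].
  apply: measurable_wrtM; first exact: measurable_wrt_cst.
  by apply: measurable_wrtD; [exact: mphi|exact: measurable_wrt_cst].
have Ybd w : I w != 0 -> 0 <= Y s w <= r by move=> /Ir h4; rewrite sqnorm_ge0.
have Ibd w (v L : R) : (I w != 0 -> `|v| <= L) -> 0 <= L -> `|I w * v| <= L.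
  move=> vL L0; have [->|Iw] := eqVneq (I w) 0; first by rewrite mul0r normr0.
  have /andP[i0 i1] := I01 w.
  by rewrite normrM (ger0_norm i0) (le_trans (ler_wpM2l i0 (vL Iw)))// ler_piMl.
pose Lz := B + h * (Qb + (e + e1)).
pose La := 2 * eps * Pb * (1 + r).
pose Lb := 2 * eps ^+ 2 * Db * ((1 + r) * (1 + r)) + eps ^+ 2 * (Pb + e1).
have B0 : 0 <= B by rewrite (le_trans _ (HB 0 (lexx 0))).
have r10 : 0 < 1 + r by rewrite ltr_wpDl.
have [Pb_ge0 Db_ge0 Qb_ge0] := And3 (ltW Pb0) (ltW Db0) (ltW Qb0).
have [e_ge0 e1_ge0 h_ge0] := And3 (ltW e0) (ltW e10) (ltW h_gt0).
have r1_ge0 := ltW r10.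
have Lz0 : 0 <= Lz by apply: addr_ge0 => //; apply: mulr_ge0 => //; rewrite !addr_ge0.
have La0 : 0 <= La by rewrite !mulr_ge0.
have Lb0 : 0 <= Lb.
  by apply: addr_ge0; rewrite !mulr_ge0// ?sqr_ge0// addr_ge0.
pose Lm := Lz + La + Lb.
have Lm0 : 0 <= Lm by apply: addr_ge0 => //; exact: addr_ge0.
have zL w : `|z w| <= Lm.
  apply: Ibd => //.
  move=> /Ybd yr; apply: le_trans (_ : Lz <= _); last by rewrite /Lm -addrA lerDl addr_ge0.
  apply: le_trans (ler_normD _ _) _; apply: lerD; first by apply: HB; case/andP: yr.
  rewrite normrM (gtr0_norm h_gt0) ler_pM2l//.
  apply: le_trans (ler_normD _ _) _; apply: lerD; first exact: HQ.
  by rewrite ger0_norm// addr_ge0.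
have aL i w : `|a i w| <= Lm.
  apply: Ibd => //.
  move=> /[dup] /Ir xr /Ybd yr; apply: le_trans (_ : La <= _); last by rewrite /Lm; lra.
  rewrite !normrM (ger0_norm (ler0n _ 2)) (gtr0_norm eps0).
  apply: ler_pM => //; [by rewrite !mulr_ge0| |exact: sqnorm_lt_coord].
  by rewrite ler_pM2l ?mulr_gt0// HP.
have bL i j w : `|bb i j w| <= Lm.
  apply: Ibd => //.
  move=> /[dup] /Ir xr /Ybd yr; apply: le_trans (_ : Lb <= _); last by rewrite /Lm; lra.
  apply: le_trans (ler_normD _ _) _; apply: lerD.
    have e2 : 0 <= 2 * eps ^+ 2 by rewrite mulr_ge0// sqr_ge0.
    rewrite normrM [`|_ * dp _|]normrM (ger0_norm e2) [`|X s w ord0 i * _|]normrM.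
    apply: ler_pM; [exact: mulr_ge0|exact: mulr_ge0| |].
      by rewrite ler_wpM2l// HD.
    by apply: ler_pM => //; exact: sqnorm_lt_coord.
  rewrite normrM [`|_%:R * _|]normrM (ger0_norm (sqr_ge0 eps)).
  apply: le_trans (_ : 1 * eps ^+ 2 * (Pb + e1) <= _); last by rewrite mul1r.
  apply: ler_pM => //; first by apply: mulr_ge0 => //; exact: sqr_ge0.
    by rewrite ler_wpM2r ?sqr_ge0//; case: (i == j); rewrite ?normr1 ?normr0.
  apply: le_trans (ler_normD _ _) _; apply: lerD; first exact: HP.
  by rewrite gtr0_norm.
have [iq Eq] := @quadratic_expectation _ _ _ _ P F W usualF brownianW c c4 normal_c s t s0 st z a bb K4 Lm
  mz ma mbb zL aL bL.
set f := (fun w => _) in iq Eq.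
pose g w := f w + C1 * h * \1_(~` E) w.
have iE : P.-integrable setT (EFin \o (\1_(~` E) : S -> R)).
  apply: (@bounded_integrable _ _ _ P _ 1).
  - by apply: measurable_indic; exact: measurableC.
  - by move=> w; rewrite indicE; case: (_ \in _); rewrite ?normr1 ?normr0.
have ig : P.-integrable setT (EFin \o g).
  by apply: real_integrableD => //; exact: real_integrableZ.
have point : {ae P, forall w, I w * U (Y t w) <= g w}.
  have gs := good_solution.
  apply: filterS gs => w [_ [cw ew]].
  have ind0 : 0 <= \1_(~` E) w :> R by rewrite indicE.
  have x40 : 0 <= K4 * \sum_i increment W s t i w ^+ 4.
    by rewrite mulr_ge0// sumr_ge0// => i _; rewrite exprn_even_ge0.
  have [Iw0|Iw0] := eqVneq (I w) 0.
    rewrite Iw0 mul0r /g /f /z /a /bb Iw0 mul0r add0r.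
    rewrite big1 ?add0r => [|i _]; last by rewrite !mul0r.
    rewrite big1 ?add0r => [|i _]; last by rewrite big1// => j _; rewrite !mul0r.
    by rewrite addr_ge0// !mulr_ge0 ?(ltW C10)// ltW.
  have Iw1 : I w = 1 by move: Iw0; rewrite /I /alive_ind; case: alive; rewrite ?eqxx.
  have xr := Ir w Iw0; have yr := Ybd w Iw0.
  have [bs1 bs2] := drift_increment mb bM cw ew s0 st.
  set beta := (_ - _ - _) in bs1 bs2.
  pose xi : 'rV[R]_n := W t w - W s w.
  have Xt : X t w = X s w + beta + eps *: xi.
    by rewrite /beta -/xi; rewrite addrA addrC; apply/rowP => i; rewrite !mxE; ring.
  have hk : 0 < h <= h1 by rewrite h_gt0.
  have bs1' i : `|beta ord0 i| <= `|M| * h.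
    by rewrite (le_trans (bs1 i))// ts ler_wpM2r ?ler_norm// ltW.
  have := Hstep h (X s w) beta (eps *: xi) hk xr bs1'.
  rewrite -Xt -/(Y s w) -/(Y t w) dotvZr sqnormZ.
  set y := Y s w in yr *; set u := dotv (X s w) xi; set m := sqnorm xi.
  have drift : p y * (2 * dotv (X s w) beta) <= h * (q y + e) + C1 * h * \1_(~` E) w.
    have [wE|wE] := pselect (E w).
      rewrite indicE memNset; last by rewrite /= => /(_ wE).
      rewrite mulr0 addr0.
      have := bs2 ((2 * p y) *: X s w) (q y + e).
      rewrite dotvZl ts => H; apply: le_trans (_ : (q y + e) * h <= _); last by rewrite mulrC.
      apply: le_trans (H _); first by rewrite le_eqVlt; apply/orP; left; apply/eqP; ring.
      move=> v /andP[sv vt]; rewrite dotvZl.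
      apply: le_trans (Hdel (X s w) (X v w) xr _).
        by rewrite le_eqVlt; apply/orP; left; apply/eqP; rewrite /y /Y; ring.
      move=> i; have [_ osc] := HE w wE; apply: osc.
      - by rewrite (le_trans s0 sv) (le_trans vt kT).
      - by rewrite s0 ltW// (lt_le_trans st kT).
      - rewrite ger0_norm ?subr_ge0// (le_trans _ hh2)// -ts lerD2r.
        by [].
    rewrite indicE mem_set// mulr1.
    have h4 : `|p y * (2 * dotv (X s w) beta)| <= Pb * (2 * (n%:R * ((1 + r) * (`|M| * h)))).
      rewrite normrM ler_pM ?HP// normrM (ger0_norm (ler0n _ 2)) ler_wpM2l//.
      apply: le_trans (ler_norm_sum _ _ _) _.
      rewrite mulr_natl -[in leRHS](card_ord n) -sumr_const.
      by apply: ler_sum => i _; rewrite normrM ler_pM// sqnorm_lt_coord.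
    have h5 := HQ _ yr; move: h4 h5; rewrite !ler_norml => /andP[_ h4] /andP[h5 _].
    have h6 : - Qb * h <= q y * h by rewrite ler_wpM2r// ltW.
    have h7 : 0 <= h * e by rewrite mulr_ge0 ?ltW.
    by rewrite /C1; lra.
  have suma : \sum_i a i w * increment W s t i w = 2 * eps * p y * u.
    rewrite /u /dotv mulr_sumr; apply: eq_bigr => i _.
    by rewrite /a Iw1 mul1r -/y /increment -/xi; ring.
  have sumb : \sum_i \sum_j bb i j w * (increment W s t i w * increment W s t j w) =
      2 * eps ^+ 2 * dp y * u ^+ 2 + eps ^+ 2 * (p y + e1) * m.
    have -> : u ^+ 2 = \sum_i \sum_j (X s w ord0 i * xi ord0 i) * (X s w ord0 j * xi ord0 j).
      by rewrite expr2 /u /dotv mulr_suml; apply: eq_bigr => i _; rewrite mulr_sumr.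
    rewrite /m /sqnorm /dotv !mulr_sumr -big_split /=; apply: eq_bigr => i _.
    rewrite (bigD1 i)//= [in RHS](bigD1 i)//= mulrDr addrAC; congr (_ + _).
      by rewrite /bb Iw1 eqxx mulr1n -/y /increment -/xi; ring.
    rewrite mulr_sumr; apply: eq_bigr => j ji.
    by rewrite /bb Iw1 eq_sym (negbTE ji) mulr0n -/y /increment -/xi; ring.
  have m4 : K * (eps ^+ 2 * m) ^+ 2 <= K4 * \sum_i increment W s t i w ^+ 4.
    have -> : K * (eps ^+ 2 * m) ^+ 2 = K * eps ^+ 4 * m ^+ 2 by ring.
    rewrite /K4 -[leRHS]mulrA; apply: ler_wpM2l; last exact: sqr_sqnorm_le.
    by apply: mulr_ge0; [exact: ltW|exact: exprn_even_ge0].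
  move=> step; rewrite Iw1 mul1r /g /f suma sumb /z Iw1 mul1r -/y.
  by lra.
have le1 := ae_le_Rintegral iL ig point.
apply: (le_trans le1).
have -> : \int[P]_w g w = \int[P]_w f w + C1 * h * \int[P]_w \1_(~` E) w.
  rewrite RintegralD//; last exact: real_integrableZ.
  by rewrite RintegralZl.
have PE' : \int[P]_w (\1_(~` E) w : R) <= eta1.
  rewrite /Rintegral integral_indic// ?setIT; last exact: measurableC.
  by rewrite -lee_fin fineK// fin_num_measure//; exact: measurableC.
have ibb i : P.-integrable setT (EFin \o bb i i).
  exact: bounded_integrable (measurable_wrt_measurable usualF s0 (mbb i i)) (bL i i).
have iz : P.-integrable setT (EFin \o z).
  exact: bounded_integrable (measurable_wrt_measurable usualF s0 mz) zL.
have iI : P.-integrable setT (EFin \o I).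
  apply: (@bounded_integrable _ _ _ P _ 1 (measurable_wrt_measurable usualF s0 mI)) => w.
  by have /andP[i0 i1] := I01 w; rewrite ger0_norm.
have isum := real_integrable_sum measurableT (index_enum 'I_n) ibb.
have le2 : \int[P]_w z w + c * (t - s) * \sum_i \int[P]_w bb i i w <=
    \int[P]_w (I w * U (Y s w)) + (c0 * h + h * (2 * e)) * \int[P]_w I w.
  rewrite -(Rintegral_sum measurableT _ ibb) -RintegralZl// -RintegralD//; last exact: real_integrableZ.
  rewrite -RintegralZl// -RintegralD//; last exact: real_integrableZ.
  apply: le_Rintegral => //.
  - by apply: real_integrableD => //; exact: real_integrableZ.
  - by apply: real_integrableD => //; exact: real_integrableZ.
  move=> w _; rewrite ts.
  have sb : \sum_i bb i i w = I w * (2 * eps ^+ 2 * dp (Y s w) * Y s w + n%:R * (eps ^+ 2 * (p (Y s w) + e1))).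
    rewrite /bb -mulr_sumr big_split /= -mulr_sumr; congr (_ * (_ + _)).
    rewrite (eq_bigr (fun=> eps ^+ 2 * (p (Y s w) + e1))); last by move=> i _; rewrite eqxx mul1r.
    by rewrite sumr_const card_ord mulr_natl.
  rewrite sb /z; have [->|Iw] := eqVneq (I w) 0; first by rewrite !mul0r !mulr0 addr0.
  have Iw1 : I w = 1 by move: Iw; rewrite /I /alive_ind; case: alive; rewrite ?eqxx.
  rewrite Iw1 !mul1r mulr1.
  have := gen (Ybd w Iw); set y := Y s w => gy.
  have eE : e1 * D1 = e by rewrite /e1 divfK// gt_eqF.
  have hgy : h * (q y + c * eps ^+ 2 * (n%:R * p y + 2 * y * dp y)) <= h * c0 by rewrite ler_pM2l.
  have heE : h * (e1 * D1) = h * e by rewrite eE.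
  by rewrite /D1 in heE; lra.
have I1 : \int[P]_w I w <= 1.
  apply: le_trans (_ : \int[P]_w (1 : R) <= _).
    apply: le_Rintegral => //; first exact: finite_measure_integrable_cst.
    by move=> w _; case/andP: (I01 w).
  rewrite Rintegral_cst//; have := congr1 fine (probability_setT P) => /= ->.
  by rewrite mulr1.
have K4h : K4 * (n%:R * (c4 * h ^+ 2)) <= h * e.
  apply: le_trans (_ : h * (D4 * h) <= _).
    rewrite /D4 (_ : K4 * (n%:R * (c4 * h ^+ 2)) = h * (K4 * (n%:R * c4) * h)); last by ring.
    by rewrite ler_pM2l// ler_pM2r// lerDl.
  rewrite ler_pM2l// mulrC -ler_pdivlMr//.
have C1h : C1 * h * \int[P]_w (\1_(~` E) w : R) <= h * e.
  apply: le_trans (_ : C1 * h * eta1 <= _); first by rewrite ler_wpM2l// mulr_ge0// ltW.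
  by rewrite /eta1 le_eqVlt; apply/orP; left; apply/eqP; field; rewrite gt_eqF.
have he : h * (2 * e) * \int[P]_w I w <= h * (2 * e).
  by rewrite ler_piMr// !mulr_ge0// ltW.
have he8 : h * e * 8 = h * eta by rewrite /e; field.
have he0 : 0 < h * e by rewrite mulr_gt0.
rewrite Eq ts; rewrite ts in le2.
by lra.
Qed.

Let Y_measurable (phi : R -> R) t : continuous phi -> 0 <= t -> measurable_fun setT (fun w => phi (Y t w)).
Proof.
move=> cphi t0; apply: (measurable_wrt_measurable usualF t0).
apply: (adapted_measurable_wrt (solution_adapted solX) (_ : continuous (fun x => phi (sqnorm x)))) => //.
by move=> x; apply: (continuous_comp (@sqnorm_continuous R n x)); exact: cphi.
Qed.

Lemma alive_U_integrable h k t : 0 <= h -> 0 <= t ->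
  P.-integrable setT (EFin \o (fun w => alive_ind X h r k w * U (Y t w))).
Proof.
move=> h0 t0; case: (HU) => dU _ _ [B HB].
have mf : measurable_fun setT (fun w => alive_ind X h r k w * U (Y t w)).
  apply: measurable_funM; first exact: (alive_ind_measurable solution_coord_measurable).
  by apply: Y_measurable => //; exact: is_derive_continuous dU.
apply: (@bounded_integrable _ _ _ P _ B mf) => w; have /andP[i0 i1] := alive_ind01 X h r k w.
have UB := HB _ (sqnorm_ge0 (X t w)).
have B0 : 0 <= B := le_trans (normr_ge0 _) UB.
by rewrite normrM (ger0_norm i0) (le_trans (ler_wpM2l i0 UB))// ler_piMl.
Qed.

(** Dynkin's formula at the exit time, as an inequality on a grid: the steps are
    summed up, and a path that leaves the ball is dropped from the sum, which is
    allowed since U >= 0 outside the ball. *)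
Lemma dynkin_grid (eta : R) : 0 < eta -> (forall y, r <= y -> 0 <= U y) ->
  exists2 h0, 0 < h0 & forall (N : nat) (h : R), (0 < N)%N -> h = T / N%:R -> h <= h0 ->
  \int[P]_w (alive_ind X h r N w * U (Y T w)) <= U 0 + c0 * \int[P]_w occupation X h r N w + eta.
Proof.
move=> eta0 Upos.
have etaT : 0 < eta / T by rewrite divr_gt0.
have [h0 h00 Hh0] := one_step_expectation etaT.
exists h0 => // N h N0 hE hh0.
have N0' : 0 < N%:R :> R by rewrite ltr0n.
have h_gt0 : 0 < h by rewrite hE divr_gt0.
have h_ge0 := ltW h_gt0.
have NhT : N%:R * h = T by rewrite mulrC hE divfK// gt_eqF.
have kh0 k : 0 <= k%:R * h by rewrite mulr_ge0.
have tele k : (k <= N)%N -> \int[P]_w (alive_ind X h r k w * U (Y (k%:R * h) w)) <=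
    U 0 + c0 * \int[P]_w occupation X h r k w + k%:R * h * (eta / T).
  elim: k => [|k IH] kN.
    rewrite !mul0r addr0.
    have -> : \int[P]_w occupation X h r 0 w = 0.
      rewrite (@eq_Rintegral _ _ _ _ _ (cst 0)) ?Rintegral_cst ?mul0r//.
      by move=> w _; rewrite /occupation big_ord0 mulr0.
    rewrite mulr0 addr0.
    apply: le_trans (_ : \int[P]_w U 0 <= _).
      apply: ae_le_Rintegral; first exact: alive_U_integrable.
        exact: finite_measure_integrable_cst.
      apply: filterS (solution_start) => w X0.
      by rewrite /alive_ind /= /Y X0 sqnorm0 r0 mul1r.
    rewrite Rintegral_cst//; have := congr1 fine (probability_setT P) => /= ->.
    by rewrite mulr1.
  apply: le_trans (_ : \int[P]_w (alive_ind X h r k w * U (Y (k.+1%:R * h) w)) <= _).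
    apply: le_Rintegral => //; [exact: alive_U_integrable|exact: alive_U_integrable|].
    move=> w _; rewrite /alive_ind /=; case: (alive _ _ _ _) => /=; last by rewrite mulr0n !mul0r.
    case: ltP => [_|/Upos Up] /=; first by [].
    by rewrite mulr0n mulr1n mul0r mul1r.
  have hh : 0 < h <= h0 by rewrite h_gt0.
  have kT : k.+1%:R * h <= T by rewrite -NhT ler_wpM2r// ler_nat.
  have := Hh0 h k hh kT (alive_U_integrable _ h_ge0 (kh0 _)) (alive_U_integrable _ h_ge0 (kh0 _)).
  move=> H; apply: (le_trans H); have := IH (ltnW kN).
  have -> : \int[P]_w occupation X h r k.+1 w = \int[P]_w occupation X h r k w + h * \int[P]_w alive_ind X h r k w.
    rewrite -RintegralZl//; last exact: (alive_ind_integrable P solution_coord_measurable).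
    rewrite -RintegralD//; last 2 first.
    - exact: (occupation_integrable P solution_coord_measurable).
    - by apply: real_integrableZ => //; exact: (alive_ind_integrable P solution_coord_measurable).
    by apply: eq_Rintegral => w _; rewrite /occupation big_ord_recr /= mulrDr.
  by rewrite -natr1; lra.
have := tele N (leqnn N); rewrite NhT (_ : T * (eta / T) = eta)//.
by field; rewrite gt_eqF.
Qed.

End dynkin.

(** * Functionals of the path under the weak limit *)

Section hitting.
Context {R : realType} {n : nat}.

(** Before the first grid time outside the ball, a continuous path that starts at
    0 has crossed the level r. *)
Lemma hitting_le_occupation (x : R -> 'rV[R]_n) (T r h : R) (N : nat) :
  0 < h -> N%:R * h = T -> continuous_path x -> x 0 = 0 -> 0 < r ->
  (mine (hitting_time (fun t => sqnorm (x t)) r) T%:E <=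
   (h * \sum_(k < N) (alive x h r k)%:R)%:E)%E.
Proof.
move=> h0 NhT cx x0 r0; have [H|[k [kN kr kS]]] := alive_dichotomy x r h N.
  by rewrite H mulrC NhT ge_min lexx orbT.
rewrite kS mulrC.
have kh0 : 0 <= k%:R * h by rewrite mulr_ge0 ?(ltW h0).
pose f (t : R) := sqnorm (x (Num.max 0 t)).
have cf : continuous f.
  by move=> t; exact: (continuous_comp (@continuous_path_max0 _ _ _ cx t) (@sqnorm_continuous R n _)).
have f0 : f 0 = 0 by rewrite /f maxxx x0 sqnorm0.
have fk : f (k%:R * h) = sqnorm (x (k%:R * h)) by rewrite /f (max_idPr kh0).
have [t tI ft] : exists2 t, t \in `[0, k%:R * h]%R & f t = r.
  apply: IVT => //; first exact: continuous_subspaceT.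
  by rewrite f0 fk ge_min le_max (ltW r0) kr orbT.
move: tI; rewrite in_itv /= => /andP[t0 tk].
rewrite ge_min; apply/orP; left.
apply: (@le_trans _ _ t%:E); last by rewrite lee_fin.
by apply: ge_ereal_inf; exists t%:E; [exists t => //; split|exact: lexx] => //; rewrite -ft /f (max_idPr t0).
Qed.

End hitting.

Section weak_limit.
Context {R : realType} {n : nat}.

Lemma continuous_functional (T : R) (H : {uniform` `[0, T] -> 'rV[R]_n} -> R) :
  (forall f, C_upto n T f -> forall e, 0 < e -> exists2 del, 0 < del &
    forall g : R -> 'rV[R]_n, (forall t, 0 <= t <= T -> forall i, `|g t ord0 i - f t ord0 i| <= del) ->
      `|H g - H f| <= e) ->
  {within C_upto n T, continuous H}.
Proof.
move=> Hlip; apply/subspace_continuousP => f Cf.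
apply/cvgrPdist_le => e e0.
have [del del0 Hd] := Hlip f Cf e e0.
have nf : nbhs (f : {uniform` `[0, T] -> 'rV[R]_n}) [set g | `|H f - H g| <= e].
  apply/uniform_nbhs; exists [set uv : 'rV[R]_n * 'rV[R]_n | ball uv.1 del uv.2]; split.
    exact: (entourage_ball _ (PosNum del0)).
  move=> g fg /=; rewrite distrC; apply: Hd => t tT i.
  have := fg t; rewrite /= in_itv /= => /(_ tT).
  rewrite -ball_normE /= => fgt; rewrite distrC.
  by apply: le_trans (coord_diff_le _ _ _) (ltW fgt).
by rewrite /within /=; apply: filterS nf => g Hg _.
Qed.

Lemma soft_hit_continuous (T r r' : R) : 0 < T -> r < r' ->
  {within C_upto n T, continuous (soft_hit T r r' : {uniform` `[0, T] -> 'rV[R]_n} -> R)}.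
Proof.
move=> T0 rr'; apply: continuous_functional => f Cf e e0.
pose K := T / (r' - r); have K0 : 0 < K by rewrite divr_gt0// subr_gt0.
have [B [B0 fB]] : exists B, 0 <= B /\ forall t, 0 <= t <= T -> sqnorm (f t) <= B.
  have cs : {within `[0, T], continuous (fun t => sqnorm (f t))}.
    by move=> t; exact: (continuous_comp (Cf t) (@sqnorm_continuous R n _)).
  have [c cT cmax] := EVT_max (ltW T0) cs.
  exists (sqnorm (f c)); split; first exact: sqnorm_ge0.
  by move=> t tT; apply: cmax; rewrite in_itv.
pose L := n%:R * (2 * (1 + B) + 1).
have L0 : 0 <= L by rewrite mulr_ge0//; lra.
have den0 : 0 < K * (L + 1) by rewrite mulr_gt0// ltr_wpDl.
exists (Num.min 1 (e / (K * (L + 1)))); first by rewrite lt_min ltr01 divr_gt0.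
move=> g fg.
set del := Num.min _ _ in fg.
have del1 : del <= 1 by rewrite /del ge_min lexx.
have del0 : 0 < del by rewrite /del lt_min ltr01 divr_gt0.
have dele : del * (K * (L + 1)) <= e by rewrite -ler_pdivlMr// /del ge_min lexx orbT.
have KL : K * (del * L) <= e.
  apply: le_trans dele; rewrite mulrCA ler_wpM2l ?(ltW del0)//.
  by rewrite ler_wpM2l ?(ltW K0)// lerDl.
have cost t : 0 <= t <= T -> `|soft_cost T r r' g t - soft_cost T r r' f t| <= e.
  move=> tT; have sq : `|sqnorm (g t) - sqnorm (f t)| <= del * L.
    apply: sqnorm_perturb; [exact: fB|by rewrite (ltW del0)|].
    by move=> i; exact: fg.
  rewrite /soft_cost -/K.
  have m1 (a a' : R) : `|Num.min T a - Num.min T a'| <= `|a - a'|.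
    have [h1|h1] := leP T a; have [h2|h2] := leP T a'; rewrite ?subrr ?normr0//.
    - by rewrite ger0_norm ?ger0_norm; lra.
    - by rewrite ler0_norm ?ler0_norm; lra.
  have m2 (a a' : R) : `|Num.max 0 a - Num.max 0 a'| <= `|a - a'|.
    have [h1|h1] := leP 0 a; have [h2|h2] := leP 0 a'; rewrite ?subrr ?normr0//.
    - by rewrite ger0_norm ?ger0_norm; lra.
    - by rewrite ler0_norm ?ler0_norm; lra.
  apply: (le_trans (m1 _ _)).
  rewrite opprD addrACA subrr add0r -mulrBr normrM (gtr0_norm K0).
  apply: le_trans (ler_wpM2l (ltW K0) (m2 _ _)) _.
  apply: le_trans KL; rewrite ler_wpM2l ?(ltW K0)//.
  by rewrite (_ : r' - sqnorm (g t) - (r' - sqnorm (f t)) = - (sqnorm (g t) - sqnorm (f t))) ?normrN//; ring.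
rewrite ler_norml; apply/andP; split.
  rewrite lerBrDr; apply: (soft_hit_ge T0 rr') => t tT.
  rewrite addrC lerBlDr; apply: le_trans (soft_hit_le T0 rr' f tT) _.
  by have := cost t tT; rewrite ler_norml => /andP[]; lra.
rewrite lerBlDr -lerBlDl; apply: (soft_hit_ge T0 rr') => t tT.
rewrite lerBlDl; apply: le_trans (soft_hit_le T0 rr' g tT) _.
by have := cost t tT; rewrite ler_norml => /andP[]; lra.
Qed.

Lemma start_continuous (T : R) : 0 < T ->
  {within C_upto n T, continuous ((fun f => Num.min 1 (sqnorm (f 0))) : {uniform` `[0, T] -> 'rV[R]_n} -> R)}.
Proof.
move=> T0; apply: continuous_functional => f Cf e e0.
set B := sqnorm (f 0); have B0 : 0 <= B by exact: sqnorm_ge0.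
pose L := n%:R * (2 * (1 + B) + 1).
have L0 : 0 <= L by rewrite mulr_ge0//; lra.
have L1 : 0 < L + 1 by rewrite ltr_wpDl.
exists (Num.min 1 (e / (L + 1))); first by rewrite lt_min ltr01 divr_gt0.
move=> g fg.
set del := Num.min _ _ in fg.
have del1 : del <= 1 by rewrite /del ge_min lexx.
have del0 : 0 < del by rewrite /del lt_min ltr01 divr_gt0.
have dele : del * (L + 1) <= e by rewrite -ler_pdivlMr// /del ge_min lexx orbT.
have tT : 0 <= (0 : R) <= T by rewrite lexx (ltW T0).
have sq : `|sqnorm (g 0) - sqnorm (f 0)| <= del * L.
  apply: sqnorm_perturb; [exact: lexx|by rewrite (ltW del0)|].
  by move=> i; exact: fg.
have m1 (a a' : R) : `|Num.min 1 a - Num.min 1 a'| <= `|a - a'|.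
  have [h1|h1] := leP 1 a; have [h2|h2] := leP 1 a'; rewrite ?subrr ?normr0//.
  - by rewrite ger0_norm ?ger0_norm; lra.
  - by rewrite ler0_norm ?ler0_norm; lra.
apply: (le_trans (m1 _ _)); apply: (le_trans sq); apply: le_trans dele.
by rewrite ler_wpM2l ?(ltW del0)// lerDl.
Qed.

Context (d : measure_display) (S : measurableType d) (P : probability S R)
  (X : R -> R -> S -> 'rV[R]_n)
  (d0 : measure_display) (S0 : measurableType d0) (P0 : probability S0 R)
  (X0 : R -> S0 -> 'rV[R]_n).
Hypothesis X0_limit : zero_noise_limit P X P0 X0.

Lemma soft_hit_limit (T r r' : R) : 0 < T -> r < r' ->
  ('E_P[fun w => soft_hit T r r' (X eps ^~ w)] @[eps --> 0^'+] -->
   'E_P0[fun w => soft_hit T r r' (X0 ^~ w)])%E.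
Proof.
move=> T0 rr'; apply: (X0_limit (T := T) T0 (H := soft_hit T r r')); last exact: soft_hit_continuous.
exists T; split; first exact: num_real.
move=> M TM f _ /=; rewrite ger0_norm ?soft_hit_ge0//.
by rewrite (le_trans (soft_hit_leT T0 rr' f))// ltW.
Qed.

(** The limit process starts at 0 because its law is the limit of laws that do;
    the continuous functional min 1 |x_0|^2 detects this. *)
Lemma limit_start : (forall t, 0 <= t -> forall B, borel_set B -> measurable (X0 t @^-1` B)) ->
  (forall eps, 0 < eps -> {ae P, forall w, X eps 0 w = 0}) ->
  {ae P0, forall w, X0 0 w = 0}.
Proof.
move=> mX0 Xstart.
have lim : ('E_P[fun w => (Num.min 1 (sqnorm (X eps 0 w)))%R] @[eps --> 0^'+] -->
   'E_P0[fun w => (Num.min 1 (sqnorm (X0 0 w)))%R])%E.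
  apply: (X0_limit (T := 1) ltr01 (H := fun f => Num.min 1 (sqnorm (f 0)))); last exact: start_continuous.
  exists 1; split; first exact: num_real.
  move=> M M1 f _ /=; rewrite ger0_norm ?le_min ?ler01 ?sqnorm_ge0//.
  by rewrite (le_trans _ (ltW M1))// ge_min lexx.
have E0 : ('E_P0[fun w => (Num.min 1 (sqnorm (X0 0 w)))%R] <= 0)%E.
  apply: (cvge_to_le lim); near=> eps.
  have eps0 : 0 < eps by near: eps; exact: nbhs_right_gt.
  have [N [mN PN subN]] := Xstart eps eps0.
  have PN0 : (P N <= 0)%E by rewrite PN.
  rewrite unlock; apply: (@le_trans _ _ (\int[P]_w (\1_N w)%:E)%E).
    apply: ge0_le_integral_nonmeasurable => w _.
      by rewrite lee_fin le_min ler01 sqnorm_ge0.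
    rewrite lee_fin indicE; have [wN|wN] := pselect (N w).
      by rewrite mem_set// ge_min lexx.
    rewrite memNset//= (_ : X eps 0 w = 0) ?sqnorm0 ?ge_min ?lexx ?orbT//.
    by apply: contrapT => H; apply: wN; apply: subN.
  by rewrite integral_indic ?setIT; [exact: PN0|exact: measurableT|exact: mN].
have my : measurable_fun setT (fun w => Num.min 1 (sqnorm (X0 0 w))).
  apply: measurable_minr; first exact: measurable_cst.
  move=> _ B mB; rewrite setTI.
  by apply: (mX0 0 (lexx 0) (@sqnorm R n @^-1` B)); apply: continuous_borel_preimage => //; exact: sqnorm_continuous.
have my' : measurable_fun setT (fun w => (Num.min 1 (sqnorm (X0 0 w)))%R%:E) by exact/measurable_EFinP.
have /(ae_eq_integral_abs P0 measurableT my') ae0 : (\int[P0]_w `|(Num.min 1 (sqnorm (X0 0 w)))%R%:E| = 0)%E.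
  apply/eqP; rewrite eq_le integral_ge0 ?andbT; last by move=> w _; exact: abse_ge0.
  move: E0; rewrite unlock; under [X in _ -> (X <= _)%E]eq_integral do rewrite gee0_abs ?lee_fin ?le_min ?ler01 ?sqnorm_ge0//.
  by [].
apply: filterS ae0 => w /(_ I) [] m0.
have s0 : sqnorm (X0 0 w) <= 0.
  by move: m0; have [h1|h1 ->//] := leP 1 (sqnorm (X0 0 w)) => /eqP; rewrite oner_eq0.
apply/rowP => i; rewrite mxE; apply/eqP; rewrite -sqrf_eq0 eq_le sqr_ge0 andbT.
exact: le_trans (sqr_coord_le _ _) s0.
Unshelve. all: by end_near. Qed.

End weak_limit.

(** * The extremal radial drifts *)

Section drift.
Context {R : realType} {n : nat} (b : 'rV[R]_n -> 'rV[R]_n).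

Lemma drift_coord_bound : [bounded b x | x in [set: 'rV[R]_n]] ->
  exists2 M, 0 <= M & forall x i, `|b x ord0 i| <= M.
Proof.
move=> [M [_ HM]]; exists (`|M| + 1); first by rewrite addr_ge0.
move=> x i; have := HM (`|M| + 1).
rewrite (le_lt_trans (ler_norm M)) ?ltrDl// => /(_ isT x I) /=.
by apply: le_trans; rewrite /Num.norm/= mx_normrE (le_trans _ (le_bigmax _ _ (ord0, i))).
Qed.

Hypothesis b_bounded : [bounded b x | x in [set: 'rV[R]_n]].
Hypothesis b_A3 : condA3 b.

Lemma outward x : 0 <= 2 * dotv (b x) x.
Proof. by rewrite mulr_ge0// (A3_outward b_A3). Qed.

Lemma g_min_le x : g_min b (sqnorm x) <= 2 * dotv (b x) x.
Proof.
apply: ge_inf; last by exists x.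
by exists 0 => _ [z _ <-]; exact: outward.
Qed.

Lemma g_max_ge x : 2 * dotv (b x) x <= g_max b (sqnorm x).
Proof.
have [M M0 bM] := drift_coord_bound b_bounded.
apply: ub_le_sup; last by exists x.
exists (n%:R * M ^+ 2 + sqnorm x) => _ [z zx <-].
have := @dotv_young R n 1 (b z) z ltr01; rewrite invr1 !mul1r zx => H.
apply: le_trans (_ : 2 * `|dotv (b z) z| <= _); first by rewrite ler_wpM2l// ler_norm.
apply: le_trans H _; rewrite lerD2r.
rewrite -[n in n%:R]card_ord mulr_natl -sumr_const; apply: ler_sum => i _.
by rewrite -expr2 -real_normK ?num_real// lerXn2r ?nnegrE.
Qed.

Lemma g_min_ge0 y : 0 <= g_min b y.
Proof.
rewrite /g_min; set A := [set _ | _ in _].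
have [[z Az]|A0] := pselect (A !=set0).
  by apply: lb_le_inf; [exists z|move=> _ [x _ <-]; exact: outward].
suff -> : A = set0 by rewrite inf0.
by apply/seteqP; split => z // Az; apply: A0; exists z.
Qed.

Hypothesis b_A5 : condA5 b.

Lemma C1_derivable (g : R -> R) y : C1_pos g -> 0 < y -> derivable g y 1.
Proof. by move=> [dg _] y0; apply: dg; rewrite in_itv /= y0. Qed.

Lemma C1_continuous (g : R -> R) y : C1_pos g -> 0 < y -> {for y, continuous g}.
Proof.
by move=> Cg y0; apply: differentiable_continuous; apply/derivable1_diffP; exact: C1_derivable.
Qed.

Lemma C1_continuous_derive (g : R -> R) (y : R) : C1_pos g -> 0 < y -> {for y, continuous (derive1 g)}.
Proof. by move=> [_ cdg] y0; apply: cdg; rewrite in_itv /= y0. Qed.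

Lemma g_min_gt0 y : 0 < y -> 0 < g_min b y.
Proof.
move=> y0; apply: (@pos_of_int_inv _ _ y (y + 1)) => //.
- by move=> z _; exact: g_min_ge0.
- by rewrite ltrDl.
- exact: (C1_derivable (A5_g_min_C1 b_A5)).
- by case: (A5_integrals b_A5 (_ : 0 < y + 1)) => //; rewrite addr_gt0.
Qed.

(** On an empty sphere g_min is the infimum of the empty set, which is 0, but
    g_min is positive. This also excludes dimension 0. *)
Lemma sphere_point y : 0 < y -> exists x : 'rV[R]_n, sqnorm x = y.
Proof.
move=> y0; apply: contrapT => H; have := g_min_gt0 y0.
rewrite /g_min (_ : [set _ | _ in _] = set0) ?inf0 ?ltxx//.
by apply/seteqP; split => z // [x /= xy _]; apply: H; exists x.
Qed.

Lemma dim_gt0 : (0 < n)%N.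
Proof.
have [x] := sphere_point ltr01; case: n x => // x.
by rewrite /sqnorm /dotv big_ord0 => /eqP; rewrite eq_sym oner_eq0.
Qed.

Lemma g_max_gt0 y : 0 < y -> 0 < g_max b y.
Proof.
move=> y0; have [x xy] := sphere_point y0.
apply: lt_le_trans (g_min_gt0 y0) _; rewrite -xy.
exact: le_trans (g_min_le x) (g_max_ge x).
Qed.

End drift.

(** * Bounds for positive noise *)

Section mean_occupation.
Context {R : realType} {n : nat} {d : measure_display} {S : measurableType d}
  (P : probability S R) (Z : R -> S -> 'rV[R]_n).
Hypothesis mZ : forall t i, 0 <= t -> measurable_fun setT (fun w => Z t w ord0 i).

Lemma mean_soft_hit_le_occupation (T rm r h : R) N : 0 < h -> N%:R * h = T -> 0 < T -> rm < r ->
  ('E_P[fun w => soft_hit T rm r (Z ^~ w)] <= (\int[P]_w occupation Z h r N w)%:E)%E.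
Proof.
move=> h0 NhT T0 rmr; rewrite /Rintegral fineK; last first.
  exact/integrable_fin_num/(occupation_integrable P mZ)/ltW.
rewrite unlock; apply: ge0_le_integral_nonmeasurable => w _; rewrite lee_fin.
  exact: soft_hit_ge0.
exact: soft_hit_le_occupation.
Qed.

Hypothesis cZ : {ae P, forall w, continuous_path (Z ^~ w)}.

(** The comparison of [occupation_le_soft_hit] holds on an event E of probability
    close to 1 on which the paths oscillate little. The function a is a
    measurable function below soft_hit: the integral of soft_hit itself is only
    known to be monotone. *)
Lemma mean_occupation_le_soft_hit (T r r1 r2 eta : R) :
  0 < T -> 0 < r -> r < r1 -> r1 < r2 -> 0 < eta ->
  exists2 h0, 0 < h0 & forall (N : nat) (h : R), (0 < N)%N -> h = T / N%:R -> h <= h0 ->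
  ((\int[P]_w occupation Z h r N w)%:E <=
   'E_P[fun w => soft_hit T r1 r2 (Z ^~ w)] + eta%:E)%E.
Proof.
move=> T0 r0 rr1 r12 eta0.
pose K : R := n%:R * (2 * (1 + r) + 1) + 1.
have K'0 : 0 <= n%:R * (2 * (1 + r) + 1) by rewrite mulr_ge0//; lra.
have K0 : 0 < K by rewrite ltr_wpDl.
pose del := Num.min 1 ((r1 - r) / K).
have del0 : 0 < del by rewrite lt_min ltr01 divr_gt0// subr_gt0.
have del1 : del <= 1 by rewrite ge_min lexx.
have delK : del * (n%:R * (2 * (1 + r) + 1)) <= r1 - r.
  apply: (@le_trans _ _ (del * K)); first by rewrite ler_wpM2l ?(ltW del0)// lerDl.
  by rewrite -ler_pdivlMr// ge_min lexx orbT.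
have eta20 : 0 < eta / 2 by rewrite divr_gt0.
have eta1 : 0 < eta / 2 / T by rewrite divr_gt0.
have cZ' : {ae P, forall w, continuous_path (Z ^~ w) /\ True} by apply: filterS cZ.
have [h1 [E [h10 mE PE HE]]] := continuity_event mZ cZ' T0 del0 eta1.
exists (Num.min h1 (eta / 2)); first by rewrite lt_min h10.
move=> N h N0 hE; rewrite le_min => /andP[hh1 heta].
have N0' : 0 < N%:R :> R by rewrite ltr0n.
have h0 : 0 < h by rewrite hE divr_gt0.
have NhT : N%:R * h = T by rewrite hE mulrCA mulfV ?mulr1// gt_eqF.
pose occ := occupation Z h r N.
have occ0 w : 0 <= occ w by apply: occupation_ge0; exact: ltW.
have occT w : occ w <= T by exact: occupation_leT.
pose a w : R := \1_E w * Num.max 0 (occ w - h).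
have a0 w : 0 <= a w by rewrite mulr_ge0// le_max lexx.
have ma : measurable_fun setT a.
  apply: measurable_funM; first exact: measurable_indic.
  apply: measurable_maxr; first exact: measurable_cst.
  by apply: measurable_funB; [exact: (occupation_measurable mZ _ _ (ltW h0))|exact: measurable_cst].
have a_le : (\int[P]_w (a w)%:E <= 'E_P[fun w => soft_hit T r1 r2 (Z ^~ w)])%E.
  rewrite unlock; apply: ge0_le_integral_nonmeasurable => w _; rewrite lee_fin//.
  rewrite /a indicE; have [wE|wE] := pselect (E w); last first.
    by rewrite memNset// mul0r; exact: soft_hit_ge0.
  rewrite mem_set// mul1r ge_max soft_hit_ge0//= lerBlDr.
  apply: occupation_le_soft_hit => // s t sT tT st xs.
  have := sqnorm_perturb (ltW xs) (_ : 0 <= del <= 1) (fun i => _).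
  move=> /(_ (Z t w)); rewrite (ltW del0) del1 => /(_ isT) H.
  have {}H : `|sqnorm (Z t w) - sqnorm (Z s w)| <= del * (n%:R * (2 * (1 + r) + 1)).
    apply: H => i; have [_ HH] := HE w wE; rewrite distrC.
    by apply: HH => //; exact: le_trans hh1.
  by move: H; rewrite ler_norml => /andP[_ H]; lra.
pose k w : R := h + T * \1_(~` E) w.
have k0 w : 0 <= k w by rewrite addr_ge0 ?(ltW h0)// mulr_ge0// ltW.
have mk : measurable_fun setT k.
  apply: measurable_funD; first exact: measurable_cst.
  apply: measurable_funM; first exact: measurable_cst.
  by apply: measurable_indic; exact: measurableC.
have occ_le w : occ w <= a w + k w.
  rewrite /a /k !indicE; have [wE|wE] := pselect (E w).
    rewrite mem_set// memNset; last by apply.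
    by rewrite mul1r mulr0 addr0 -lerBlDr le_max lexx orbT.
  rewrite memNset// mem_set// mul0r mulr1 add0r.
  by apply: le_trans (occT w) _; rewrite lerDr ltW.
rewrite /Rintegral fineK; last first.
  exact/integrable_fin_num/(occupation_integrable P mZ)/ltW.
apply: (@le_trans _ _ (\int[P]_w ((a w)%:E + (k w)%:E))%E).
  apply: ge0_le_integral_nonmeasurable => w _; first by rewrite lee_fin; exact: occ0.
  by rewrite -EFinD lee_fin; exact: occ_le.
rewrite ge0_integralD//; last 4 first.
- by move=> w _; rewrite lee_fin.
- exact/measurable_EFinP.
- by move=> w _; rewrite lee_fin.
- exact/measurable_EFinP.
apply: leeD => //.
under eq_integral do rewrite EFinD EFinM.
rewrite ge0_integralD//; last 3 first.
- by move=> w _; rewrite lee_fin ltW.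
- by move=> w _; rewrite -EFinM lee_fin mulr_ge0// ltW.
- by apply/measurable_EFinP; apply: measurable_funM; [exact: measurable_cst|apply: measurable_indic; exact: measurableC].
have -> : (\int[P]_w (T%:E * (\1_(~` E) w)%:E) = T%:E * P (~` E))%E.
  rewrite ge0_integralZl_EFin ?integral_indic ?setIT//; first exact: measurableC.
  - by apply/measurable_EFinP; apply: measurable_indic; exact: measurableC.
  - exact: ltW.
rewrite integral_cst//.
rewrite [X in (_ * X + _)%E](_ : _ = 1%E); last exact: probability_setT.
rewrite mule1; apply: (@le_trans _ _ (h%:E + T%:E * (eta / 2 / T)%:E)%E).
  by rewrite leeD2l// lee_pmul2l// lte_fin.
rewrite -EFinM -EFinD lee_fin (_ : T * (eta / 2 / T) = eta / 2); first by lra.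
by field; rewrite gt_eqF.
Qed.

End mean_occupation.

Lemma fine_grid {R : realType} (T h0 : R) : 0 < T -> 0 < h0 ->
  exists N : nat, (0 < N)%N /\ T / N%:R <= h0.
Proof.
move=> T0 h00; exists (Num.bound (T / h0)).+1; split => //.
rewrite ler_pdivrMr// mulrC -ler_pdivrMr//.
apply: le_trans (ltW (archi_boundP _)) _; first by rewrite divr_ge0 ?ltW.
by rewrite ler_nat.
Qed.

Section noisy_bounds.
Context {R : realType} {n : nat} {d : measure_display} {S : measurableType d}
  (P : probability S R) (F : R -> set (set S)) (W : R -> S -> 'rV[R]_n).
Hypothesis usualF : usual_conditions P F.
Hypothesis brownianW : brownian_motion P F W.
Variable b : 'rV[R]_n -> 'rV[R]_n.
Hypothesis b_bounded : [bounded b x | x in [set: 'rV[R]_n]].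
Hypothesis b_A3 : condA3 b.
Hypothesis b_A5 : condA5 b.
Variable X : R -> R -> S -> 'rV[R]_n.
Hypothesis solX : forall eps : R, 0 < eps -> strong_solution P F W b eps (X eps).

Let mX eps : 0 < eps -> forall t i, 0 <= t -> measurable_fun setT (fun w => X eps t w ord0 i).
Proof. by move=> eps0 t i t0; exact: (solution_coord_measurable usualF (solX eps0) i t0). Qed.

(** [dynkin_grid] with c0 = -1 and U >= 0 bounds the mean occupation time by
    U 0, for every eps. *)
Lemma noisy_soft_hit_upper (eps T rm r r' : R) : 0 < eps -> 0 < T -> 0 < r -> rm < r -> r < r' ->
  ('E_P[fun w => soft_hit T rm r (X eps ^~ w)] <= int_inv (g_min b) r')%E.
Proof.
move=> eps0 T0 r0 rmr rr'; apply/lee_addgt0Pr => e e0.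
have [c [c4 [c0 c40 Hc]]] := @normal_moments R.
have [M M0 bM] := drift_coord_bound b_bounded.
have s0 : 0 < c * eps ^+ 2 by rewrite mulr_gt0// exprn_gt0.
have e2 : 0 < e / 2 by rewrite divr_gt0.
have [_ _ ifin] := A5_integrals b_A5 (lt_trans r0 rr').
have [U [p [dp [q [HU cq Hpq Hgen [U0 UI]]]]]] := upper_test_function
  (fun y => C1_continuous (A5_g_min_C1 b_A5)) (g_min_gt0 b_A3 b_A5) (dim_gt0 b_A3 b_A5)
  s0 r0 rr' e2 ifin (g_min_ge0 b_A3 0).
have pq x : p (sqnorm x) * (2 * dotv x (b x)) <= q (sqnorm x).
  by apply: Hpq; [exact: sqnorm_ge0|rewrite dotvC; exact: g_min_le].
have [h0 h00 Hh0] := dynkin_grid usualF brownianW c40 (ltW c0) Hc (A3_measurable b_A3) bM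
  eps0 (solX eps0) HU cq r0 T0 pq Hgen e2 (fun y ry => U0 y (le_trans (ltW r0) ry)).
have [N [N0 Nh0]] := fine_grid T0 h00.
have N0' : 0 < N%:R :> R by rewrite ltr0n.
have hp : 0 < T / N%:R by rewrite divr_gt0.
have NhT : N%:R * (T / N%:R) = T by rewrite mulrCA mulfV ?mulr1// gt_eqF.
apply: (le_trans (mean_soft_hit_le_occupation P (mX eps0) hp NhT T0 rmr)).
have := Hh0 N _ N0 erefl Nh0.
have : 0 <= \int[P]_w (alive_ind (X eps) (T / N%:R) r N w * U (sqnorm (X eps T w))).
  by apply: Rintegral_ge0 => w _; rewrite mulr_ge0 ?U0 ?sqnorm_ge0.
move=> H1 H2.
have H3 : \int[P]_w occupation (X eps) (T / N%:R) r N w <= U 0 + e / 2 by lra.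
apply: (@le_trans _ _ (U 0 + e / 2)%:E); first by rewrite lee_fin.
rewrite EFinD; apply: (le_trans (leeD2r (e / 2)%:E UI)).
by rewrite -addeA -EFinD -splitr.
Qed.

(** [dynkin_grid] with c0 = 1 bounds - L <= U on the paths that are alive at time T
    by - L plus the mean occupation time Q. Those paths have occupation time T,
    so their probability A satisfies T A <= Q, and L - eta <= Q (1 + L / T). *)
Lemma noisy_soft_hit_lower (r eta : R) : 0 < r -> 0 < eta -> (eta%:E < int_inv (g_max b) r)%E ->
  exists L : R, [/\ 0 < L, (int_inv (g_max b) r <= (L + eta)%:E)%E &
    exists2 eps1, 0 < eps1 & forall eps T r1 r2, 0 < eps -> eps <= eps1 ->
    0 < T -> r < r1 -> r1 < r2 ->
    (((L - eta) / (1 + L / T))%:E <= 'E_P[fun w => soft_hit T r1 r2 (X eps ^~ w)] + eta%:E)%E].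
Proof.
move=> r0 eta0 etaI.
have [c [c4 [c0 c40 Hc]]] := @normal_moments R.
have [M M0 bM] := drift_coord_bound b_bounded.
have [_ Imm ifin] := A5_integrals b_A5 r0.
have [U [p [dp [q [s0 [HU cq Hpq [s00 Hgen] [U0 Umin IU]]]]]]] := lower_test_function
  (fun y => C1_derivable (A5_g_max_C1 b_A5))
  (fun y y0 => C1_continuous_derive (A5_g_max_C1 b_A5) y0)
  (g_max_gt0 b_bounded b_A3 b_A5) n r0 eta0 (le_lt_trans Imm ifin).
set L := - U 0 in IU.
have L0 : 0 < L by have := lt_le_trans etaI IU; rewrite -EFinD lte_fin ltrDr.
exists L; split => //; exists (Num.min 1 (s0 / c)); first by rewrite lt_min ltr01 divr_gt0.
move=> eps T r1 r2 eps0; rewrite le_min => /andP[eps1 epss] T0 rr1 r12.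
have ss : 0 < c * eps ^+ 2 <= s0.
  rewrite mulr_gt0 ?exprn_gt0//= mulrC -ler_pdivlMr//.
  apply: le_trans epss; rewrite expr2 -[leRHS]mulr1 ler_wpM2l// ltW//.
have pq x : p (sqnorm x) * (2 * dotv x (b x)) <= q (sqnorm x).
  by apply: Hpq; [exact: sqnorm_ge0|rewrite dotvC; exact: g_max_ge].
have [h0 h00 Hh0] := dynkin_grid usualF brownianW c40 (ltW c0) Hc (A3_measurable b_A3) bM
  eps0 (solX eps0) HU cq r0 T0 pq (Hgen _ ss) eta0 U0.
have [h1 h10 Hh1] := mean_occupation_le_soft_hit (mX eps0) (solution_continuous (solX eps0))
  T0 r0 rr1 r12 eta0.
have hm0 : 0 < Num.min h0 h1 by rewrite lt_min h00.
have [N [N0]] := fine_grid T0 hm0; rewrite le_min => /andP[Nh0 Nh1].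
have N0' : 0 < N%:R :> R by rewrite ltr0n.
set h := T / N%:R in Nh0 Nh1.
have hp : 0 < h by rewrite divr_gt0.
have NhT : N%:R * h = T by rewrite mulrCA mulfV ?mulr1// gt_eqF.
apply: le_trans (Hh1 N h N0 erefl Nh1); rewrite lee_fin.
have := Hh0 N h N0 erefl Nh0.
set Q := \int[P]_w occupation (X eps) h r N w; rewrite mul1r => HQ.
pose A := \int[P]_w alive_ind (X eps) h r N w.
have iA := alive_ind_integrable P (mX eps0) r N (ltW hp).
have TA : T * A <= Q.
  rewrite /A -RintegralZl//; apply: le_Rintegral => //.
  - by apply: real_integrableZ.
  - exact: (occupation_integrable P (mX eps0) r N (ltW hp)).
  - by move=> w _; rewrite -NhT; exact: (occupation_ge _ _ _ _ (ltW hp)).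
have LA : - L * A <= \int[P]_w (alive_ind (X eps) h r N w * U (sqnorm (X eps T w))).
  rewrite /A -RintegralZl//; apply: le_Rintegral => //.
  - by apply: real_integrableZ.
  - exact: (alive_U_integrable usualF (solX eps0) r HU N (ltW hp) (ltW T0)).
  - move=> w _; rewrite /L opprK mulrC; apply: ler_wpM2l; first exact: ler0n.
    by apply: Umin; exact: sqnorm_ge0.
have L1 : 0 < 1 + L / T by rewrite addr_gt0// divr_gt0.
have AQ : L * A <= L * (Q / T) by rewrite ler_wpM2l ?(ltW L0)// ler_pdivlMr// mulrC.
have U0L : U 0 = - L by rewrite /L opprK.
rewrite U0L in HQ; rewrite ler_pdivrMr// mulrDr mulr1 (_ : Q * (L / T) = L * (Q / T)); last by ring.
by rewrite mulNr in LA; lra.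
Qed.

End noisy_bounds.

(** * Bounds for the limit process *)

Lemma limn_einf_sup_einfs {R : realType} (u : (\bar R)^nat) :
  limn_einf u = ereal_sup (range (einfs u)).
Proof. by rewrite limn_einf_lim; exact/cvg_lim/cvg_einfs_sup. Qed.

Lemma limn_einf_le {R : realType} (u : (\bar R)^nat) (a : \bar R) :
  (forall k, u k <= a)%E -> (limn_einf u <= a)%E.
Proof.
move=> ua; rewrite limn_einf_sup_einfs; apply: ge_ereal_sup => _ [k _ <-].
by rewrite /einfs /=; apply: ge_ereal_inf; exists (u k); [exists k => /=|exact: ua].
Qed.

(** If the liminf is finite, a truncation level above it shows that x is not
    truncated there. *)
Lemma le_limn_einf_truncations {R : realType} (x : \bar R) (u : (\bar R)^nat) :
  (forall k, mine x k.+1%:R%:E <= u k)%E -> (x <= limn_einf u)%E.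
Proof.
move=> xu; rewrite limn_einf_sup_einfs; set s := ereal_sup _.
have H k : (mine x k.+1%:R%:E <= s)%E.
  apply: (@le_trans _ _ (einfs u k)); last by apply: ereal_sup_ubound; exists k.
  apply: le_ereal_inf_tmp => _ [m /= km <-]; apply: le_trans (xu m).
  by rewrite le_min !ge_min lexx/= lee_fin ler_nat ltnS km orbT.
case E : s => [v| |]; last 2 first.
- exact: leey.
- have := H 0; rewrite E ge_min => /orP[//|].
  by rewrite leNgt ltNyr.
have := H (Num.bound `|v|); rewrite E ge_min => /orP[//|].
rewrite lee_fin leNgt => /negP[]; apply: le_lt_trans (ler_norm v) _.
have := archi_boundP (normr_ge0 v); move=> /lt_le_trans; apply.
by rewrite ler_nat.
Qed.

Lemma hitting_time_ge0 {R : realType} (y : R -> R) (r : R) : (0 <= hitting_time y r)%E.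
Proof. by apply: le_ereal_inf_tmp => _ [t [t0 _] <-]; rewrite lee_fin. Qed.

Section limit_bounds.
Context {R : realType} {n : nat} {d : measure_display} {S : measurableType d}
  (P : probability S R) (F : R -> set (set S)) (W : R -> S -> 'rV[R]_n).
Hypothesis usualF : usual_conditions P F.
Hypothesis brownianW : brownian_motion P F W.
Variable b : 'rV[R]_n -> 'rV[R]_n.
Hypothesis b_bounded : [bounded b x | x in [set: 'rV[R]_n]].
Hypothesis b_A3 : condA3 b.
Hypothesis b_A5 : condA5 b.
Variable X : R -> R -> S -> 'rV[R]_n.
Hypothesis solX : forall eps : R, 0 < eps -> strong_solution P F W b eps (X eps).
Context {d0 : measure_display} {S0 : measurableType d0} (P0 : probability S0 R)
  (X0 : R -> S0 -> 'rV[R]_n).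
Hypothesis X0_process : continuous_process X0.
Hypothesis X0_limit : zero_noise_limit P X P0 X0.

Let mX0 t i : 0 <= t -> measurable_fun setT (fun w => X0 t w ord0 i).
Proof.
move=> t0 _ B mB; rewrite setTI.
apply: (process_measurable X0_process t0 (B := (fun x : 'rV[R]_n => x ord0 i) @^-1` B)).
by apply: continuous_borel_preimage => //; exact: coord_continuous.
Qed.

Let tau0 (r : R) (w : S0) : \bar R := hitting_time (fun t => sqnorm (X0 t w)) r.

Lemma limit_soft_hit_upper (T rm r r' : R) : 0 < T -> 0 < r -> rm < r -> r < r' ->
  ('E_P0[fun w => soft_hit T rm r (X0 ^~ w)] <= int_inv (g_min b) r')%E.
Proof.
move=> T0 r0 rmr rr'; apply: (cvge_to_le (soft_hit_limit X0_limit T0 rmr)).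
near=> eps; apply: (noisy_soft_hit_upper usualF brownianW b_bounded b_A3 b_A5 solX) => //.
Unshelve. all: by end_near. Qed.

Lemma limit_soft_hit_lower (r eta : R) : 0 < r -> 0 < eta -> (eta%:E < int_inv (g_max b) r)%E ->
  exists L : R, [/\ 0 < L, (int_inv (g_max b) r <= (L + eta)%:E)%E &
    forall T r1 r2, 0 < T -> r < r1 -> r1 < r2 ->
    (((L - eta) / (1 + L / T) - eta)%:E <= 'E_P0[fun w => soft_hit T r1 r2 (X0 ^~ w)])%E].
Proof.
move=> r0 eta0 etaI.
have [L [L0 IL [eps1 eps10 H]]] :=
  noisy_soft_hit_lower usualF brownianW b_bounded b_A3 b_A5 solX r0 eta0 etaI.
exists L; split => // T r1 r2 T0 rr1 r12.
apply: (cvge_to_ge (soft_hit_limit X0_limit T0 r12)); near=> eps.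
rewrite EFinB leeBlDr//; apply: H => //.
by near: eps; exact: nbhs_right_le.
Unshelve. all: by end_near. Qed.

(** For r < r0 the soft hitting time of r0 bounds the hitting time from below.
    Its mean is at least (L - eta) / (1 + L / T) - eta, where L is close to the
    integral of 1 / g_max up to r and T is arbitrary: T tends to infinity, then
    eta to 0 and r to r0. *)
Lemma hitting_time_mean_ge (r0 : R) : 0 < r0 ->
  (int_inv (g_max b) r0 <= \int[P0]_w tau0 r0 w)%E.
Proof.
move=> r00; apply/lee_addgt0Pr => e e0.
have tau_ge0 : (0 <= \int[P0]_w tau0 r0 w)%E.
  by apply: integral_ge0 => w _; exact: hitting_time_ge0.
case V : (\int[P0]_w tau0 r0 w)%E => [v| |]; last 2 first.
- by rewrite addye// leey.
- by move: tau_ge0; rewrite V.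
have v0 : 0 <= v by move: tau_ge0; rewrite V lee_fin.
have e2 : 0 < e / 2 by rewrite divr_gt0.
have [del [del0 delr Hdel]] := int_inv_continuity (fun y => C1_continuous (A5_g_max_C1 b_A5))
  (g_max_gt0 b_bounded b_A3 b_A5) r00 e2.
pose r := r0 - del; have rp : 0 < r by rewrite subr_gt0.
have rr0 : r < r0 by rewrite ltrBlDr ltrDl.
have Ir : (int_inv (g_max b) r0 <= int_inv (g_max b) r + (e / 2)%:E)%E.
  by apply: Hdel; rewrite /r ?lexx ?lerBlDr ?lerDl ?(ltW del0).
have [Ipos Imm ifin] := A5_integrals b_A5 rp.
have Ifin : int_inv (g_max b) r \is a fin_num.
  by rewrite ge0_fin_numE ?(ltW Ipos)// (le_lt_trans Imm).
pose I := fine (int_inv (g_max b) r).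
have IE : int_inv (g_max b) r = I%:E by rewrite fineK.
have I0 : 0 < I by rewrite -lte_fin -IE.
pose eta := Num.min (e / 8) (I / 2).
have eta0 : 0 < eta by rewrite lt_min !divr_gt0.
have eta8 : eta <= e / 8 by rewrite ge_min lexx.
have etaI : (eta%:E < int_inv (g_max b) r)%E.
  by rewrite IE lte_fin; apply: (@le_lt_trans _ _ (I / 2)); [rewrite ge_min lexx orbT|lra].
have [L [L0 IL HL]] := limit_soft_hit_lower rp eta0 etaI.
have [r1 rr1 r1r0] : exists2 r1, r < r1 & r1 < r0 by exists ((r + r0) / 2); lra.
have soft T : 0 < T -> (L - eta) / (1 + L / T) - eta <= v.
  move=> T0; rewrite -lee_fin -V; apply: le_trans (HL T r1 r0 T0 rr1 r1r0) _.
  rewrite unlock; apply: ge0_le_integral_nonmeasurable => w _.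
    by rewrite lee_fin; exact: soft_hit_ge0.
  exact: soft_hit_le_hitting.
have Lv : L - eta <= v + eta.
  rewrite leNgt; apply/negP => Lv.
  pose D := L - eta - (v + eta); have D0 : 0 < D by rewrite subr_gt0.
  have vL : 0 < (v + eta) * L by rewrite mulr_gt0// ltr_wpDl.
  (* For this T the factor L / T costs half of the gap D. *)
  pose T := 2 * ((v + eta) * L) / D.
  have T0 : 0 < T by rewrite divr_gt0// mulr_gt0.
  have L1 : 0 < 1 + L / T by rewrite addr_gt0// divr_gt0.
  have := soft T T0; rewrite lerBlDr ler_pdivrMr// mulrDr mulr1.
  have -> : (v + eta) * (L / T) = D / 2.
    rewrite /T; field; rewrite gt_eqF//= gt_eqF//=.
    by rewrite gt_eqF// ltr_wpDl.
  by rewrite /D; lra.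
apply: (le_trans Ir); rewrite IE -!EFinD lee_fin.
by move: IL; rewrite IE lee_fin; lra.
Qed.

(** The hitting time capped at T is at most the occupation time of the ball of
    squared radius r0, which is measurable and whose mean is close to that of a
    soft hitting time with a slightly larger level. The indicator of a null set
    takes care of the paths that do not start at 0. *)
Lemma hitting_time_majorant (r0 T e : R) : 0 < r0 -> 0 < T -> 0 < e ->
  exists m : S0 -> \bar R, [/\ measurable_fun setT m, forall w, (0 <= m w)%E,
    forall w, (mine (tau0 r0 w) T%:E <= m w)%E &
    (\int[P0]_w m w <= int_inv (g_min b) r0 + e%:E)%E].
Proof.
move=> r00 T0 e0; have e2 : 0 < e / 2 by rewrite divr_gt0.
have [del [del0 delr Hdel]] := int_inv_continuity (fun y => C1_continuous (A5_g_min_C1 b_A5))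
  (g_min_gt0 b_A3 b_A5) r00 e2.
have Ir : (int_inv (g_min b) (r0 + del) <= int_inv (g_min b) r0 + (e / 2)%:E)%E.
  by apply: Hdel; rewrite ?lexx ?lerBlDr ?lerDl ?(ltW del0).
have [r1 rr1 r1d] : exists2 r1, r0 < r1 & r1 < r0 + del by exists (r0 + del / 2); lra.
have [r2 r12 r2d] : exists2 r2, r1 < r2 & r2 < r0 + del by exists ((r1 + (r0 + del)) / 2); lra.
have r20 : 0 < r2 by lra.
have cX0 : {ae P0, forall w, continuous_path (X0 ^~ w)}.
  by apply: aeW => w; exact: (process_continuous X0_process).
have [h0 h00 Hh0] := mean_occupation_le_soft_hit mX0 cX0 T0 r00 rr1 r12 e2.
have [N [N0 Nh0]] := fine_grid T0 h00.
have N0' : 0 < N%:R :> R by rewrite ltr0n.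
set h := T / N%:R in Nh0.
have hp : 0 < h by rewrite divr_gt0.
have NhT : N%:R * h = T by rewrite mulrCA mulfV ?mulr1// gt_eqF.
have [Z [mZ PZ subZ]] : {ae P0, forall w, X0 0 w = 0}.
  apply: (limit_start X0_limit (process_measurable X0_process)) => eps eps0.
  exact: (solution_start brownianW (solX eps0)).
pose occ := occupation X0 h r0 N.
have mocc : measurable_fun setT (fun w => (occ w)%:E).
  by apply/measurable_EFinP; exact: (occupation_measurable mX0 _ _ (ltW hp)).
have occ0 w : (0 <= (occ w)%:E)%E by rewrite lee_fin; apply: occupation_ge0; exact: ltW.
have m1 : measurable_fun setT (fun w => (\1_Z w : R)%:E).
  by apply/measurable_EFinP; exact: measurable_indic.
exists (fun w => (occ w)%:E + T%:E * (\1_Z w)%:E)%E; split.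
- by apply: emeasurable_funD => //; apply: emeasurable_funM => //; exact: measurable_cst.
- by move=> w; rewrite adde_ge0// -EFinM lee_fin mulr_ge0// ltW.
- move=> w; rewrite indicE; have [wZ|wZ] := pselect (Z w).
    rewrite mem_set// mule1 ge_min; apply/orP; right.
    by rewrite leeDr.
  rewrite memNset// mule0 adde0; apply: hitting_le_occupation => //.
    exact: (process_continuous X0_process).
  by apply: contrapT => H; apply: wZ; apply: subZ.
- rewrite ge0_integralD//; last 2 first.
  + by move=> w _; rewrite -EFinM lee_fin mulr_ge0// ltW.
  + by apply: emeasurable_funM => //; exact: measurable_cst.
  have -> : (\int[P0]_w (T%:E * (\1_Z w)%:E) = 0)%E.
    rewrite ge0_integralZl_EFin ?integral_indic ?setIT ?(ltW T0)//.
    by apply/eqP; rewrite mule_eq0; apply/orP; right; apply/eqP; exact: PZ.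
  rewrite adde0; have := Hh0 N h N0 erefl Nh0.
  rewrite /Rintegral fineK; last first.
    exact/integrable_fin_num/(occupation_integrable _ mX0)/ltW.
  move/le_trans; apply.
  apply: (@le_trans _ _ (int_inv (g_min b) (r0 + del) + (e / 2)%:E)%E).
    by apply: leeD2r; exact: limit_soft_hit_upper.
  by apply: le_trans (leeD2r _ Ir) _; rewrite -addeA -EFinD -splitr.
Qed.

(** Fatou's lemma for the measurable majorants of the hitting time capped at
    1, 2, 3, ... *)
Lemma hitting_time_mean_le (r0 : R) : 0 < r0 ->
  (\int[P0]_w tau0 r0 w <= int_inv (g_min b) r0)%E.
Proof.
move=> r00; apply/lee_addgt0Pr => e e0.
have /choice[m Hm] (k : nat) := hitting_time_majorant r00 (ltr0Sn R k) e0.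
apply: (@le_trans _ _ (\int[P0]_w limn_einf (fun k => m k w))%E).
  apply: ge0_le_integral_nonmeasurable => w _; first exact: hitting_time_ge0.
  by apply: le_limn_einf_truncations => k; have [_ _ + _] := Hm k; exact.
apply: le_trans (fatou P0 measurableT (f := m) _ _) _.
- by move=> k; have [] := Hm k.
- by move=> k w _; have [_ + _ _] := Hm k; exact.
- by apply: limn_einf_le => k; have [] := Hm k.
Qed.

End limit_bounds.

Unset Implicit Arguments.

Theorem theorem7p3 (R : realType) (n : nat)
    (d : measure_display) (S : measurableType d) (P : probability S R)
    (F : R -> set (set S)) (W : R -> S -> 'rV[R]_n)
    (usualF : usual_conditions P F)
    (brownianW : brownian_motion P F W)
    (b : 'rV[R]_n -> 'rV[R]_n)
    (b_bounded : [bounded b x | x in [set: 'rV[R]_n]])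
    (b_A3 : condA3 b) (b_A5 : condA5 b)
    (X : R -> R -> S -> 'rV[R]_n)
    (solX : forall eps : R, 0 < eps -> strong_solution P F W b eps (X eps))
    (d0 : measure_display) (S0 : measurableType d0) (P0 : probability S0 R)
    (X0 : R -> S0 -> 'rV[R]_n)
    (X0_process : continuous_process X0)
    (X0_limit : zero_noise_limit P X P0 X0)
    (Y0 : R -> S0 -> R) (Y0E : forall t w, Y0 t w = sqnorm (X0 t w))
    (r0 : R) (r0_gt0 : 0 < r0)
    (tau0 : S0 -> \bar R) (tau0E : forall w, tau0 w = hitting_time (Y0 ^~ w) r0) :
  [/\ (int_inv (g_max b) r0 <= \int[P0]_w tau0 w)%E,
      (\int[P0]_w tau0 w <= int_inv (g_min b) r0)%E &
      (int_inv (g_min b) r0 < +oo)%E].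
Proof.
have tauE : (\int[P0]_w tau0 w = \int[P0]_w hitting_time (fun t => sqnorm (X0 t w)) r0)%E.
  apply: eq_integral => w _; rewrite tau0E; congr (hitting_time _ r0).
  by apply/funext => t; rewrite Y0E.
rewrite tauE; split.
- exact: (hitting_time_mean_ge usualF brownianW b_bounded b_A3 b_A5 solX X0_limit r0_gt0).
- exact: (hitting_time_mean_le usualF brownianW b_bounded b_A3 b_A5 solX X0_process X0_limit r0_gt0).
- by have [] := A5_integrals b_A5 r0_gt0.
Qed.
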